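(* Star Decomposition is in XP with respect to the vertex cover number $\mathrm{vc}$ of the input graph. More precisely, if a vertex cover of size $\mathrm{vc}$ of the $n$-vertex input graph is given, then Star Decomposition can be solved in time $O\big((n+5^{\mathrm{vc}})^{5^{\mathrm{vc}}}\, n^{\mathrm{vc}}\big)$.
   Context: Star Decomposition problem: given a simple graph $G=(V,E)$ and vectors of positive integers $\mathbf{s}=(s_1,\ldots,s_d)$ (distinct star lengths) and $\mathbf{a}=(a_1,\ldots,a_d)$ (multiplicities) with $\sum_i a_is_i=|E|$, decide whether $E$ can be partitioned into the edge sets of subgraphs each isomorphic to a star $K_{1,\ell}$, with exactly $a_i$ of them isomorphic to $K_{1,s_i}$ for each $i\in[d]$. *)

(* Defs.v *)
From mathcomp Require Import all_boot.

Set Implicit Arguments.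
Unset Strict Implicit.
Unset Printing Implicit Defensive.

Record sgraph (V : finType) := SGraph {
  adj :> rel V;
  adj_sym : symmetric adj;
  adj_irr : irreflexive adj
}.

Definition edges (V : finType) (G : sgraph V) : {set {set V}} :=
  [set [set p.1; p.2] | p : V * V & G p.1 p.2].

Definition vertex_cover (V : finType) (G : sgraph V) (C : {set V}) : bool :=
  [forall x, forall y, G x y ==> (x \in C) || (y \in C)].

Definition vc (V : finType) (G : sgraph V) : nat :=
  #|[arg min_(C < [set: V] | vertex_cover G C) #|C| ]|.

Definition star_rel (l : nat) : rel 'I_l.+1 :=
  fun x y => (x == ord0) (+) (y == ord0).

Fact star_rel_sym l : symmetric (@star_rel l).
Proof. by move=> x y; rewrite /star_rel addbC. Qed.

Fact star_rel_irr l : irreflexive (@star_rel l).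
Proof. by move=> x; rewrite /star_rel addbb. Qed.

(* K_{1,l}, with centre ord0. *)
Definition star (l : nat) : sgraph 'I_l.+1 :=
  SGraph (@star_rel_sym l) (@star_rel_irr l).

(* F is the edge set of a graph on vertices of V that is isomorphic to H. *)
Definition edge_set_of_copy (V W : finType) (H : sgraph W)
    (F : {set {set V}}) : bool :=
  [exists f : {ffun W -> V},
     injectiveb f && (F == [set f @: e | e : {set W} in edges H])].

Record instance := Instance {
  nv : nat;
  graph : sgraph 'I_nv;
  dim : nat;
  lens : dim.-tuple nat;
  mults : dim.-tuple nat;
  lens_gt0 : forall i, 0 < tnth lens i;
  mults_gt0 : forall i, 0 < tnth mults i;
  lens_uniq : uniq lens;
  sum_lens : \sum_(i < dim) tnth mults i * tnth lens i = #|edges graph|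
}.

Definition star_decomposable (x : instance) : Prop :=
  exists P : {set {set {set 'I_(nv x)}}},
    [/\ partition P (edges (graph x)),
        forall F, F \in P -> exists l, edge_set_of_copy (star l) F
      & forall i : 'I_(dim x),
          #|[set F in P | edge_set_of_copy (star (tnth (lens x) i)) F]|
            = tnth (mults x) i].

(* Unit-cost RAM over the natural numbers with registers
   and an indirectly addressed memory.  Multiplication is not primitive: with
   addition and truncated subtraction only, a word gains at most one bit per
   step, so unit cost stays polynomially related to Turing machine time. *)

(* r, a, b are register numbers, standing for the contents of the register;
   c and l are literals. *)
Inductive instr :=
| IConst of nat & nat         (* IConst r c : r := c *)
| IAdd of nat & nat & nat     (* IAdd r a b : r := a + b *)
| ISub of nat & nat & nat     (* ISub r a b : r := a - b, truncated at 0 *)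
| IRead of nat & nat          (* IRead r a  : r := mem[a] *)
| IWrite of nat & nat         (* IWrite a b : mem[a] := b *)
| IJumpz of nat & nat.        (* IJumpz r l : if r = 0 then goto line l *)

Definition program := seq instr.

Record config := Config { pc : nat; reg : nat -> nat; mem : nat -> nat }.

Definition upd (f : nat -> nat) (k v : nat) : nat -> nat :=
  fun j => if j == k then v else f j.

Definition exec (i : instr) (c : config) : config :=
  let: Config l R M := c in
  match i with
  | IConst r v => Config l.+1 (upd R r v) M
  | IAdd r a b => Config l.+1 (upd R r (R a + R b)) M
  | ISub r a b => Config l.+1 (upd R r (R a - R b)) M
  | IRead r a => Config l.+1 (upd R r (M (R a))) M
  | IWrite a b => Config l.+1 R (upd M (R a) (R b))
  | IJumpz r l' => Config (if R r == 0 then l' else l.+1) R M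
  end.

(* The machine halts by leaving the program text; a halted configuration is a
   fixed point of step. *)
Definition halted (p : program) (c : config) : bool := size p <= pc c.

Definition step (p : program) (c : config) : config :=
  if onth p (pc c) is Some i then exec i c else c.

Definition init (w : seq nat) : config :=
  Config 0 (fun=> 0) (fun k => nth 0 w k).

Definition run (p : program) (w : seq nat) (t : nat) : config :=
  iter t (step p) (init w).

(* Register 0 is the output register. *)
Definition decides_within (p : program) (w : seq nat) (Q : Prop) (t : nat) :
    Prop :=
  halted p (run p w t) /\ (reg (run p w t) 0 <> 0 <-> Q).

Definition computable (f : nat -> nat) : Prop :=
  exists p : program, forall k : nat, exists t : nat,
    halted p (run p [:: k] t) /\ reg (run p [:: k] t) 0 = f k.

(* Total number of bits of the words of w. *)
Definition bitsize (w : seq nat) : nat := \sum_(v <- w) (trunc_log 2 v).+1.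

(* The problem L on objects of type A, presented to the machine through enc,
   is slice-wise polynomial for the parameter kappa. *)
Definition in_XP (A : Type) (enc : A -> seq nat) (kappa : A -> nat)
    (L : A -> Prop) : Prop :=
  exists (p : program) (f g : nat -> nat),
    [/\ computable f, computable g
      & forall x : A,
          decides_within p (enc x) (L x)
            (f (kappa x) * bitsize (enc x) ^ g (kappa x))].

(* The number of vertices, the adjacency matrix row by row, and the two vectors
   preceded by their common length. *)
Definition encode (x : instance) : seq nat :=
  nv x ::
    [seq nat_of_bool (graph x u v) | u <- enum 'I_(nv x),
                                     v <- enum 'I_(nv x)]
    ++ dim x :: lens x ++ mults x.

Definition encode_with_cover (x : instance) (C : {set 'I_(nv x)}) :
    seq nat :=
  #|C| :: [seq val u | u <- enum C] ++ encode x.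

(* Main.v *)
(** A star decomposition amounts to choosing for every edge which end is the
    centre of its star, and for every star a centre, so that the lengths of the
    stars centred at v add up to the number of edges centred at v.  Fix a cover
    C of size k.  A vertex outside C centres only stars of length at most k, so
    2k counters suffice: for c in C, the number of edges at c centred at their
    other end plus the total length of the stars centred at c, which must be
    the degree of c; and for l <= k the number of stars of length l that have
    received a centre, which must be the multiplicity of l.
    By Kronecker substitution with Q = 2 (k+1)^2 n, the counters become the
    digits of an exponent in base Q, and the numbers of ways of reaching all
    the exponents become the digits in base 2^Q of a single natural number,
    which acquires one factor for each vertex and each star.  The answer is the
    digit at the target exponent, and it is found in time O(Q^(4k+2)).
    If no cover is given, a greedy maximal matching yields one of size at most
    twice the minimum. *)

Require Import Defs.
From mathcomp Require Import all_boot.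
From mathcomp Require Import zify.

Set Implicit Arguments.
Unset Strict Implicit.
Unset Printing Implicit Defensive.

(** * A structured language compiled to the machine *)

(** The vertices outside the cover must balance their degrees too, but they are too many to own a
    digit each. Their constraint is local, so an auxiliary variable Z of degree at most k tracks it:
    each vertex multiplies a polynomial in Z by its own factors, after which a single coefficient is
    kept. The same device makes every star take exactly one centre. The value of Q serves twice: Q
    exceeds all counters, so that digits never carry, and it exceeds the number of binary factors,
    so that each exponent is reached in fewer than 2^Q ways. The weights are powers of Q from the
    first on, never the zeroth; all exponents are then multiples of Q, and the coefficient at one
    exponent cannot spill into the next. Exponents stay below J = Q^(2k+1), and the final number has
    at most J bits. Without multiplication a factor 2^a costs a doublings; isolating the digit takes
    up to J shifts of this kind, whence J^2 = Q^(4k+2). *)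

Definition state : Type := (nat -> nat) * (nat -> nat).

(* Compiled code assumes that rZero contains 0, so that IJumpz rZero jumps
   unconditionally, and every loop overwrites rUnit. *)
Definition rOut := 0.
Definition rZero := 1.
Definition rUnit := 2.

(* In If r a b, the branch a is taken if r is nonzero.  Loop r a repeats a while
   counting r down to 0; a may read r but not write it. *)
Inductive cmd :=
| Prim of instr
| Seq of cmd & cmd
| If of nat & cmd & cmd
| Loop of nat & cmd.

Declare Scope cmd_scope.
Delimit Scope cmd_scope with cmd.
Bind Scope cmd_scope with cmd.
Notation "c1 ;; c2" := (Seq c1 c2) (at level 60, right associativity) : cmd_scope.
Coercion Prim : instr >-> cmd.

Definition prim (i : instr) (s : state) : state :=
  let c := exec i (Config 0 s.1 s.2) in (reg c, Defs.mem c).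

Definition decr (r : nat) (s : state) : state :=
  prim (ISub r r rUnit) (prim (IConst rUnit 1) s).

Fixpoint sem (c : cmd) (s : state) : state :=
  match c with
  | Prim i => prim i s
  | Seq a b => sem b (sem a s)
  | If r a b => if s.1 r == 0 then sem b s else sem a s
  | Loop r a => iter (s.1 r) (fun s' => decr r (sem a s')) s
  end.

(** The extra terms count the instructions added by [comp]: a test, and after a nonzero branch the
    jump over the other one; in each round of a loop the test, the two instructions of the decrement
    and the jump back; and the last test, which exits. *)
Fixpoint cost (c : cmd) (s : state) : nat :=
  match c with
  | Prim i => 1
  | Seq a b => cost a s + cost b (sem a s)
  | If r a b => if s.1 r == 0 then (cost b s).+1 else (cost a s).+2
  | Loop r a =>
      (\sum_(i < s.1 r)
         (cost a (iter i (fun s' => decr r (sem a s')) s) + 4)).+1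
  end.

Fixpoint len (c : cmd) : nat :=
  match c with
  | Prim i => 1
  | Seq a b => len a + len b
  | If r a b => len a + len b + 2
  | Loop r a => len a + 4
  end.

(** Jump targets are absolute, hence the parameter [l], the line at which the code will stand. *)
Fixpoint comp (l : nat) (c : cmd) : program :=
  match c with
  | Prim i => [:: i]
  | Seq a b => comp l a ++ comp (l + len a) b
  | If r a b =>
      IJumpz r (l + len a + 2)
        :: comp l.+1 a ++ IJumpz rZero (l + len a + len b + 2)
        :: comp (l + len a + 2) b
  | Loop r a =>
      IJumpz r (l + len a + 4)
        :: comp l.+1 a
        ++ [:: IConst rUnit 1; ISub r r rUnit; IJumpz rZero l]
  end.

Definition writes_reg (i : instr) : option nat :=
  match i with
  | IConst r _ | IAdd r _ _ | ISub r _ _ | IRead r _ => Some r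
  | _ => None
  end.

Definition is_jump (i : instr) := if i is IJumpz _ _ then true else false.
Definition is_write (i : instr) := if i is IWrite _ _ then true else false.

Fixpoint wr (c : cmd) : seq nat :=
  match c with
  | Prim i => seq_of_opt (writes_reg i)
  | Seq a b => wr a ++ wr b
  | If r a b => wr a ++ wr b
  | Loop r a => [:: r, rUnit & wr a]
  end.

(** A counter that the body leaves alone fixes the number of rounds on entry, which makes the [iter]
    in [sem] faithful to the machine; an unwritten [rZero] keeps the jumps on it unconditional. *)
Fixpoint wf (c : cmd) : bool :=
  match c with
  | Prim i => ~~ is_jump i && (writes_reg i != Some rZero)
  | Seq a b => wf a && wf b
  | If r a b => wf a && wf b
  | Loop r a => [&& wf a, r \notin wr a, r != rZero & r != rUnit]
  end.

Lemma len_comp c l : size (comp l c) = len c.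
Proof.
elim: c l => [i|a IHa b IHb|r a IHa b IHb|r a IHa] l //=.
- by rewrite size_cat IHa IHb.
- rewrite size_cat /= IHa IHb; lia.
- by rewrite size_cat /= IHa !addnS addn0.
Qed.

Lemma prim_frame i s r :
  r \notin seq_of_opt (writes_reg i) -> (prim i s).1 r = s.1 r.
Proof.
by case: i => [r' v|r' a b|r' a b|r' a|a b|r' l] //=;
  rewrite inE /upd => /negPf->.
Qed.

Lemma decr_frame r s q : q != r -> q != rUnit -> (decr r s).1 q = s.1 q.
Proof. by rewrite /= /upd => /negPf-> /negPf->. Qed.

Lemma decr_self r s : r != rUnit -> (decr r s).1 r = (s.1 r).-1.
Proof. by rewrite /= /upd => /negPf h; rewrite !eqxx h subn1. Qed.

Lemma sem_frame c s r : r \notin wr c -> (sem c s).1 r = s.1 r.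
Proof.
elim: c s => [i|a IHa b IHb|q a IHa b IHb|q a IHa] s /=.
- exact: prim_frame.
- by rewrite mem_cat negb_or => /andP[ra rb]; rewrite IHb ?IHa.
- by rewrite mem_cat negb_or => /andP[ra rb]; case: ifP => _; rewrite ?IHb ?IHa.
- rewrite !inE !negb_or => /and3P[rq ru ra].
  by elim: (s.1 q) => // n IHn; rewrite iterS decr_frame // IHa.
Qed.

Lemma sem_zero c s : wf c -> (sem c s).1 rZero = s.1 rZero.
Proof.
elim: c s => [i|a IHa b IHb|q a IHa b IHb|q a IHa] s /=.
- by case: i => [r v|r a b|r a b|r a|a b|r l] //=;
    rewrite /upd -[_ != _]/(r != rZero) eq_sym => /negPf->.
- by case/andP=> ra rb; rewrite IHb ?IHa.
- by case/andP=> ra rb; case: ifP => _; rewrite ?IHb ?IHa.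
- case/and4P=> wa _ qz _; elim: (s.1 q) => // n IHn.
  by rewrite iterS decr_frame ?IHa // eq_sym.
Qed.

Lemma onth_pre (pre post : program) i :
  onth (pre ++ i :: post) (size pre) = Some i.
Proof. by elim: pre. Qed.

Lemma step_at p l R M i :
  onth p l = Some i -> step p (Config l R M) = exec i (Config l R M).
Proof. by rewrite /step /= => ->. Qed.

(** The code sits between arbitrary [pre] and [post] so that the induction applies to subcommands in
    place; the number of steps is exact so that runs compose by [iterD]. *)
Lemma iter_comp c pre post s : wf c -> s.1 rZero = 0 ->
  iter (cost c s) (step (pre ++ comp (size pre) c ++ post))
       (Config (size pre) s.1 s.2)
  = Config (size pre + len c) (sem c s).1 (sem c s).2.
Proof.
elim: c pre post s => [i|a IHa b IHb|r a IHa b IHb|r a IHa] pre post s /=.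
- move=> /andP[nj _] z0; rewrite (step_at _ _ (onth_pre _ _ _)).
  by case: i nj => //=; rewrite addn1.
- move=> /andP[wa wb] z0; rewrite addnC iterD.
  rewrite -catA IHa // addnA.
  have := IHb (pre ++ comp (size pre) a) post (sem a s) wb.
  rewrite size_cat len_comp -!catA; apply.
  by rewrite sem_zero.
- move=> /andP[wa wb] z0.
  set p := pre ++ _.
  have onp : onth p (size pre) = Some (IJumpz r (size pre + len a + 2)).
    exact: onth_pre.
  case: ifP => r0.
    rewrite iterSr (step_at _ _ onp) /= r0.
    have := IHb (pre ++ IJumpz r (size pre + len a + 2) :: comp (size pre).+1 a
      ++ [:: IJumpz rZero (size pre + len a + len b + 2)]) post s wb z0.
    rewrite !size_cat /= size_cat len_comp /=.
    have -> : size pre + (len a + 1).+1 = size pre + len a + 2 by lia.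
    rewrite /p -?catA /= -?catA /= => ->.
    by congr Config; lia.
  rewrite iterSr (step_at _ _ onp) /= r0 -/(iter _ _ _).
  have := IHa (pre ++ [:: IJumpz r (size pre + len a + 2)])
     (IJumpz rZero (size pre + len a + len b + 2)
        :: comp (size pre + len a + 2) b ++ post) s wa z0.
  rewrite !size_cat /= addn1 -?catA /= /p -?catA /= -?catA /= => ->.
  rewrite (@step_at _ _ _ _ (IJumpz rZero (size pre + len a + len b + 2))).
    by rewrite /= sem_zero // z0 /=; congr Config; lia.
  set l := (size pre).+1 + len a.
  have -> : l = size (pre ++ IJumpz r (size pre + len a + 2)
                          :: comp (size pre).+1 a).
    by rewrite size_cat /= len_comp /l; lia.
  rewrite -[X in onth X _]/(pre ++ (IJumpz r (size pre + len a + 2)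
      :: comp (size pre).+1 a) ++ _).
  by rewrite catA onth_pre.
- case/and4P=> wa ra rz ru; set p := pre ++ _; rewrite -iterS.
  move En: (s.1 r) => n; elim: n s En => [|n IHn] s En z0.
    rewrite big_ord0 /= (step_at _ _ (onth_pre _ _ _)) /= En /=.
    by congr Config; lia.
  rewrite big_ord_recl -addnS.
  under eq_bigr do rewrite lift0 iterSr.
  set s1 := decr r (sem a s).
  have En1 : s1.1 r = n by rewrite decr_self // sem_frame // En.
  have z1 : s1.1 rZero = 0 by rewrite decr_frame ?sem_zero // eq_sym.
  (* One round is split off: test, body, decrement and jump back lead to [s1] at the same line with
     counter [n], where the induction hypothesis takes over. *)
  rewrite addnC iterD [iter n.+1 _ s]iterSr -/s1 -IHn //; congr iter.
  rewrite addn4 iterSr (step_at _ _ (onth_pre _ _ _)) /= En /=.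
  have := IHa (pre ++ [:: IJumpz r (size pre + len a + 4)])
     ([:: IConst rUnit 1; ISub r r rUnit; IJumpz rZero (size pre)] ++ post)
     s wa z0.
  rewrite !size_cat /= addn1 -?catA /= /p -?catA /= => ->.
  set l := (size pre).+1 + len a.
  set q := pre ++ _.
  pose pr := pre ++ IJumpz r (size pre + len a + 4) :: comp (size pre).+1 a.
  have El : l = size pr by rewrite size_cat /= len_comp /l; lia.
  have Eq : q = pr ++ [:: IConst rUnit 1, ISub r r rUnit, IJumpz rZero (size pre) & post].
    by rewrite /q /pr -?catA.
  rewrite (@step_at _ _ _ _ (IConst rUnit 1)); last by rewrite Eq El onth_pre.
  rewrite /= (@step_at _ _ _ _ (ISub r r rUnit)); last first.
    have -> : l.+1 = size (rcons pr (IConst rUnit 1)) by rewrite size_rcons El.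
    by rewrite Eq -cat_rcons onth_pre.
  rewrite /= (@step_at _ _ _ _ (IJumpz rZero (size pre))); last first.
    have -> : l.+2 = size (rcons (rcons pr (IConst rUnit 1)) (ISub r r rUnit)).
      by rewrite !size_rcons El.
    by rewrite Eq -2!cat_rcons onth_pre.
  have /= := z1; rewrite /= => ->.
  by rewrite eqxx.
Qed.

Definition compile (c : cmd) : program := comp 0 c.

Definition start (w : seq nat) : state := ((fun=> 0), (fun k => nth 0 w k)).

Lemma halted_iter p c t t' :
  halted p (iter t (step p) c) -> t <= t' ->
  iter t' (step p) c = iter t (step p) c.
Proof.
move=> h /subnK <-; elim: (t' - t) => // m IHm.
rewrite addSn iterS IHm /step onth_default //.
Qed.

Lemma run_compile c w t : wf c -> cost c (start w) <= t ->
  halted (compile c) (run (compile c) w t) /\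
  reg (run (compile c) w t) =1 (sem c (start w)).1.
Proof.
move=> wc ct; have /= := @iter_comp c [::] [::] (start w) wc erefl.
rewrite cats0 add0n -/(compile c) => E.
have H : halted (compile c) (iter (cost c (start w)) (step (compile c)) (init w)).
  by rewrite /init E /halted /= len_comp.
rewrite /run (halted_iter H) //; split=> //.
by rewrite /init E.
Qed.

(** * Hoare triples with a time bound *)

Definition ok (c : cmd) (s : state) (t : nat) (P : state -> Prop) : Prop :=
  P (sem c s) /\ cost c s <= t.

Definition agree (w : seq nat) (s s' : state) : Prop :=
  forall r, r \notin w -> s'.1 r = s.1 r.

(** The frame condition [agree] follows from the syntax of [c], so postconditions need to mention
    only what [c] changes. *)
Lemma ok_weaken c s t t' (P P' : state -> Prop) :
  ok c s t P -> t <= t' ->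
  (forall s', agree (wr c) s s' -> P s' -> P' s') -> ok c s t' P'.
Proof.
move=> [p ct] tt pp; split; last exact: leq_trans tt.
by apply: pp => // r; apply: sem_frame.
Qed.

Lemma ok_le c s t t' (P : state -> Prop) : ok c s t P -> t <= t' -> ok c s t' P.
Proof. by move=> [p ct] tt; split=> //; apply: leq_trans tt. Qed.

Lemma ok_seq c1 c2 s t1 t2 (P1 P2 : state -> Prop) :
  ok c1 s t1 P1 ->
  (forall s', agree (wr c1) s s' -> P1 s' -> ok c2 s' t2 P2) ->
  ok (c1 ;; c2) s (t1 + t2) P2.
Proof.
move=> [p1 ct1] H; have [|//|p2 ct2] := H (sem c1 s).
  by move=> r; apply: sem_frame.
by split=> //=; apply: leq_add.
Qed.

Lemma ok_prim i c s t (P : state -> Prop) :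
  ok c (prim i s) t P -> ok (i ;; c) s t.+1 P.
Proof. by move=> [p ct]; split. Qed.

Lemma ok_prim1 i s (P : state -> Prop) : P (prim i s) -> ok i s 1 P.
Proof. by []. Qed.

Lemma ok_if r a b s t (P : state -> Prop) :
  (s.1 r != 0 -> ok a s t P) -> (s.1 r = 0 -> ok b s t P) ->
  ok (If r a b) s t.+2 P.
Proof.
rewrite /ok /=; case: eqP => [r0 _ /(_ r0)|_ /(_ isT)] [p ct] //.
by split=> //; lia.
Qed.

(** The invariant is indexed by the number of completed rounds and is read after the decrement. Each
    round also learns the value of the counter and that registers not written by the loop are
    unchanged since its start, so [I] does not have to carry either. *)
Lemma ok_loop r a s (t : nat -> nat) (I : nat -> state -> Prop) :
  r \notin wr a -> r != rUnit ->
  I 0 s ->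
  (forall i s', i < s.1 r -> agree (wr (Loop r a)) s s' -> s'.1 r = s.1 r - i ->
     I i s' -> ok a s' (t i) (fun s2 => I i.+1 (decr r s2))) ->
  ok (Loop r a) s (\sum_(i < s.1 r) (t i + 4)).+1 (I (s.1 r)).
Proof.
move=> ra ru I0 H; pose body s' := decr r (sem a s').
have K i : i <= s.1 r ->
    [/\ agree (wr (Loop r a)) s (iter i body s),
        (iter i body s).1 r = s.1 r - i & I i (iter i body s)].
  elim: i => [|i IHi] li; first by rewrite subn0.
  have [ag er ii] := IHi (ltnW li); have [I1 _] := H i _ li ag er ii.
  split=> //; last first.
    by rewrite iterS decr_self // sem_frame // er subnS.
  move=> q; rewrite !inE !negb_or => /and3P[qr qu qa].
  by rewrite iterS decr_frame // sem_frame // ag // !inE !negb_or qr qu.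
split; first by have [] := K _ (leqnn _).
rewrite /= ltnS; apply: leq_sum => i _; rewrite leq_add2r.
have [ag er ii] := K i (ltnW (ltn_ord i)).
by have [_] := H i _ (ltn_ord i) ag er ii.
Qed.

(** * Lists of weights and their generating functions *)

(* An operation ((a, t), b) multiplies a polynomial in Z by 2^a + Z^t 2^b; a block
   (ops, d) multiplies the coefficient of Z^0 by all its operations and moves the
   coefficient of Z^d to Z^0.  A list of pairs (z, w) stands for the polynomial
   with terms Z^z 2^w, see valz. *)
Definition op : Type := nat * nat * nat.
Definition block : Type := seq op * nat.

Definition stepL (L : seq (nat * nat)) (o : op) : seq (nat * nat) :=
  [seq (p.1, p.2 + o.1.1) | p <- L]
  ++ [seq (p.1 + o.1.2, p.2 + o.2) | p <- L].

Definition selL (d : nat) (L : seq (nat * nat)) : seq (nat * nat) :=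
  [seq (0, p.2) | p <- L & p.1 == d].

Definition runb (L : seq (nat * nat)) (b : block) :=
  selL b.2 (foldl stepL L b.1).

Definition runbs (bs : seq block) := foldl runb [:: (0, 0)] bs.

Definition valz (L : seq (nat * nat)) (z : nat) : nat :=
  \sum_(p <- L | p.1 == z) 2 ^ p.2.

Definition op_act (o : op) (A : nat -> nat) (z : nat) : nat :=
  A z * 2 ^ o.1.1 + (if o.1.2 <= z then A (z - o.1.2) * 2 ^ o.2 else 0).

Lemma valz_step L o z : valz (stepL L o) z = op_act o (valz L) z.
Proof.
rewrite /valz /stepL /op_act big_cat !big_map /=; congr (_ + _).
  by rewrite big_distrl /=; apply: eq_bigr => p _; rewrite expnD.
case: leqP => h; last first.
  by rewrite big_pred0 // => p; apply/eqP => e; move: h; rewrite -e; lia.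
rewrite big_distrl /=; apply: eq_big => [p|p _]; last by rewrite expnD.
by rewrite -[in LHS](subnK h) eqn_add2r.
Qed.

Lemma valz_sel L d z : valz (selL d L) z = if z == 0 then valz L d else 0.
Proof.
rewrite /valz /selL big_map big_filter_cond /=; case: (z =P 0) => [->|/eqP h].
  by apply: eq_bigl => p; rewrite andbT.
by rewrite big_pred0 // => p; rewrite [0 == z]eq_sym (negPf h) andbF.
Qed.

Lemma size_steps L ops : size (foldl stepL L ops) = size L * 2 ^ size ops.
Proof.
elim: ops L => [|o ops IH] L /=; first by rewrite muln1.
by rewrite IH size_cat !size_map expnS addnn -mul2n; lia.
Qed.

(** Each operation doubles the list and a selection only shrinks it. The bound serves to keep the
    number of ways below 2^Q, the base of the digits. *)
Lemma size_runbs bs : size (runbs bs) <= 2 ^ \sum_(b <- bs) size b.1.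
Proof.
rewrite -[X in _ <= X]mul1n -[X in X * _]/(size [:: (0, 0)]) /runbs.
elim: bs [:: _] => [|b bs IH] L /=; first by rewrite big_nil muln1.
apply: leq_trans (IH _) _; rewrite big_cons expnD mulnA leq_mul2r.
by rewrite size_map size_filter (leq_trans (count_size _ _)) ?size_steps ?orbT.
Qed.

(** * Reachable exponents *)

Fixpoint reach (ops : seq op) (z w : nat) : Prop :=
  if ops is o :: ops' then
    exists z' w', reach ops' z' w' /\
      ((z = z' /\ w = o.1.1 + w') \/ (z = o.1.2 + z' /\ w = o.2 + w'))
  else z = 0 /\ w = 0.

Lemma mem_stepL L o z w : (z, w) \in stepL L o <->
  exists z' w', (z', w') \in L /\
      ((z = z' /\ w = o.1.1 + w') \/ (z = o.1.2 + z' /\ w = o.2 + w')).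
Proof.
rewrite mem_cat; split=> [/orP[/mapP[[z' w'] h [-> ->]]|/mapP[[z' w'] h [-> ->]]]|].
- by exists z', w'; split=> //; left; rewrite addnC.
- by exists z', w'; split=> //; right; rewrite addnC [_ + w']addnC.
case=> z' [w' [h [[-> ->]|[-> ->]]]]; apply/orP; [left|right]; apply/mapP;
  by exists (z', w') => //=; rewrite ![_ + w']addnC // addnC.
Qed.

Lemma mem_steps L ops z w : (z, w) \in foldl stepL L ops <->
  exists z0 w0 z' w', [/\ (z0, w0) \in L, reach ops z' w', z = z0 + z' & w = w0 + w'].
Proof.
elim: ops L z w => [|o ops IH] L z w /=.
  split=> [h|[z0 [w0 [z' [w' [h [-> ->] -> ->]]]]]]; last by rewrite !addn0.
  by exists z, w, 0, 0; rewrite !addn0.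
rewrite IH; split.
  case=> z0 [w0 [z' [w' [/mem_stepL[z1 [w1 [h c]]] r -> ->]]]].
  case: c => [[-> ->]|[-> ->]].
    exists z1, w1, z', (o.1.1 + w'); split=> //; last lia.
    by exists z', w'; split=> //; left.
  exists z1, w1, (o.1.2 + z'), (o.2 + w'); split=> //; [|lia|lia].
  by exists z', w'; split=> //; right.
case=> z0 [w0 [z' [w' [h [z1 [w1 [r c]]] -> ->]]]].
case: c => [[-> ->]|[-> ->]].
  exists z0, (o.1.1 + w0), z1, w1; split=> //; last lia.
  by apply/mem_stepL; exists z0, w0; split=> //; left.
exists (o.1.2 + z0), (o.2 + w0), z1, w1; split=> //; [|lia|lia].
by apply/mem_stepL; exists z0, w0; split=> //; right.
Qed.

(** The exponents of the terms that survive all selections. Multiplicities are dropped, since the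
    answer depends only on whether a coefficient vanishes. *)
Fixpoint breach (bs : seq block) (w : nat) : Prop :=
  if bs is b :: bs' then
    exists w1 w2, [/\ reach b.1 b.2 w1, breach bs' w2 & w = w1 + w2]
  else w = 0.

Lemma mem_runbs bs z w : (z, w) \in runbs bs <-> z = 0 /\ breach bs w.
Proof.
(* Generalised from the initial list to any list of degree 0 in Z, the shape that every selection
   restores. *)
have K L : (forall p, p \in L -> p.1 = 0) ->
    (z, w) \in foldl runb L bs <->
    z = 0 /\ exists w0 w', [/\ (0, w0) \in L, breach bs w' & w = w0 + w'].
  elim: bs L => [|b bs IH] L L0 /=.
    split=> [h|[-> [w0 [w' [h -> ->]]]]]; last by rewrite addn0.
    have /= z0 := L0 _ h; split=> //; exists w, 0; split=> //.
      by rewrite -z0.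
    by rewrite addn0.
  rewrite IH; last by move=> p /mapP[q _ ->].
  split=> -[z0 [w0 [w' H]]]; split=> //.
    case: H => /mapP[[z1 w1]]; rewrite mem_filter /= => /andP[/eqP -> ].
    move=> /mem_steps[z2 [w2 [z3 [w3 [h r e ->]]]]] [->] bb ->.
    have /= z20 := L0 _ h; rewrite z20 add0n in h e; subst z3.
    exists w2, (w3 + w'); split=> //; last lia.
    by exists w3, w'.
  case: H => h [w1 [w2 [r br ->]]] ->.
  exists (w0 + w1), w2; split=> //; last lia.
  apply/mapP; exists (b.2, w0 + w1) => //; rewrite mem_filter eqxx /=.
  by apply/mem_steps; exists 0, w0, b.2, w1.
rewrite /runbs K; last by move=> p; rewrite inE => /eqP->.
split=> -[-> H]; split=> //.
  by case: H => w0 [w' []]; rewrite inE => /eqP[->] h ->.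
by exists 0, w; rewrite inE.
Qed.

Lemma reach_cat s1 s2 z w : reach (s1 ++ s2) z w <->
  exists z1 w1 z2 w2,
    [/\ reach s1 z1 w1, reach s2 z2 w2, z = z1 + z2 & w = w1 + w2].
Proof.
elim: s1 z w => [|o s1 IH] z w /=.
  split=> [h|[z1 [w1 [z2 [w2 [[-> ->] h -> ->]]]]]] //.
  by exists 0, 0, z, w.
split.
  case=> z' [w' [/IH[z1 [w1 [z2 [w2 [r1 r2 -> ->]]]]] c]].
  case: c => [[-> ->]|[-> ->]].
    exists z1, (o.1.1 + w1), z2, w2; split=> //; last lia.
    by exists z1, w1; split=> //; left.
  exists (o.1.2 + z1), (o.2 + w1), z2, w2; split=> //; try lia.
  by exists z1, w1; split=> //; right.
case=> z1 [w1 [z2 [w2 [[z' [w' [r1 c]]] r2 -> ->]]]].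
exists (z' + z2), (w' + w2); split; last by case: c; [left|right]; lia.
by apply/IH; exists z', w', z2, w2.
Qed.

(** Choices for different indices are independent and so combine into functions; [uniq r] allows
    these to be redefined at the head without disturbing the tail. *)
Lemma reach_flatten (I : eqType) (r : seq I) (s : I -> seq op) z w : uniq r ->
  reach (flatten [seq s i | i <- r]) z w <->
  exists Z W : I -> nat,
    [/\ forall i, i \in r -> reach (s i) (Z i) (W i),
        z = \sum_(i <- r) Z i & w = \sum_(i <- r) W i].
Proof.
elim: r z w => [|i r IH] z w /=.
  split=> [[-> ->]|[Z [W [_ -> ->]]]]; last by rewrite !big_nil.
  by exists (fun=> 0), (fun=> 0); rewrite !big_nil.
case/andP=> ir ur; split.
  case/reach_cat=> z1 [w1 [z2 [w2 [r1 /(IH _ _ ur)[Z [W [h -> ->]]] -> ->]]]].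
  have nir j : j \in r -> (j == i) = false.
    by move=> jr; apply/eqP => e; rewrite -e jr in ir.
  exists (fun j => if j == i then z1 else Z j),
         (fun j => if j == i then w1 else W j); split.
  - move=> j; rewrite inE; case: eqP => [-> //|_ /= jr]; exact: h.
  - by rewrite big_cons eqxx; congr (_ + _); apply: eq_big_seq => j /nir->.
  - by rewrite big_cons eqxx; congr (_ + _); apply: eq_big_seq => j /nir->.
case=> Z [W [h -> ->]]; apply/reach_cat; rewrite !big_cons.
exists (Z i), (W i), (\sum_(j <- r) Z j), (\sum_(j <- r) W j); split=> //.
  by apply: h; rewrite inE eqxx.
by apply/IH => //; exists Z, W; split=> // j jr; apply: h; rewrite inE jr orbT.
Qed.

(** Repeating an operation encodes a multiplicity: only the number [m] of copies that take the
    second option matters. *)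
Lemma reach_nseq k o z w : reach (nseq k o) z w <->
  exists m, [/\ m <= k, z = m * o.1.2 & w = (k - m) * o.1.1 + m * o.2].
Proof.
elim: k z w => [|k IH] z w /=.
  by split=> [[-> ->]|[m [m0 -> ->]]]; [exists 0 | move: m0; rewrite leqn0 => /eqP->].
split.
  case=> z' [w' [/IH[m [mk -> ->]] [[-> ->]|[-> ->]]]].
    exists m; split=> //; [lia|]; rewrite subSn //; lia.
  by exists m.+1; split=> //; rewrite subSS; lia.
case=> m [mk -> ->].
case: m mk => [|m] mk.
  exists 0, (k * o.1.1); split; last by left; lia.
  by apply/IH; exists 0; split=> //; lia.
exists (m * o.1.2), ((k - m) * o.1.1 + m * o.2); split; last by right; lia.
by apply/IH; exists m.
Qed.

Lemma breach_cat b1 b2 w : breach (b1 ++ b2) w <->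
  exists w1 w2, [/\ breach b1 w1, breach b2 w2 & w = w1 + w2].
Proof.
elim: b1 w => [|b b1 IH] w /=.
  by split=> [h|[w1 [w2 [-> h ->]]]] //; exists 0, w.
split.
  case=> w1 [w2 [h /IH[w3 [w4 [h3 h4 ->]]] ->]].
  by exists (w1 + w3), w4; split=> //; [exists w1, w3 | lia].
case=> w1 [w2 [[w3 [w4 [h3 h4 ->]]] h2 ->]].
exists w3, (w4 + w2); split=> //; last lia.
by apply/IH; exists w4, w2.
Qed.

Lemma breach_flatten (I : eqType) (r : seq I) (s : I -> seq block) w : uniq r ->
  breach (flatten [seq s i | i <- r]) w <->
  exists W : I -> nat,
    (forall i, i \in r -> breach (s i) (W i)) /\ w = \sum_(i <- r) W i.
Proof.
elim: r w => [|i r IH] w /=.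
  split=> [->|[W [_ ->]]]; last by rewrite !big_nil.
  by exists (fun=> 0); rewrite !big_nil.
case/andP=> ir ur; split.
  case/breach_cat=> w1 [w2 [r1 /(IH _ ur)[W [h ->]] ->]].
  have nir j : j \in r -> (j == i) = false.
    by move=> jr; apply/eqP => e; rewrite -e jr in ir.
  exists (fun j => if j == i then w1 else W j); split.
  - move=> j; rewrite inE; case: eqP => [-> //|_ /= jr]; exact: h.
  - by rewrite big_cons eqxx; congr (_ + _); apply: eq_big_seq => j /nir->.
case=> W [h ->]; apply/breach_cat; rewrite !big_cons.
exists (W i), (\sum_(j <- r) W j); split=> //.
  by apply: h; rewrite inE eqxx.
by apply/IH => //; exists W; split=> // j jr; apply: h; rewrite inE jr orbT.
Qed.

Lemma breach_map (I : eqType) (r : seq I) (s : I -> block) w : uniq r ->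
  breach [seq s i | i <- r] w <->
  exists W : I -> nat,
    (forall i, i \in r -> reach (s i).1 (s i).2 (W i)) /\
    w = \sum_(i <- r) W i.
Proof.
move=> ur; have -> : [seq s i | i <- r] = flatten [seq [:: s i] | i <- r].
  by elim: r {ur} => //= i r <-.
rewrite breach_flatten //; split=> -[W [h ->]]; exists W; split=> // i /h.
  by case=> w1 [w2 [h1 -> ->]]; rewrite addn0.
by move=> h1; exists (W i), 0; rewrite addn0.
Qed.

(** * Separation of digits in Kronecker substitution *)

Lemma sum_pow_lt (s : seq nat) b c :
  (forall x, x \in s -> x <= b) -> size s < 2 ^ c ->
  \sum_(x <- s) 2 ^ x + 2 ^ b <= 2 ^ (b + c).
Proof.
move=> hb hs; apply: (@leq_trans ((size s).+1 * 2 ^ b)); last first.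
  by rewrite expnD mulnC leq_mul2l hs orbT.
rewrite mulSn addnC leq_add2l.
elim: s hb {hs} => [|x s IH] hb; first by rewrite big_nil.
rewrite big_cons /= mulSn leq_add ?leq_pexp2l ?hb ?inE ?eqxx // IH // => y ys.
by rewrite hb // inE ys orbT.
Qed.

(** Being multiples of Q, the exponents above T are at least T + Q and vanish modulo 2^(T+Q), while
    those below T are at most T - Q, and fewer than 2^Q of them sum to less than 2^T. The residue
    thus reaches 2^T only through T itself. *)
Lemma kron_coef (Q T : nat) (s : seq nat) :
  0 < Q -> (forall x, x \in s -> Q %| x) -> Q %| T -> size s < 2 ^ Q ->
  (2 ^ T <= (\sum_(x <- s) 2 ^ x) %% 2 ^ (T + Q)) = (T \in s).
Proof.
move=> Q0 dv dT sz.
rewrite (bigID (fun x => x <= T)) /=.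
have [H ->] : exists H, \sum_(x <- s | ~~ (x <= T)) 2 ^ x = H * 2 ^ (T + Q).
  exists (\sum_(x <- s | ~~ (x <= T)) 2 ^ (x - (T + Q))).
  rewrite big_distrl /= big_seq_cond [RHS]big_seq_cond; apply: eq_bigr => x /andP[xs].
  rewrite -ltnNge -expnD => lx; congr (2 ^ _); rewrite subnK //.
  have /dvdnP[a Ea] := dv x xs; have /dvdnP[b Eb] := dT.
  by move: lx; rewrite Ea Eb -mulSnr ltn_pmul2r // leq_pmul2r.
rewrite addnC modnMDl modn_small; last first.
  rewrite -big_filter; set s' := filter _ _.
  have h := @sum_pow_lt s' T Q.
  apply: leq_trans (h _ _); first by rewrite -addn1 leq_add2l expn_gt0.
    by move=> x; rewrite mem_filter => /andP[].
  by apply: leq_ltn_trans sz; rewrite size_filter count_size.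
apply/idP/idP => [|Ts]; last first.
  by rewrite (big_rem T) //= leqnn leq_addr.
apply: contraLR => Ts; rewrite -ltnNge.
rewrite -big_filter; set s' := filter _ _.
have [->|[y ys]] : s' = [::] \/ exists y, y \in s'.
- by case: s' => [|y r]; [left | right; exists y; rewrite inE eqxx].
- by rewrite big_nil expn_gt0.
have lxQ x : x \in s' -> x <= T - Q /\ Q <= T.
  rewrite mem_filter => /andP[xT xs].
  have lxT : x < T by rewrite ltn_neqAle xT andbT; apply: contraNneq Ts => <-.
  have /dvdnP[a Ea] := dv x xs; have /dvdnP[b Eb] := dT.
  have : x + Q <= T by move: lxT; rewrite Ea Eb -mulSnr ltn_pmul2r // leq_pmul2r.
  lia.
have [_ QT] := lxQ _ ys.
have := @sum_pow_lt s' (T - Q) Q; rewrite subnK // => h.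
apply: leq_trans (h _ _).
- by rewrite -addn1 leq_add2l expn_gt0.
- by move=> x /lxQ[].
by apply: leq_ltn_trans sz; rewrite size_filter count_size.
Qed.

Lemma digits_inj (Q m : nat) (f g : nat -> nat) :
  (forall j, j < m -> f j < Q) -> (forall j, j < m -> g j < Q) ->
  \sum_(j < m) f j * Q ^ j = \sum_(j < m) g j * Q ^ j ->
  forall j, j < m -> f j = g j.
Proof.
elim: m f g => [|m IH] f g hf hg E j //.
have Q0 : 0 < Q by apply: leq_ltn_trans (hf 0 isT).
move: E; rewrite !big_ord_recl /= !muln1.
have shift h : \sum_(i < m) h (bump 0 i) * Q ^ bump 0 i
    = Q * \sum_(i < m) h i.+1 * Q ^ i.
  rewrite big_distrr /=; apply: eq_bigr => i _.
  by rewrite /bump add1n expnS mulnCA.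
rewrite !shift => E.
have E0 : f 0 = g 0.
  have := congr1 (modn^~ Q) E.
  by rewrite ![_ + Q * _]addnC ![Q * _]mulnC !modnMDl !modn_small ?hf ?hg.
case: j => // j lj; apply: (IH (fun i => f i.+1) (fun i => g i.+1)) => //.
- by move=> i li /=; apply: hf.
- by move=> i li /=; apply: hg.
move: E; rewrite E0 => /addnI/eqP; rewrite eqn_mul2l => /orP[/eqP e|/eqP//].
by rewrite e in Q0.
Qed.

Lemma digits_lt (Q m : nat) (f : nat -> nat) :
  (forall j, j < m -> f j < Q) -> \sum_(j < m) f j * Q ^ j < Q ^ m.
Proof.
elim: m => [|m IH] hf; first by rewrite big_ord0.
rewrite big_ord_recr /= expnS.
apply: (@leq_trans (f m * Q ^ m + Q ^ m)).
  by rewrite addnC -addnS leq_add2l IH // => j /ltnW; apply: hf.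
by rewrite -mulSnr leq_mul2r hf ?orbT.
Qed.

(** * Star decompositions and centred orientations *)

Definition claw (V : finType) (v : V) (S : {set V}) : {set {set V}} :=
  [set [set v; u] | u in S].

Lemma set2_eq (V : finType) (a b c d : V) :
  [set a; b] = [set c; d] -> (a = c /\ b = d) \/ (a = d /\ b = c).
Proof.
move=> E; have := set21 a b; have := set22 a b; rewrite E !inE.
have := set21 c d; have := set22 c d; rewrite -E !inE.
by move=> /orP[/eqP h1|/eqP h1] /orP[/eqP h2|/eqP h2] /orP[/eqP h3|/eqP h3]
  /orP[/eqP h4|/eqP h4]; subst; auto.
Qed.

Lemma card_claw (V : finType) (v : V) (S : {set V}) :
  v \notin S -> #|claw v S| = #|S|.
Proof.
move=> vS; apply: card_in_imset => u w uS wS /set2_eq[[_ ->]|[e _]] //.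
by rewrite e wS in vS.
Qed.

Lemma copy_starP (V : finType) l (F : {set {set V}}) :
  reflect (exists (v : V) (S : {set V}), [/\ v \notin S, #|S| = l & F = claw v S])
          (edge_set_of_copy (star l) F).
Proof.
have edS (e : {set 'I_l.+1}) :
    e \in edges (star l) <-> exists2 j, j != ord0 & e = [set ord0; j].
  split.
    case/imsetP => -[x y]; rewrite inE /= /star_rel => h ->.
    case: (eqVneq x ord0) h => [-> /= h|x0 /= /eqP->]; first by exists y.
    by exists x; rewrite // setUC.
  case=> j j0 ->; apply/imsetP; exists (ord0, j) => //.
  by rewrite inE /= /star_rel eqxx (negPf j0).
apply: (iffP existsP) => [[f /andP[/injectiveP inj /eqP ->]]|].
  exists (f ord0), (f @: [set~ ord0]); split.
  - by apply/imsetP => -[x]; rewrite !inE => x0 /inj e; rewrite e eqxx in x0.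
  - by rewrite card_imset // cardsC1 card_ord.
  - apply/setP => e; apply/imsetP/imsetP.
      case=> g /edS[j j0 ->] ->; exists (f j); last by rewrite imsetU1 imset_set1.
      by rewrite imset_f // !inE.
    case=> u /imsetP[j]; rewrite !inE => j0 -> ->.
    exists [set ord0; j]; last by rewrite imsetU1 imset_set1.
    by apply/edS; exists j.
case=> v [S [vS Sl ->]].
pose f := [ffun i : 'I_l.+1 => nth v (v :: enum S) i].
have sz : size (v :: enum S) = l.+1 by rewrite /= -cardE Sl.
have un : uniq (v :: enum S) by rewrite /= mem_enum vS enum_uniq.
exists f; apply/andP; split.
  apply/injectiveP => i j; rewrite !ffunE => /eqP.
  by rewrite nth_uniq ?sz // => /eqP/val_inj.
have f0 : f ord0 = v by rewrite ffunE.
apply/eqP/setP => e; apply/imsetP/imsetP.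
  case=> u uS ->.
  have lu : (index u (enum S)).+1 < l.+1.
    by rewrite ltnS -Sl cardE index_mem mem_enum.
  exists [set ord0; Ordinal lu].
    by apply/edS; exists (Ordinal lu).
  by rewrite imsetU1 imset_set1 f0 ffunE /= nth_index // mem_enum.
case=> g /edS[j j0 ->] ->; exists (f j); last by rewrite imsetU1 imset_set1 f0.
rewrite ffunE; case: j j0 => -[|j] //= lj _.
by rewrite -mem_enum mem_nth // -cardE Sl.
Qed.

Lemma card_copy_star (V : finType) l (F : {set {set V}}) :
  edge_set_of_copy (star l) F -> #|F| = l.
Proof. by case/copy_starP=> v [S [vS <- ->]]; rewrite card_claw. Qed.

Lemma edgesP (V : finType) (G : sgraph V) (e : {set V}) :
  reflect (exists u v, G u v /\ e = [set u; v]) (e \in edges G).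
Proof.
apply: (iffP imsetP) => [[[u v]]|[u [v [uv ->]]]].
  by rewrite inE => uv ->; exists u, v.
by exists (u, v); rewrite ?inE.
Qed.

Lemma edgeE (V : finType) (G : sgraph V) (u v : V) :
  ([set u; v] \in edges G) = G u v.
Proof.
apply/edgesP/idP => [[a [b [ab]]]|uv]; last by exists u, v.
by case/set2_eq=> -[-> ->] //; rewrite adj_sym.
Qed.

Definition decomposition (V : finType) (G : sgraph V) (d : nat)
    (s a : 'I_d -> nat) : Prop :=
  exists P : {set {set {set V}}},
    [/\ partition P (edges G),
        forall F, F \in P -> exists l, edge_set_of_copy (star l) F
      & forall i, #|[set F in P | edge_set_of_copy (star (s i)) F]| = a i].

(* [cen u v] says that the star through the edge uv is centred at u, and
   [m v i] is the number of stars of length [s i] centred at v. *)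
Definition centred (V : finType) (G : sgraph V) (d : nat)
    (s a : 'I_d -> nat) : Prop :=
  exists (cen : rel V) (m : V -> 'I_d -> nat),
    [/\ forall u v, G u v -> cen u v = ~~ cen v u,
        forall i, \sum_v m v i = a i
      & forall v, \sum_i m v i * s i = #|[set u | G v u && cen v u]|].

Section Centres.

Variables (V : finType) (G : sgraph V) (d : nat) (s a : 'I_d -> nat).
Hypothesis s_gt0 : forall i, 0 < s i.
Hypothesis s_inj : injective s.
Hypothesis sum_edges : \sum_i a i * s i = #|edges G|.

(** A star with one edge has two possible centres, so [ctr] fixes one centre for each part, and both
    the orientation and the counts are read off from this single choice. *)
Lemma decomposition_centred : decomposition G s a -> centred G s a.
Proof.
case=> P [partP starP cardP].
pose isc v (F : {set {set V}}) :=
  [exists S : {set V}, (v \notin S) && (F == claw v S)].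
pose ctr (F : {set {set V}}) := [pick v | isc v F].
have ctrP F : F \in P -> exists (v : V) (S : {set V}),
    [/\ ctr F = Some v, v \notin S & F = claw v S].
  move=> /starP[l /copy_starP[v [S [vS _ FS]]]]; rewrite /ctr.
  case: pickP => [w /existsP[S' /andP[wS' /eqP FS']]|/(_ v)/existsP[]].
    by exists w, S'.
  by exists S; rewrite vS FS eqxx.
pose cp i (F : {set {set V}}) := edge_set_of_copy (star (s i)) F.
pose Fs v := [set F in P | ctr F == Some v].
pose E1 F := \sum_i cp i F * s i.
have sum_le F : E1 F <= #|F|.
  case: (boolP [exists i, cp i F]) => [/existsP[i ci]|/existsPn n]; last first.
    by rewrite /E1 big1 // => i _; rewrite (negPf (n i)).
  rewrite /E1 (bigD1 i) //= ci mul1n big1 ?addn0 ?(card_copy_star ci) //.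
  move=> j ji; case: (boolP (cp j F)) => // cj.
  by rewrite (s_inj (etrans (esym (card_copy_star cj)) (card_copy_star ci))) eqxx in ji.
(* Summed over the parts, [E1] gives the sum of the [a i * s i], which is the number of edges. So
   [sum_le] is an equality for every part, that is, every part has a listed length. *)
have E1P F : F \in P -> E1 F = #|F|.
  have le : forall F, F \in P -> E1 F <= #|F| ?= iff (E1 F == #|F|) by split.
  have [_ e] := leqif_sum le; move=> FP; apply/eqP; move: FP; apply/implyP.
  move: F; apply/forallP; rewrite -e -(card_partition partP) -sum_edges.
  rewrite exchange_big /=; apply/eqP/eq_bigr => i _.
  rewrite -cardP -sum1_card big_distrl /= big_mkcond /= [RHS]big_mkcond /=.
  by apply: eq_bigr => F _; rewrite inE -/(cp i F) mul1n; case: (F \in P); case: (cp i F); rewrite /= ?mul1n.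
have covP : cover P = edges G := cover_partition partP.
have tiP := partition_trivIset partP.
pose cen (u v : V) := ctr (pblock P [set u; v]) == Some u.
have outE v : #|[set u | G v u && cen v u]| = \sum_(F in Fs v) #|F|.
  have tF : trivIset (Fs v).
    by apply: trivIsetS tiP; apply/subsetP => F; rewrite inE => /andP[].
  rewrite (eqnP tF); set O := [set u | _].
  have vO : v \notin O by rewrite inE adj_irr.
  rewrite -(card_claw vO); apply: eq_card => e; apply/imsetP/bigcupP.
    case=> u; rewrite inE => /andP[vu c] ->; exists (pblock P [set v; u]).
      by rewrite inE pblock_mem ?covP ?edgeE.
    by rewrite mem_pblock covP edgeE.
  case=> F; rewrite inE => /andP[FP cF] eF.
  have [w [S [cw wS FS]]] := ctrP _ FP.
  move: cF; rewrite cw => /eqP[wv]; subst w.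
  have /imsetP[u uS eu] : e \in claw v S by rewrite -FS.
  exists u => //; rewrite inE -edgeE -eu -covP /cen -eu.
  by rewrite (def_pblock tiP FP eF) cw eqxx andbT; apply/bigcupP; exists F.
exists cen, (fun v i => #|[set F in Fs v | cp i F]|); split.
- move=> u v uv; rewrite /cen [in RHS]setUC.
  have eP : [set u; v] \in cover P by rewrite covP edgeE.
  have FP := pblock_mem eP; have [w [S [-> wS FS]]] := ctrP _ FP.
  have uDv : u != v by apply: contraTneq uv => ->; rewrite adj_irr.
  have : [set u; v] \in claw w S by rewrite -FS mem_pblock.
  case/imsetP=> y _ /set2_eq[[<- _]|[_ <-]].
    by rewrite eqxx -[_ == _]/(u == v) (negPf uDv).
  by rewrite eqxx -[_ == _]/(v == u) eq_sym (negPf uDv).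
- move=> i; rewrite -cardP -sum1_card.
  under eq_bigr do rewrite -sum1_card big_mkcond /=.
  rewrite exchange_big [RHS]big_mkcond /=; apply: eq_bigr => F _.
  rewrite !inE; case: (boolP (F \in P)) => FP /=; last first.
    by rewrite big1 // => v _; rewrite !inE (negPf FP).
  have [w [S [cw _ _]]] := ctrP _ FP.
  rewrite (bigD1 w) //= big1 => [|v vw]; rewrite !inE FP cw ?eqxx ?addn0 //=.
  by rewrite -[_ == _]/(w == v) eq_sym (negPf vw).
- move=> v; rewrite outE.
  under [RHS]eq_bigr => F do [rewrite inE => /andP[FP _]; rewrite -E1P //].
  rewrite [RHS]exchange_big /=; apply: eq_bigr => i _.
  rewrite -sum1_card big_distrl /= big_mkcond [RHS]big_mkcond /=.
  by apply: eq_bigr => F _; rewrite inE mul1n; case: (F \in Fs v); case: (cp i F); rewrite /= ?mul1n.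
Qed.

(** The edges centred at [v] are cut into stars arbitrarily. The word [lbl v] repeats each label (i,
    j) with j < m v i exactly s i times; its length is the number of edges centred at [v], and each
    edge receives the letter at its own position. *)
Lemma centred_decomposition : centred G s a -> decomposition G s a.
Proof.
case=> cen [m [anti sum_m out]].
pose O v := [set u | G v u && cen v u].
pose N := #|V|.
have mN v i : m v i <= N.
  apply: leq_trans (_ : #|O v| <= N); last exact: max_card.
  by rewrite -out (bigD1 i) //= (leq_trans _ (leq_addr _ _)) // leq_pmulr.

pose lbl v : seq ('I_d * 'I_N) := flatten [seq nseq (if t.2 < m v t.1 then s t.1 else 0) t | t : 'I_d * 'I_N <- enum {: 'I_d * 'I_N}].
have sum_ind n c : n <= N -> \sum_(j < N) (if j < n then c else 0) = n * c.
  move=> nN; rewrite -big_mkcond /= -(big_ord_widen _ (fun=> c) nN).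
  by rewrite sum_nat_const card_ord.
have sz v : size (lbl v) = #|O v|.
  rewrite size_flatten /shape -map_comp sumnE big_map -out big_enum /=.
  under [RHS]eq_bigr do rewrite -sum_ind //.
  by rewrite pair_bigA; apply: eq_bigr => p _; rewrite size_nseq.
pose lab v u := onth (lbl v) (index u (enum (O v))).
have lab_map v : [seq lab v u | u <- enum (O v)] = [seq Some t | t <- lbl v].
  apply: (@eq_from_nth _ None) => [|i]; rewrite !size_map -?cardE ?sz // => li.
  have [u0 u0O] : exists u, u \in O v.
    by apply/set0Pn; rewrite -card_gt0; apply: leq_trans li.
  rewrite (nth_map u0) -?cardE // /lab index_uniq ?enum_uniq -?cardE //.
  by rewrite onthE.
pose S v t := [set u in O v | lab v u == Some t].
have cardS v t : #|S v t| = if t.2 < m v t.1 then s t.1 else 0.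
  have -> : #|S v t| = count_mem (Some t) [seq lab v u | u <- enum (O v)].
    rewrite count_map -size_filter cardE /S; congr size.
    by rewrite /enum_mem -filter_predI; apply: eq_filter => u; rewrite !inE andbC.
  rewrite lab_map count_map count_flatten -map_comp sumnE big_map big_enum /=.
  rewrite (bigD1 t) //= big1 => [|q qt].
    by rewrite addn0 count_nseq /= eqxx mul1n.
  by rewrite count_nseq /= -[_ == _]/(q == t) (negPf qt).
pose J := [set p : (V * ('I_d * 'I_N))%type | p.2.2 < m p.1 p.2.1].
pose F (p : (V * ('I_d * 'I_N))%type) := claw p.1 (S p.1 p.2).
have vS v t : v \notin S v t by rewrite !inE adj_irr.
have cardF p : p \in J -> #|F p| = s p.2.1.
  by rewrite inE /F => h; rewrite card_claw ?vS // cardS h.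
have F_in p e : e \in F p ->
    exists u, [/\ e = [set p.1; u], G p.1 u, cen p.1 u & lab p.1 u = Some p.2].
  case/imsetP=> u; rewrite !inE => /andP[/andP[g c] /eqP l] ->; by exists u.
(* Positive lengths make all claws nonempty, as a partition requires; together with disjointness
   this also gives distinct claws for distinct indices. *)
have F0 : set0 \notin F @: J.
  apply/imsetP=> -[p pJ] e0; have := s_gt0 p.2.1.
  by rewrite -(cardF _ pJ) -e0 cards0.
(* A common edge of two claws either has the same centre in both, and then the same label, or has
   both its ends as centres, which [anti] excludes. *)
have disjF : {in J &, forall p q, q != p -> [disjoint F p & F q]}.
  move=> [v t] [v' t'] _ _; apply: contraR => /pred0Pn[e /andP[/= e1 e2]].
  have [u [/= eu g c l]] := F_in _ _ e1.
  have [u' [/= eu' g' c' l']] := F_in _ _ e2.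
  move: eu'; rewrite eu => /set2_eq[[evv euu]|[evu euv]]; subst.
    by move: l'; rewrite l => -[->].
  by move: c'; rewrite anti // c.
have [tiF injF] := trivIimset disjF F0.
exists (F @: J); split.
- apply/and3P; split=> //; rewrite cover_imset; apply/eqP/setP => e.
  apply/bigcupP/edgesP.
    by case=> p _ /F_in[u [-> g _ _]]; exists p.1, u.
  have key u v : G u v -> cen u v -> exists2 p, p \in J & [set u; v] \in F p.
    move=> uv c; have vO : v \in O u by rewrite inE uv.
    have : lab u v \in [seq Some t | t <- lbl u].
      by rewrite -lab_map map_f // mem_enum.
    case/mapP=> t tl lt; exists (u, t).
      rewrite inE /=; case/flatten_mapP: tl => q _; rewrite mem_nseq.
      by case: ifP => //= h /andP[_ /eqP->].
    by apply/imsetP; exists v => //; rewrite !inE uv c lt eqxx.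
  case=> u [v [uv ->]]; case: (boolP (cen u v)) => c; first exact: key.
  have vu : G v u by rewrite adj_sym.
  by rewrite setUC; apply: key => //; rewrite anti // (negPf c).
- move=> _ /imsetP[p pJ ->]; exists #|F p|; apply/copy_starP.
  by exists p.1, (S p.1 p.2); rewrite card_claw.
- move=> i; rewrite -sum_m.
  have -> : [set X in F @: J | edge_set_of_copy (star (s i)) X]
      = F @: [set p in J | p.2.1 == i].
    apply/setP => X; rewrite inE; apply/andP/imsetP.
      case=> /imsetP[p pJ ->] /card_copy_star; rewrite cardF // => /s_inj e.
      by exists p; rewrite // inE pJ e eqxx.
    case=> p; rewrite inE => /andP[pJ /eqP pi ->]; split; first exact: imset_f.
    apply/copy_starP; exists p.1, (S p.1 p.2); split=> //.
    by rewrite -pi -cardF // card_claw.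
  rewrite card_in_imset; last first.
    by move=> p q; rewrite !inE => /andP[pJ _] /andP[qJ _]; apply: injF; rewrite inE.
  rewrite -sum1_card big_mkcond /=.
  transitivity (\sum_v \sum_(t : 'I_d * 'I_N)
      (if (v, t) \in [set p in J | p.2.1 == i] then 1 else 0)).
    by rewrite pair_bigA; apply: eq_bigr => -[].
  apply: eq_bigr => v _.
  transitivity (\sum_i' \sum_(j < N)
      (if (v, (i', j)) \in [set p in J | p.2.1 == i] then 1 else 0)).
    by rewrite pair_bigA; apply: eq_bigr => -[].
  rewrite (bigD1 i) //= [X in _ + X]big1 => [|i' ne]; last first.
    by apply: big1 => j _; rewrite !inE /= (negPf ne) andbF.
  rewrite addn0 -[RHS]muln1 -sum_ind //; apply: eq_bigr => j _.
  by rewrite !inE /= eqxx andbT.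
Qed.

End Centres.

(** * Weights of choices *)

(** Taking the second option raises the degree by 1 and the first adds nothing, so degree 1 means
    exactly one second option. This is how a star obtains a single centre. *)
Lemma reach_one (ops : seq op) w :
  (forall o, o \in ops -> o.1 = (0, 1)) ->
  reach ops 1 w <-> exists2 o, o \in ops & w = o.2.
Proof.
have K0 r u : (forall o : op, o \in r -> o.1 = (0, 1)) -> reach r 0 u <-> u = 0.
  elim: r u => [|o r IH] u h /=; first by split=> [[]|->].
  have ho : o.1 = (0, 1) by apply: h; rewrite inE eqxx.
  have hr : forall o : op, o \in r -> o.1 = (0, 1).
    by move=> o' o'r; apply: h; rewrite inE o'r orbT.
  split; last by move=> ->; exists 0, 0; split; [apply/(IH _ hr) | left; rewrite ho].
  case=> z' [w' [h1 [[z0 ->]|[]]]]; rewrite ho //=.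
  by rewrite -z0 in h1; apply/(IH _ hr).
elim: ops w => [|o r IH] w h /=; first by split=> [[]|[]].
have ho : o.1 = (0, 1) by apply: h; rewrite inE eqxx.
have hr : forall o : op, o \in r -> o.1 = (0, 1).
  by move=> o' o'r; apply: h; rewrite inE o'r orbT.
split.
  case=> z' [w' [h1 [[e ->]|[]]]]; rewrite ho /=.
    rewrite -e in h1; case/(IH _ hr): h1 => o' o'r ->.
    by exists o'; rewrite // inE o'r orbT.
  case: z' h1 => // h1 _ ->; exists o; rewrite ?inE ?eqxx //.
  by move/(K0 _ _ hr): h1 => ->; rewrite addn0.
case=> o'; rewrite inE => /orP[/eqP-> ->|o'r ->].
  by exists 0, 0; split; [apply/(K0 _ _ hr) | right; rewrite ho !addn0].
exists 1, o'.2; split; last by left; rewrite ho.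
by apply/(IH _ hr); exists o'.
Qed.

Lemma card_sumb (T : finType) (P : pred T) : #|[set u | P u]| = \sum_u P u.
Proof.
rewrite -sum1dep_card big_mkcond /=; apply: eq_bigr => u _; by case: (P u).
Qed.

Lemma sum_uniq (T : finType) (r : seq T) (F : T -> nat) : uniq r ->
  \sum_(c <- r) F c = \sum_c (c \in r) * F c.
Proof.
move=> ur; rewrite big_uniq //= big_mkcond /=; apply: eq_bigr => c _.
by case: (c \in r); rewrite ?mul1n.
Qed.

Lemma count_sumb (T : finType) (r : seq T) (P : pred T) : uniq r ->
  count P r = \sum_c ((c \in r) && P c).
Proof.
move=> ur; rewrite -sum1_count big_mkcond /= sum_uniq //.
by apply: eq_bigr => c _; case: (c \in r); case: (P c).
Qed.

Lemma sum_iota_pick k l (F : nat -> nat) : 0 < l ->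
  \sum_(j <- iota 1 k) (l == j) * F j = if l <= k then F l else 0.
Proof.
move=> l0; case: leqP => h.
  rewrite (bigD1_seq l) ?iota_uniq ?mem_iota /=; [|lia..].
  rewrite eqxx mul1n big1 ?addn0 // => j; rewrite eq_sym => /negPf->.
  by rewrite mul0n.
rewrite big_seq big1 // => j; rewrite mem_iota => hj.
by rewrite (_ : l == j = false) //; apply/eqP; lia.
Qed.

(** * Centred orientations as reachable exponents *)

Section Reduction.

Variables (n : nat) (G : sgraph 'I_n) (d : nat) (s a : 'I_d -> nat).
Variables (cs : seq 'I_n) (Q : nat).

Let k := size cs.

(** Counters of cover vertices occupy the powers 1 to k of Q, counters of lengths the powers k + 1
    to 2k. Power 0 stays empty so that every weight is a multiple of Q. *)
Definition xw (c : 'I_n) := Q ^ (index c cs).+1.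
Definition fw (l : nat) := Q ^ (k + l).
Definition tv (v : 'I_n) : nat := v \notin cs.
Definition xv (v : 'I_n) : nat := if v \in cs then xw v else 0.
(** With [c] in the cover, an edge is decided at its end outside the cover if there is one, and
    otherwise at the larger of its ends. *)
Definition handled (v c : 'I_n) : bool := G v c && ((v \notin cs) || (c < v)).

(** Multiplicity k suffices: the stars centred at a vertex outside the cover have at least one edge
    each and at most k edges together. *)
Definition star_ops : seq op :=
  flatten [seq nseq k (0, l, fw l) | l <- iota 1 k].

(** The first option centres the edge at [v] and charges the counter of [c]; the second centres it
    at [c] and charges [v], whose account is a digit inside the cover and the degree in Z
    outside. *)
Definition edge_ops (v : 'I_n) : seq op :=
  [seq (xw c, tv v, xv v) | c <- cs & handled v c].

(* For v outside the cover, Z counts the edges at v centred elsewhere and the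
   lengths of the stars centred at v, which add up to the degree of v.  For v in
   the cover, Z is not used by the edges, and the final coefficient of Z^0
   excludes all the stars. *)
Definition vblock (v : 'I_n) : block :=
  (edge_ops v ++ star_ops, tv v * count (handled v) cs).

(** A length above k has no counter, since such a star can only be centred in the cover. *)
Definition foff (l : nat) : nat := if l <= k then fw l else 0.

(* Z counts the centres given to the star; the weightless option leaves the
   centre outside the cover. *)
Definition sblock (l : nat) : block :=
  ((if l <= k then [:: (0, 1, 0)] else [::])
     ++ [seq (0, 1, foff l + l * xw c) | c <- cs], 1).

Definition blocks : seq block :=
  [seq vblock v | v <- enum 'I_n]
  ++ flatten [seq nseq (a i) (sblock (s i)) | i <- enum 'I_d].

Definition target : nat :=
  \sum_v \sum_(c <- cs | G v c) xw c + \sum_i a i * foff (s i).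

Hypothesis s_gt0 : forall i, 0 < s i.
Hypothesis s_inj : injective s.
Hypothesis cs_uniq : uniq cs.
Hypothesis cs_cover : forall u v, G u v -> (u \in cs) || (v \in cs).
Hypothesis Q_large1 : 2 * n + \sum_i a i * s i < Q.
Hypothesis Q_large2 : n * k + \sum_i a i * s i < Q.

Definition weight (X : 'I_n -> nat) (U : nat -> nat) : nat :=
  \sum_(c <- cs) X c * xw c + \sum_(l <- iota 1 k) U l * fw l.

Lemma weight_digits c0 X U :
  weight X U = Q * \sum_(j < k + k)
    (if j < k then X (nth c0 cs j) else U (j - k).+1) * Q ^ j.
Proof.
rewrite big_split_ord /= mulnDr /weight; congr (_ + _).
  rewrite (big_nth c0) big_mkord big_distrr /=; apply: eq_bigr => i _.
  by rewrite ltn_ord /xw index_uniq ?ltn_ord // expnS mulnCA.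
rewrite -[iota 1 k]/(iota (1 + 0) k) iotaDl big_map.
have -> : iota 0 k = index_iota 0 k by rewrite /index_iota subn0.
rewrite big_mkord big_distrr /=.
apply: eq_bigr => i _; rewrite ltnNge leq_addr /= addKn.
by rewrite /fw add1n addnS expnS mulnCA.
Qed.

Lemma weight_inj X U X' U' :
  (forall c, c \in cs -> X c < Q) -> (forall l, 0 < l <= k -> U l < Q) ->
  (forall c, c \in cs -> X' c < Q) -> (forall l, 0 < l <= k -> U' l < Q) ->
  weight X U = weight X' U' ->
  (forall c, c \in cs -> X c = X' c) /\ (forall l, 0 < l <= k -> U l = U' l).
Proof.
(* A first element of the cover serves as the default for [nth]; without one there are no digits at
   all. *)
case E : cs => [|c0 r].
  by split=> // l; rewrite /k E; case: l.
rewrite -E => hX hU hX' hU'; rewrite !(weight_digits c0) => /eqP.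
rewrite eqn_mul2l => /orP[/eqP Q0|/eqP]; first by move: Q_large1; rewrite Q0.
pose g Y W j := if j < k then Y (nth c0 cs j) else W (j - k).+1 : nat.
have gQ Y W : (forall c, c \in cs -> Y c < Q) -> (forall l, 0 < l <= k -> W l < Q) ->
    forall j, j < k + k -> g Y W j < Q.
  by move=> hY hW i li; rewrite /g; case: (ltnP i k) => h; [apply: hY; exact: mem_nth | apply: hW; lia].
move/(@digits_inj Q (k + k) (g X U) (g X' U') (gQ _ _ hX hU) (gQ _ _ hX' hU')).
rewrite /g => H; split=> [c cc|l lk].
  have ic : index c cs < k by rewrite index_mem.
  by have := H (index c cs); rewrite ic nth_index //; apply; lia.
have kl : k + l.-1 < k + k by lia.
by have := H _ kl; rewrite ltnNge leq_addr /= addKn prednK; last by case/andP: lk.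
Qed.

Lemma weight_dvd X U : Q %| weight X U.
Proof.
case E : cs => [|c0 r]; first by rewrite /weight /k E !big_nil dvdn0.
by rewrite (weight_digits c0) dvdn_mulr.
Qed.

(** The gap Q comes from the factor Q in front of the digits. It leaves room for fewer than 2^Q
    terms to fit into Q^(2k+1) bits. *)
Lemma weight_lt X U :
  (forall c, c \in cs -> X c < Q) -> (forall l, 0 < l <= k -> U l < Q) ->
  weight X U <= Q ^ (k + k).+1 - Q.
Proof.
case E : cs => [|c0 r]; first by rewrite /weight /k E !big_nil.
rewrite -E (weight_digits c0) => hX hU.
have -> : Q ^ (k + k).+1 - Q = Q * (Q ^ (k + k) - 1) by rewrite mulnBr muln1 expnS.
rewrite leq_mul2l; apply/orP; right.
rewrite leq_subRL ?add1n ?expn_gt0; last by rewrite (leq_ltn_trans _ Q_large1).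
apply: (@digits_lt Q (k + k) (fun j => if j < k then X (nth c0 cs j) else U (j - k).+1)).
by move=> i li; case: (ltnP i k) => h; [apply: hX; exact: mem_nth | apply: hU; lia].
Qed.

Lemma reach_star_ops z w : reach star_ops z w <->
  exists m : nat -> nat, [/\ forall l, m l <= k,
    z = \sum_(l <- iota 1 k) m l * l & w = \sum_(l <- iota 1 k) m l * fw l].
Proof.
rewrite /star_ops reach_flatten ?iota_uniq //; split.
  case=> Z [W [h -> ->]].
  have {}h l : exists m, l \in iota 1 k -> [/\ m <= k, Z l = m * l & W l = m * fw l].
    case: (boolP (l \in iota 1 k)) => lk; last by exists 0.
    have /reach_nseq[m /= [mk Zl Wl]] := h _ lk; exists m => _; split=> //.
    by rewrite Wl muln0.
  (* Choosing the multiplicities of all lengths at once is finite choice, hence the passage through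
     ordinals and back by [inord]. *)
  have [m hm] : exists m : 'I_k.+1 -> nat, forall l : 'I_k.+1, (l : nat) \in iota 1 k ->
      [/\ m l <= k, Z l = m l * l & W l = m l * fw l].
    exact: (fin_all_exists (fun l : 'I_k.+1 => h l)).
  pose m' l := if (0 < l <= k) then m (inord l) else 0.
  have m'P l : l \in iota 1 k -> [/\ m' l <= k, Z l = m' l * l & W l = m' l * fw l].
    move=> lk; have := lk; rewrite mem_iota add1n ltnS => lk'.
    have il : (inord l : 'I_k.+1) = l :> nat by rewrite inordK ?ltnS; case/andP: lk'.
    by rewrite /m' lk'; have := hm (inord l); rewrite il; apply.
  exists m'; split.
  - move=> l; case: (boolP (l \in iota 1 k)) => [/m'P[]//|].
    by rewrite mem_iota add1n ltnS /m' => /negPf->.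
  - by apply: eq_big_seq => l /m'P[].
  - by apply: eq_big_seq => l /m'P[].
case=> m [mk -> ->]; exists (fun l => m l * l), (fun l => m l * fw l); split=> // l _.
by apply/reach_nseq; exists (m l); rewrite muln0.
Qed.

Lemma reach_edge_ops v z w : reach (edge_ops v) z w <->
  exists sel : pred 'I_n,
    z = \sum_(c <- cs | handled v c) sel c * tv v /\
    w = \sum_(c <- cs | handled v c) (if sel c then xv v else xw c).
Proof.
rewrite /edge_ops; have -> : [seq (xw c, tv v, xv v) | c <- cs & handled v c]
  = flatten [seq [:: (xw c, tv v, xv v)] | c <- cs & handled v c].
  by elim: (filter _ _) => //= c r <-.
rewrite reach_flatten ?filter_uniq //; split.
  case=> Z [W [h -> ->]].
  have {}h c : exists b : bool, c \in [seq c <- cs | handled v c] ->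
      Z c = b * tv v /\ W c = if b then xv v else xw c.
    case: (boolP (c \in _)) => cc; last by exists true.
    have /= := h _ cc.
    by case=> z' [w' [[-> ->] [[-> ->]|[-> ->]]]]; [exists false | exists true];
      rewrite ?addn0 ?mul0n ?mul1n.
  have [sel hs] := fin_all_exists h.
  by exists sel; split; rewrite -[RHS]big_filter; apply: eq_big_seq => c /hs[].
case=> sel [-> ->].
exists (fun c => sel c * tv v), (fun c => if sel c then xv v else xw c).
split; rewrite ?big_filter // => c _ /=; exists 0, 0; split=> //; case: (sel c); [right|left];
  by rewrite ?mul1n ?addn0.
Qed.

(** Stars of equal length are interchangeable, so only the number centred at each cover vertex and
    the number left for the outside matter. *)
Lemma breach_star_copies (l m : nat) w : breach (nseq m (sblock l)) w <->
  exists (mC : 'I_n -> nat) (m0 : nat),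
    [/\ m0 + \sum_(c <- cs) mC c = m, k < l -> m0 = 0
      & w = \sum_(c <- cs) mC c * (foff l + l * xw c)].
Proof.
have one u : reach (sblock l).1 1 u <->
    (l <= k /\ u = 0) \/ exists2 c, c \in cs & u = foff l + l * xw c.
  rewrite reach_one /=; last first.
    move=> o; rewrite mem_cat => /orP[|/mapP[c _ ->] //].
    by case: leqP => // _; rewrite inE => /eqP->.
  split.
    case=> o; rewrite mem_cat => /orP[|/mapP[c cc ->] ->]; last by right; exists c.
    by case: leqP => //; rewrite inE => lk /eqP-> ->; left.
  case=> [[lk ->]|[c cc ->]].
    by exists (0, 1, 0) => //; rewrite lk inE eqxx.
  exists (0, 1, foff l + l * xw c) => //.
  by rewrite mem_cat map_f ?orbT // (map_f (fun c => (0, 1, foff l + l * xw c))).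
elim: m w => [|m IH] w.
  split=> [->|[mC [m0 [/eqP]]]].
    exists (fun=> 0), 0; rewrite big1 //; split=> //.
  rewrite addn_eq0 sum_nat_seq_eq0 => /andP[_ /allP h] _ -> /=.
  by rewrite big_seq big1 // => c /h /eqP->.
have -> : nseq m.+1 (sblock l) = sblock l :: nseq m (sblock l) by [].
rewrite /= -/(sblock l).1; split.
  case=> w1 [w2 [/one h1 /IH[mC [m0 [<- mk ->]]] ->]].
  case: h1 => [[lk ->]|[c cc ->]].
    by exists mC, m0.+1; split=> //; lia.
  exists (fun c' => (c' == c) + mC c'), m0.
  have pick F : \sum_(c' <- cs) (c' == c) * F c' = F c.
    rewrite (bigD1_seq c) //= eqxx mul1n big1 ?addn0 // => j /negPf->.
    by rewrite mul0n.
  split=> //.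
    have := pick (fun=> 1); rewrite big_split /=.
    under eq_bigr do rewrite muln1.
    by move=> ->; lia.
  under [RHS]eq_bigr do rewrite mulnDl.
  by rewrite big_split /= pick.
case=> mC [m0 [e mk ->]].
(* One star is removed: one centred in the cover if none is left for the outside, and otherwise an
   outside one, which weighs nothing. *)
case: (posnP m0) => [m00|m0_gt0].
  have [c cc mc] : exists2 c, c \in cs & 0 < mC c.
    have : \sum_(c <- cs) mC c != 0 by lia.
    rewrite sum_nat_seq_eq0 => /allPn[c cc]; rewrite -lt0n => h; by exists c.
  pose mC' c' := if c' == c then (mC c).-1 else mC c'.
  have pick F : \sum_(c' <- cs) mC c' * F c' = F c + \sum_(c' <- cs) mC' c' * F c'.
    rewrite !(bigD1_seq c cc cs_uniq) /= /mC' eqxx addnA -mulSn prednK //.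
    by congr (_ + _); apply: eq_bigr => j /negPf->.
  exists (foff l + l * xw c), (\sum_(c' <- cs) mC' c' * (foff l + l * xw c')).
  split; [by apply/one; right; exists c| |exact: pick].
  apply/IH; exists mC', 0; split=> //.
  have := pick (fun=> 1); under eq_bigr do rewrite muln1.
  by under [X in _ + X]eq_bigr do rewrite muln1; lia.
exists 0, (\sum_(c <- cs) mC c * (foff l + l * xw c)); split=> //.
  by apply/one; left; split=> //; rewrite leqNgt; apply/negP => /mk; lia.
by apply/IH; exists mC, m0.-1; split=> //; [lia | move=> /mk ->].
Qed.

Lemma foffE i : foff (s i) = \sum_(l <- iota 1 k) (s i == l) * fw l.
Proof. by rewrite sum_iota_pick. Qed.

Lemma weightD X X' U U' :
  weight X U + weight X' U' = weight (fun c => X c + X' c) (fun l => U l + U' l).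
Proof.
rewrite /weight addnACA -!big_split /=; congr (_ + _);
  by apply: eq_bigr => c _; rewrite mulnDl.
Qed.

Lemma sum_cond_uniq (P : pred 'I_n) (F : 'I_n -> nat) :
  \sum_(c <- cs | P c) F c = \sum_c (c \in cs) * (P c * F c).
Proof.
rewrite big_mkcond /= [LHS]sum_uniq //; apply: eq_bigr => c _.
by case: (P c); rewrite ?mul1n ?mul0n.
Qed.

(** Regroups the weights by the vertex charged: [c] is charged as the other end of a handled edge
    with [sel] false, and as the handling end of an edge with [sel] true. *)
Lemma weight_edges (sel : 'I_n -> pred 'I_n) :
  \sum_v \sum_(c <- cs | handled v c) (if sel v c then xv v else xw c)
  = weight (fun c => \sum_v (handled v c && ~~ sel v c)
                     + \sum_(c' <- cs) (handled c c' && sel c c')) (fun=> 0).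
Proof.
rewrite /weight [X in _ = _ + X]big1 // addn0.
transitivity (\sum_v \sum_c
   ((c \in cs) * ((handled v c && ~~ sel v c) * xw c)
    + (v \in cs) * (((c \in cs) * (handled v c && sel v c)) * xw v))).
  apply: eq_bigr => v _; rewrite sum_cond_uniq; apply: eq_bigr => c _.
  rewrite /xv; case: (c \in cs); case: (handled v c); case: (sel v c);
    case: (v \in cs); rewrite /= ?mul1n ?mul0n ?muln0 ?addn0 ?mul1n //.
under eq_bigr do rewrite big_split; rewrite big_split /= exchange_big /=.
under [RHS]eq_bigr do rewrite mulnDl; rewrite big_split /=.
rewrite [X in _ = X + _]sum_uniq // [X in _ = _ + X]sum_uniq //.
congr (_ + _); apply: eq_bigr => c _.
  by rewrite -big_distrr /= -big_distrl.
by rewrite [in RHS]sum_uniq // big_distrl /= big_distrr.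
Qed.

Lemma weight_stars (mI : 'I_n -> nat -> nat) :
  \sum_v \sum_(l <- iota 1 k) mI v l * fw l
  = weight (fun=> 0) (fun l => \sum_v mI v l).
Proof.
rewrite /weight [X in _ = X + _]big1 // add0n exchange_big /=.
by apply: eq_bigr => l _; rewrite big_distrl.
Qed.

Lemma weight_copies (mC : 'I_d -> 'I_n -> nat) :
  \sum_i \sum_(c <- cs) mC i c * (foff (s i) + s i * xw c)
  = weight (fun c => \sum_i mC i c * s i)
           (fun l => \sum_i (s i == l) * \sum_(c <- cs) mC i c).
Proof.
rewrite /weight [RHS]addnC.
under [X in _ = X + _]eq_bigr do rewrite big_distrl /=.
under [X in _ = _ + X]eq_bigr do rewrite big_distrl /=.
rewrite [X in _ = X + _]exchange_big [X in _ = _ + X]exchange_big -big_split /=.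
apply: eq_bigr => i _.
under eq_bigr do rewrite mulnDr; rewrite big_split /=; congr (_ + _).
  rewrite -big_distrl /= foffE big_distrr /=.
  by apply: eq_bigr => l _; rewrite mulnCA mulnA.
by apply: eq_bigr => c _; rewrite mulnA.
Qed.

Lemma weight_target :
  target = weight (fun c => \sum_v G v c) (fun l => \sum_i (s i == l) * a i).
Proof.
rewrite /target /weight; congr (_ + _).
  under eq_bigr do rewrite sum_cond_uniq; rewrite exchange_big /= [RHS]sum_uniq //.
  by apply: eq_bigr => c _; rewrite big_distrl big_distrr.
under [RHS]eq_bigr do rewrite big_distrl /=; rewrite [RHS]exchange_big /=.
apply: eq_bigr => i _; rewrite foffE big_distrr /=.
by apply: eq_bigr => l _; rewrite mulnCA mulnA.
Qed.

Definition Xof (sel : 'I_n -> pred 'I_n) (mC : 'I_d -> 'I_n -> nat) c :=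
  \sum_v (handled v c && ~~ sel v c) + \sum_(c' <- cs) (handled c c' && sel c c')
  + \sum_i mC i c * s i.

Definition Uof (mI : 'I_n -> nat -> nat) (mC : 'I_d -> 'I_n -> nat) l :=
  \sum_v mI v l + \sum_i (s i == l) * \sum_(c <- cs) mC i c.

(** [sel v c] centres the edge handled at [v] at its other end [c]; [mI v l] counts stars of length
    l at [v] outside the cover, [mC i c] stars of index i at [c], and [m0 i] those left for the
    outside. For [v] in the cover the second clause makes [mI v l] vanish for l from 1 to k. *)
Definition valid_choice (sel : 'I_n -> pred 'I_n) (mI : 'I_n -> nat -> nat)
    (mC : 'I_d -> 'I_n -> nat) (m0 : 'I_d -> nat) : Prop :=
  [/\ forall v l, mI v l <= k,
      forall v, \sum_(c <- cs | handled v c) sel v c * tv v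
                + \sum_(l <- iota 1 k) mI v l * l = tv v * count (handled v) cs,
      forall i, m0 i + \sum_(c <- cs) mC i c = a i
    & forall i, k < s i -> m0 i = 0].

Lemma breach_blocks w : breach blocks w <->
  exists sel mI mC m0,
    valid_choice sel mI mC m0 /\ w = weight (Xof sel mC) (Uof mI mC).
Proof.
have totalE sel mI mC :
    \sum_v (\sum_(c <- cs | handled v c) (if sel v c then xv v else xw c)
            + \sum_(l <- iota 1 k) mI v l * fw l)
    + \sum_i \sum_(c <- cs) mC i c * (foff (s i) + s i * xw c)
    = weight (Xof sel mC) (Uof mI mC).
  rewrite big_split /= weight_edges weight_stars weight_copies !weightD.
  by rewrite /weight; congr (_ + _); apply: eq_bigr => c _; rewrite ?addn0 ?add0n.
rewrite /blocks breach_cat; split.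
  case=> w1 [w2 [/breach_map h1 /breach_flatten h2 ->]].
  have [W1 [{}h1 ->]] := h1 (enum_uniq _); have [W2 [{}h2 ->]] := h2 (enum_uniq _).
  have {}h1 v : exists p : pred 'I_n * (nat -> nat),
      [/\ forall l, p.2 l <= k,
        \sum_(c <- cs | handled v c) p.1 c * tv v
                + \sum_(l <- iota 1 k) p.2 l * l = tv v * count (handled v) cs
      & W1 v = \sum_(c <- cs | handled v c) (if p.1 c then xv v else xw c)
            + \sum_(l <- iota 1 k) p.2 l * fw l].
    have /= := h1 v (mem_enum _ _).
    case/reach_cat=> z1 [u1 [z2 [u2 [/reach_edge_ops[sel [-> ->]]]]]].
    by case/reach_star_ops=> m [mk -> ->] e e'; exists (sel, m).
  have {}h2 i : exists p : ('I_n -> nat) * nat,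
      [/\ p.2 + \sum_(c <- cs) p.1 c = a i, k < s i -> p.2 = 0
      & W2 i = \sum_(c <- cs) p.1 c * (foff (s i) + s i * xw c)].
    have /breach_star_copies[mC [m0 [h h' h'']]] := h2 i (mem_enum _ _).
    by exists (mC, m0).
  have [p1 {}h1] := fin_all_exists h1; have [p2 {}h2] := fin_all_exists h2.
  exists (fun v => (p1 v).1), (fun v => (p1 v).2), (fun i => (p2 i).1), (fun i => (p2 i).2).
  split; first by split=> [v|v|i|i]; [case: (h1 v) | case: (h1 v) | case: (h2 i) | case: (h2 i)].
  rewrite -totalE !big_enum /=; congr (_ + _); apply: eq_bigr => i _.
    by case: (h1 i).
  by case: (h2 i).
case=> sel [mI [mC [m0 [[hI hz hm h0] ->]]]]; rewrite -totalE.
eexists; eexists; split; last reflexivity.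
  apply/breach_map; first exact: enum_uniq.
  eexists; split; last by rewrite big_enum /=; reflexivity.
  move=> v _ /=; apply/reach_cat; do 4!eexists; split.
  - by apply/reach_edge_ops; exists (sel v).
  - by apply/reach_star_ops; exists (mI v).
  - by rewrite hz.
  - by [].
apply/breach_flatten; first exact: enum_uniq.
eexists; split; last by rewrite big_enum /=; reflexivity.
by move=> i _; apply/breach_star_copies; exists (mC i), (m0 i); split=> //; apply: h0.
Qed.

Lemma mC_le sel mI mC m0 i c : valid_choice sel mI mC m0 -> c \in cs -> mC i c <= a i.
Proof.
by case=> _ _ hm _ cc; rewrite -hm (bigD1_seq c) //=; lia.
Qed.

(** The two sums over edges are at most n each and the stars at [c] have at most the total length,
    whence the form of [Q_large1]. *)
Lemma Xof_lt sel mI mC m0 c : valid_choice sel mI mC m0 -> c \in cs -> Xof sel mC c < Q.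
Proof.
move=> h cc; apply: leq_ltn_trans Q_large1; rewrite /Xof leq_add //; last first.
  by apply: leq_sum => i _; rewrite leq_mul2r (mC_le _ h) ?orbT.
rewrite mul2n -addnn leq_add //.
  rewrite -[X in _ <= X]card_ord -sum1_card; apply: leq_sum => v _; exact: leq_b1.
apply: (@leq_trans (size cs)).
  by rewrite -sum1_size; apply: leq_sum => v _; exact: leq_b1.
by rewrite -(card_uniqP cs_uniq) -[X in _ <= X]card_ord max_card.
Qed.

Lemma Uof_lt sel mI mC m0 l : valid_choice sel mI mC m0 -> Uof mI mC l < Q.
Proof.
case=> hI _ hm _; apply: leq_ltn_trans Q_large2; rewrite /Uof leq_add //.
  rewrite -[X in X * _]card_ord -sum_nat_const; apply: leq_sum => v _; exact: hI.
apply: leq_sum => i _; case: eqP => _; rewrite ?mul0n // mul1n.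
by apply: (@leq_trans (a i)); rewrite ?leq_pmulr // -hm leq_addl.
Qed.

Lemma breach_blocks_dvd w : breach blocks w -> Q %| w.
Proof. by case/breach_blocks=> sel [mI [mC [m0 [_ ->]]]]; apply: weight_dvd. Qed.

Lemma breach_blocks_le w : breach blocks w -> w <= Q ^ (k + k).+1 - Q.
Proof.
case/breach_blocks=> sel [mI [mC [m0 [h ->]]]]; apply: weight_lt => [c cc|l _].
  exact: Xof_lt h cc.
exact: Uof_lt h.
Qed.

Lemma degree_lt c : \sum_v G v c < Q.
Proof.
apply: leq_ltn_trans Q_large1; apply: (@leq_trans n); last by lia.
rewrite -[X in _ <= X]card_ord -sum1_card; apply: leq_sum => v _; exact: leq_b1.
Qed.

Lemma lengths_lt l : \sum_i (s i == l) * a i < Q.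
Proof.
apply: leq_ltn_trans Q_large2; apply: leq_trans (leq_addl _ _).
apply: leq_sum => i _; case: eqP => _; rewrite ?mul0n // mul1n.
by rewrite leq_pmulr.
Qed.

Lemma target_dvd : Q %| target.
Proof. by rewrite weight_target weight_dvd. Qed.

Lemma target_le : target <= Q ^ (k + k).+1 - Q.
Proof.
rewrite weight_target; apply: weight_lt => [c _|l _].
  exact: degree_lt.
exact: lengths_lt.
Qed.

(* Every edge is handled at exactly one of its ends, so the two sums together run
   over all the edges at c. *)
Lemma indegE (cen : rel 'I_n) (sel : 'I_n -> pred 'I_n) c : c \in cs ->
  (forall u c, c \in cs -> handled u c -> cen u c = ~~ sel u c /\ cen c u = sel u c) ->
  \sum_v (handled v c && ~~ sel v c) + \sum_(c' <- cs) (handled c c' && sel c c')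
  = \sum_v (G v c && cen v c).
Proof.
move=> cc link; rewrite [X in _ + X]sum_uniq // -big_split /=.
apply: eq_bigr => v _; case: (boolP (G v c)) => [vc|]; last first.
  by rewrite /handled [G c v]adj_sym => /negPf-> /=; rewrite muln0.
have cv : G c v by rewrite adj_sym.
case: (boolP (handled v c)) => hv.
  have [-> _] := link _ _ cc hv; rewrite /=.
  rewrite (_ : (v \in cs) * _ = 0) ?addn0 //.
  have := hv; rewrite /handled vc cv cc /=.
  by case: (v \in cs) => //= lt; rewrite ltnNge ltnW.
have vs : v \in cs by move: hv; rewrite /handled vc negb_or negbK => /andP[].
have hc : handled c v.
  move: hv; rewrite /handled vc cv vs cc /= -leqNgt leq_eqVlt => /orP[/eqP/val_inj e|//].
  by rewrite e adj_irr in vc.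
by have [_ ->] := link _ _ vs hc; rewrite vs hc mul1n.
Qed.

Lemma degE (cen : rel 'I_n) v : (forall u v, G u v -> cen u v = ~~ cen v u) ->
  \sum_u G u v = \sum_u (G u v && cen u v) + \sum_u (G v u && cen v u).
Proof.
move=> anti; rewrite -big_split /=; apply: eq_bigr => u _.
rewrite [G v u]adj_sym; case: (boolP (G u v)) => uv //=.
by rewrite (anti _ _ uv); case: (cen v u).
Qed.

Lemma nbr_cover v c : v \notin cs -> G v c -> c \in cs.
Proof. by move=> vs /cs_cover; rewrite (negPf vs). Qed.

Lemma handled_out v c : v \notin cs -> handled v c = G v c.
Proof. by rewrite /handled => ->; rewrite andbT. Qed.

Lemma sum_out v (F : 'I_n -> nat) : v \notin cs ->
  \sum_(c <- cs | handled v c) F c = \sum_c G v c * F c.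
Proof.
move=> vs; rewrite sum_cond_uniq; apply: eq_bigr => c _; rewrite handled_out //.
case: (boolP (G v c)) => vc; last by rewrite mul0n muln0.
by rewrite (nbr_cover vs vc) mul1n.
Qed.

Lemma sum_lengths (F : 'I_d -> nat) :
  \sum_(l <- iota 1 k) (\sum_i (s i == l) * F i) * l
  = \sum_(i | s i <= k) F i * s i.
Proof.
under eq_bigr do rewrite big_distrl /=.
rewrite exchange_big [RHS]big_mkcond /=; apply: eq_bigr => i _.
rewrite -[RHS](sum_iota_pick k (fun l => F i * l)) //.
by apply: eq_bigr => l _; rewrite mulnA.
Qed.

Lemma centred_breach : centred G s a -> breach blocks target.
Proof.
case=> cen [m [anti sum_m out]].
have outE v : \sum_i m v i * s i = \sum_u (G v u && cen v u) by rewrite out card_sumb.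
(* All neighbours of a vertex outside the cover lie in the cover, so a star longer than k cannot be
   centred there. *)
have small v i : v \notin cs -> k < s i -> m v i = 0.
  move=> vs lk; apply/eqP; rewrite -leqn0 leqNgt; apply/negP => m0.
  have : \sum_i m v i * s i <= k.
    rewrite outE -[X in _ <= X](card_uniqP cs_uniq) -sum1_card [X in _ <= X]big_mkcond /=.
    apply: leq_sum => u _; case: (boolP (G v u)) => // vu.
    by rewrite (nbr_cover vs vu) leq_b1.
  rewrite (bigD1 i) //= => h; have : s i <= m v i * s i by rewrite leq_pmull.
  lia.
pose sel v c := cen c v.
pose mI v l := if v \in cs then 0 else \sum_i (s i == l) * m v i.
pose mC i c := m c i.
pose m0 i := \sum_(v | v \notin cs) m v i.
have sum_mC i : \sum_(c <- cs) mC i c = \sum_(v | v \in cs) m v i.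
  by rewrite -big_uniq.
apply/breach_blocks; exists sel, mI, mC, m0; split.
  split.
  - move=> v l; rewrite /mI; case: ifPn => // vs.
    apply: (@leq_trans (\sum_i m v i * s i)).
      by apply: leq_sum => i _; case: eqP => _; rewrite ?mul0n // mul1n leq_pmulr.
    rewrite outE -[X in _ <= X](card_uniqP cs_uniq) -sum1_card [X in _ <= X]big_mkcond /=.
    apply: leq_sum => u _; case: (boolP (G v u)) => // vu.
    by rewrite (nbr_cover vs vu) leq_b1.
  - move=> v; rewrite /tv /mI; case: (boolP (v \in cs)) => vs /=.
      by rewrite mul0n !big1 // => c _; rewrite muln0.
    rewrite mul1n sum_lengths sum_out //.
    have -> : \sum_(i | s i <= k) m v i * s i = \sum_i m v i * s i.
      rewrite big_mkcond; apply: eq_bigr => i _; case: leqP => // h.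
      by rewrite small.
    rewrite outE -big_split count_sumb //=.
    apply: eq_bigr => c _; rewrite handled_out // /sel.
    case: (boolP (G v c)) => vc; last by rewrite /= andbF.
    by rewrite (nbr_cover vs vc) /= (anti _ _ vc); case: (cen c v).
  - by move=> i; rewrite sum_mC addnC -sum_m [RHS](bigID (mem cs)).
  - by move=> i lk; apply: big1 => v vs; apply: small.
rewrite weight_target /weight; congr (_ + _).
  apply: eq_big_seq => c cc; congr (_ * _); rewrite /Xof.
  rewrite (indegE (cen := cen)) // => [|u c' cc' /andP[uc' _]].
    by rewrite outE -degE.
  by rewrite /sel; split=> //; apply: anti.
apply: eq_big_seq => l; rewrite mem_iota => lk; congr (_ * _); rewrite /Uof.
have -> : \sum_v mI v l = \sum_i (s i == l) * m0 i.
  under [RHS]eq_bigr do rewrite big_distrr /=.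
  rewrite [RHS]exchange_big [RHS]big_mkcond /=; apply: eq_bigr => v _ /=.
  by rewrite /mI; case: (v \in cs).
rewrite -big_split /=; apply: eq_bigr => i _; rewrite -mulnDr sum_mC addnC.
by rewrite -sum_m [in LHS](bigID (mem cs)).
Qed.

(** Since all counters are below Q, the single equality of exponents splits into one equation for
    each cover vertex and one for each length up to k. Longer stars have no option outside the cover
    and are counted by their blocks alone. *)
Lemma breach_centred : breach blocks target -> centred G s a.
Proof.
case/breach_blocks=> sel [mI [mC [m0 [h]]]]; rewrite weight_target.
case/weight_inj => [c _|l _|c cc|l _|HX HU].
- exact: degree_lt.
- exact: lengths_lt.
- exact: Xof_lt h cc.
- exact: Uof_lt h.
case: h => hI hz hm h0.
(* The orientation of an edge is stored at the end that handles it, so [cen u v] and [cen v u] read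
   the same bit of [sel]. *)
pose cen u v := if (v \in cs) && handled u v then ~~ sel u v
                else ((u \in cs) && handled v u) && sel v u.
have excl u c : c \in cs -> handled u c -> (u \in cs) && handled c u = false.
  rewrite /handled => cc /andP[_]; rewrite cc /=; case: (u \in cs) => //= lt.
  by rewrite ltnNge (ltnW lt) andbF.
have link u c : c \in cs -> handled u c -> cen u c = ~~ sel u c /\ cen c u = sel u c.
  by move=> cc uc; rewrite /cen cc uc (excl _ _ cc uc).
have handE u v : G u v -> (v \in cs) && handled u v || (u \in cs) && handled v u.
  move=> uv; have vu : G v u by rewrite adj_sym.
  rewrite /handled uv vu /=; have := cs_cover uv.
  case: (boolP (u \in cs)) => us; case: (boolP (v \in cs)) => vs //= _.
  by rewrite -neq_ltn; apply: contraTneq uv => /val_inj->; rewrite adj_irr.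
have anti u v : G u v -> cen u v = ~~ cen v u.
  move/handE/orP=> [/andP[cv hv]|/andP[cu hu]].
    by have [-> ->] := link _ _ cv hv.
  by have [-> ->] := link _ _ cu hu; rewrite negbK.
have mI_in v l : v \in cs -> 0 < l <= k -> mI v l = 0.
  move=> vs lk; have := hz v; rewrite /tv vs /= mul0n => /eqP.
  rewrite addn_eq0 => /andP[_]; rewrite sum_nat_seq_eq0 => /allP/(_ l).
  rewrite mem_iota add1n ltnS => /(_ lk); rewrite muln_eq0 => /orP[/eqP//|/eqP l0].
  by rewrite l0 in lk.
have UE l : 0 < l <= k ->
    \sum_v mI v l + \sum_i (s i == l) * \sum_(c <- cs) mC i c
    = \sum_i (s i == l) * a i by move=> /HU.
have pick i (F : 'I_d -> nat) : \sum_j (s j == s i) * F j = F i.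
  rewrite (bigD1 i) //= eqxx mul1n big1 ?addn0 // => j.
  by rewrite (inj_eq s_inj) => /negPf->.
exists cen, (fun v i => if v \in cs then mC i v else if s i <= k then mI v (s i) else 0).
split=> // [i|v].
  rewrite (bigID (mem cs)) /=.
  have -> : \sum_(v | v \in cs) (if v \in cs then mC i v else
      if s i <= k then mI v (s i) else 0) = \sum_(c <- cs) mC i c.
    by rewrite -big_uniq //; apply: eq_big_seq => c ->.
  case: (leqP (s i) k) => sk; last first.
    by rewrite [X in _ + X]big1 ?addn0 => [|v /negPf->]; rewrite // -hm h0.
  have sk' : 0 < s i <= k by rewrite s_gt0.
  have := UE _ sk'; rewrite !pick => <-; rewrite addnC; congr (_ + _).
  rewrite [RHS](bigID (mem cs)) /= [X in _ = X + _]big1 ?add0n => [|v vs].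
    by apply: eq_bigr => v /negPf->.
  exact: mI_in.
rewrite card_sumb; case: (boolP (v \in cs)) => vs.
  have := HX _ vs; rewrite /Xof (indegE vs link) (degE v anti).
  by move/addnI.
transitivity (\sum_(l <- iota 1 k) mI v l * l).
  transitivity (\sum_(i | s i <= k) mI v (s i) * s i).
    rewrite [RHS]big_mkcond /=; apply: eq_bigr => i _.
    by case: ifP.
  rewrite -(sum_lengths (fun i => mI v (s i))); apply: eq_big_seq => l.
  rewrite mem_iota add1n ltnS => lk; congr (_ * _).
  case: (boolP [exists i, s i == l]) => [/existsP[i /eqP <-]|/existsPn no].
    exact: (pick i (fun i => mI v (s i))).
  (* A length that is not listed has target digit 0, so no star of that length was chosen at any
     vertex. *)
  have no' F : \sum_i (s i == l) * F i = 0.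
    by apply: big1 => i _; rewrite (negPf (no i)).
  rewrite no'; have /eqP := UE _ lk; rewrite !no' addn0.
  by rewrite sum_nat_eq0 => /forallP/(_ v)/eqP->.
(* The selected coefficient says that the edges at [v] centred elsewhere and the lengths of the
   stars at [v] add up to the degree; cancelling the former leaves the edges centred at [v]. *)
have := hz v; rewrite /tv vs /= mul1n sum_out // count_sumb //.
set A := \sum_c _; set B := \sum_(l <- _) _; set D := \sum_c _; set E := \sum_u _ => h.
suff : A + E = D by rewrite -h => /addnI.
rewrite /A /E /D -big_split /=; apply: eq_bigr => c _; rewrite handled_out //.
case: (boolP (G v c)) => vc /=; last by rewrite andbF.
have cc := nbr_cover vs vc; rewrite cc.
have hv : handled v c by rewrite handled_out.
by have [-> _] := link _ _ cc hv; rewrite muln1; case: (sel v c).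
Qed.

Lemma breach_targetP : breach blocks target <-> centred G s a.
Proof. by split; [apply: breach_centred | apply: centred_breach]. Qed.

End Reduction.

(** * The program *)

Open Scope cmd_scope.
Open Scope nat_scope.

Ltac frame := repeat match goal with
  ag : agree _ _ ?s' |- context [?s'.1 ?r] => rewrite (ag r isT) end.

(** A power of two is applied by repeated doubling, in time linear in the exponent. Counting down a
    copy in register 20 preserves [e]. *)
Definition SHIFT x e : cmd := IAdd 20 e rZero ;; Loop 20 (IAdd x x x).

Lemma ok_SHIFT x e s : s.1 rZero = 0 -> x \notin [:: rUnit; 20] -> e != x ->
  ok (SHIFT x e) s (5 * s.1 e + 2)
    (fun s' => s'.1 x = s.1 x * 2 ^ s.1 e /\ s'.2 = s.2).
Proof.
move=> z0; rewrite !inE negb_or => /andP[xu x20] ex.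
have -> : 5 * s.1 e + 2 = (5 * s.1 e).+1.+1 by lia.
apply: ok_prim; set s1 := prim _ s.
have e1 : s1.1 20 = s.1 e by rewrite /= /upd eqxx z0 addn0.
have x1 : s1.1 x = s.1 x by rewrite /= /upd (negPf x20).
have x2 : 20 \notin wr (IAdd x x x) by rewrite /= inE eq_sym.
have := @ok_loop 20 (IAdd x x x) s1 (fun=> 1)
  (fun i s' => s'.1 x = s.1 x * 2 ^ i /\ s'.2 = s.2) x2 isT.
case=> [|i s' li ag cnt [h1 h2]|]; first by rewrite x1 muln1.
  apply: ok_prim1; split=> //.
  rewrite decr_frame //= /upd eqxx h1 expnS; lia.
rewrite e1 => h c; split=> //; apply: leq_trans c _.
by rewrite sum_nat_const card_ord; lia.
Qed.

Definition MUL a b : cmd :=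
  IConst 25 0 ;; IAdd 24 a rZero ;; Loop 24 (IAdd 25 25 b).

Lemma ok_MUL a b s : s.1 rZero = 0 -> a != 25 -> b \notin [:: rUnit; 24; 25] ->
  ok (MUL a b) s (5 * s.1 a + 3)
    (fun s' => s'.1 25 = s.1 a * s.1 b /\ s'.2 = s.2).
Proof.
move=> z0 a25; rewrite !inE !negb_or => /and3P[bu b24 b25].
have -> : 5 * s.1 a + 3 = (5 * s.1 a).+1.+2 by lia.
apply: ok_prim; apply: ok_prim; set s1 := prim _ _.
have e1 : s1.1 24 = s.1 a by rewrite /= /upd /= (negPf a25) z0 addn0.
have := @ok_loop 24 (IAdd 25 25 b) s1 (fun=> 1)
  (fun i s' => s'.1 25 = i * s.1 b /\ s'.2 = s.2) isT isT.
case=> [//|i s' li ag cnt [h1 h2]|].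
  apply: ok_prim1; split=> //; rewrite /= /upd /= h1.
  have -> : s'.1 b = s1.1 b.
    by apply: ag; rewrite !inE !negb_or b24 bu b25.
  by rewrite /= /upd (negPf b24) (negPf b25); lia.
rewrite e1 => h c; split=> //; apply: leq_trans c _.
by rewrite sum_nat_const card_ord; lia.
Qed.

(* Size and address of the cover, address of the encoded instance, first free
   cell, number of vertices, Q, address of the array, target exponent; then the
   constant 1 and the arguments of PSTEP and SELECT. *)
Notation rK := 3 (only parsing).
Notation rC := 4 (only parsing).
Notation rG := 5 (only parsing).
Notation rF := 6 (only parsing).
Notation rN := 7 (only parsing).
Notation rQ := 8 (only parsing).
Notation rA := 9 (only parsing).
Notation rT := 10 (only parsing).
Notation rOne := 11 (only parsing).
Notation rPa := 12 (only parsing).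
Notation rPt := 13 (only parsing).
Notation rPb := 14 (only parsing).
Notation rD := 26 (only parsing).

(* The array contains the coefficients up to degree k of a polynomial in Z. *)
Definition holds (L : seq (nat * nat)) (s : state) : Prop :=
  forall z, z <= s.1 rK -> s.2 (s.1 rA + z) = valz L z.

Definition below (s s' : state) : Prop :=
  forall x, x < s.1 rA -> s'.2 x = s.2 x.

(* Multiplies the polynomial by 2^a + 2^b Z^t, up to degree k.  This is done in
   place because the loop counter, and so the degree, descends. *)
Definition PSTEP_body : cmd :=
  IAdd 16 rA 15 ;; ISub 16 16 rOne ;; ISub 19 15 rOne ;;
  IRead 17 16 ;; SHIFT 17 rPa ;;
  ISub 19 rPt 19 ;;
  If 19 (IConst 19 0)
        (ISub 21 16 rPt ;; IRead 18 21 ;; SHIFT 18 rPb ;; IAdd 17 17 18) ;;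
  IWrite 16 17.

Definition PSTEP : cmd := IAdd 15 rK rOne ;; Loop 15 PSTEP_body.

Lemma ok_PSTEP s L : s.1 rZero = 0 -> s.1 rOne = 1 -> holds L s ->
  ok PSTEP s ((s.1 rK).+1 * (5 * s.1 rPa + 5 * s.1 rPb + 20) + 2)
    (fun s' => holds (stepL L (s.1 rPa, s.1 rPt, s.1 rPb)) s' /\ below s s').
Proof.
move=> z0 o1 hL; rewrite addn2; apply: ok_prim; set s1 := prim _ _.
have e1 : s1.1 15 = (s.1 rK).+1 by rewrite /= /upd /= o1 addn1.
set o := (_, _, _); set k := s.1 rK in e1 *.
(* After i rounds the coefficients above degree k - i are new. Degree z needs only degrees z and z -
   t, which are still old when its turn comes. *)
pose I i (s' : state) := (forall z, z <= k -> s'.2 (s.1 rA + z) =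
   if k < z + i then valz (stepL L o) z else valz L z) /\ below s s'.
have := @ok_loop 15 PSTEP_body s1 (fun=> 5 * s.1 rPa + 5 * s.1 rPb + 15) I isT isT.
rewrite e1 => H; apply: ok_weaken.
- apply: H; first by split=> // z zk; rewrite addn0 ltnNge zk; apply: hL.
  move=> i s' li ag cnt [h1 h2].
  have {}cnt : s'.1 15 = (k - i).+1 by rewrite cnt; lia.
  have -> : 5 * s.1 rPa + 5 * s.1 rPb + 15 =
     ((5 * s.1 rPa + 2) + (((5 * s.1 rPb + 2) + 1).+2.+2 + 1).+1).+4 by lia.
  have zk : k - i <= k by lia.
  do 4!apply: ok_prim; set s2 := prim _ _.
  have A' : s'.1 rA = s.1 rA by frame.
  have a2 : s2.1 rPa = s.1 rPa by rewrite /= /upd /=; frame.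
  have d2 : s2.1 16 = s.1 rA + (k - i).
    by rewrite /= /upd /= cnt; frame; rewrite /= /upd /= o1; lia.
  have z2 : s2.1 19 = k - i.
    by rewrite /= /upd /= cnt; frame; rewrite /= /upd /= o1; lia.
  have x2 : s2.1 17 = valz L (k - i).
    have -> : s2.1 17 = s'.2 (s2.1 16) by [].
    rewrite d2 h1 // ifF //; lia.
  have m2 : s2.2 = s'.2 by [].
  have := @ok_SHIFT 17 12 s2; rewrite a2 => S.
  apply: ok_seq; first by apply: S => //=; rewrite /upd /=; frame.
  move=> s3 ag3 [x3 m3]; apply: ok_prim; set s4 := prim _ _.
  apply: (ok_seq (P1 := fun s5 => s5.1 17 = valz (stepL L o) (k - i) /\ s5.2 = s'.2)).
    (* The truncated difference vanishes exactly when t is at most the current degree, so it tests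
       whether the shifted coefficient exists. *)
    have u4 : s4.1 19 = s.1 rPt - (k - i).
      rewrite /= /upd /=; frame; rewrite z2 /= /upd /=; by frame.
    rewrite valz_step /op_act /=.
    apply: ok_if => h.
      apply: (ok_weaken (t := 1) (P := fun s5 => s5.1 17 = s4.1 17 /\ s5.2 = s4.2)).
      - exact: ok_prim1.
      - lia.
      - move=> s5 _ [-> ->]; split; last by rewrite /= m3.
        rewrite ifF; last by rewrite u4 in h; lia.
        by rewrite addn0 [LHS]x3 x2.
    rewrite ifT; last by rewrite u4 in h; lia.
    do 2!apply: ok_prim; set s5 := prim _ _.
    have tz : s.1 rPt <= k - i by rewrite u4 in h; lia.
    have b5 : s5.1 rPb = s.1 rPb by rewrite /= /upd /=; frame; rewrite /= /upd /=; frame.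
    have y5 : s5.1 18 = valz L (k - i - s.1 rPt).
      have -> : s5.1 18 = s'.2 (s3.1 16 - s3.1 rPt) by rewrite /= /upd /= m3.
      have -> : s3.1 rPt = s.1 rPt by frame; rewrite /= /upd /=; frame.
      have -> : s3.1 16 = s.1 rA + (k - i) by frame.
      rewrite -addnBA // h1; last by lia.
      by rewrite ifF //; lia.
    have := @ok_SHIFT 18 14 s5; rewrite b5 => S5.
    apply: ok_seq.
      by apply: S5 => //; rewrite /= /upd /=; frame; rewrite /= /upd /=; frame.
    move=> s6 ag6 [x6 m6]; apply: ok_prim1; split; last by rewrite /= m6 /= m3.
    rewrite /= /upd /= x6 y5; congr (_ + _).
    by frame; rewrite /= /upd /= x3 x2.
  move=> s5 ag5 [x5 m5]; apply: ok_prim1.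
  have d5 : s5.1 16 = s.1 rA + (k - i) by frame; rewrite /= /upd /=; frame.
  rewrite /I /below /=; split=> [z zk'|x xA].
    rewrite /upd d5 x5 m5 eqn_add2l.
    case: eqP => [->|zn]; first by rewrite ifT //; lia.
    rewrite h1 //; case: ltnP => h; [rewrite ifT | rewrite ifF] => //; lia.
  by rewrite /upd d5 m5 ifF ?h2 //; apply/eqP => e; rewrite e in xA; lia.
- by rewrite sum_nat_const card_ord ltnS leq_mul2l; apply/orP; right; lia.
- move=> s' ag [h1 h2]; split=> // z; frame => zk.
  rewrite h1; last by move: zk; rewrite /= /upd /=.
  by rewrite ifT //; move: zk; rewrite /= /upd /=; lia.
Qed.

Definition SELECT : cmd :=
  IAdd 28 rA rD ;; IRead 27 28 ;; IAdd 29 rK rOne ;;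
  Loop 29 (IAdd 28 rA 29 ;; ISub 28 28 rOne ;; IWrite 28 rZero) ;;
  IWrite rA 27.

Lemma ok_SELECT s L : s.1 rZero = 0 -> s.1 rOne = 1 -> s.1 rD <= s.1 rK ->
  holds L s ->
  ok SELECT s ((s.1 rK).+1 * 7 + 5)
    (fun s' => holds (selL (s.1 rD) L) s' /\ below s s').
Proof.
move=> z0 o1 dk hL.
have -> : (s.1 rK).+1 * 7 + 5 = ((((s.1 rK).+1 * 7).+1 + 1)).+3 by lia.
do 3!apply: ok_prim; set s1 := prim _ _.
have e1 : s1.1 29 = (s.1 rK).+1 by rewrite /= /upd /= o1 addn1.
have x1 : s1.1 27 = valz L (s.1 rD) by rewrite /= /upd /= hL.
set k := s.1 rK in e1 *.
pose I i (s' : state) := (forall z, z <= k -> k < z + i -> s'.2 (s.1 rA + z) = 0)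
   /\ below s s'.
have := @ok_loop 29 (IAdd 28 rA 29 ;; ISub 28 28 rOne ;; IWrite 28 rZero) s1
  (fun=> 3) I isT isT.
rewrite e1 sum_nat_const card_ord => H.
apply: ok_seq.
  apply: H; first by split=> // z zk; rewrite addn0 ltnNge zk.
  move=> i s' li ag cnt [h1 h2].
  do 2!apply: ok_prim; apply: ok_prim1.
  have d2 : s'.1 9 + s'.1 29 - s'.1 11 = s.1 rA + (k - i).
    by rewrite cnt; frame; rewrite /= /upd /= o1; lia.
  have z2 : s'.1 rZero = 0 by frame; rewrite /= /upd /=.
  rewrite /I /below /= /upd /= d2 z2; split=> [z zk ki|x xA].
    rewrite eqn_add2l; case: eqP => // zn; apply: h1 => //; lia.
  by rewrite ifF ?h2 //; apply/eqP => e; rewrite e in xA; lia.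
move=> s2 ag [h1 h2]; apply: ok_prim1.
have A2 : s2.1 rA = s.1 rA by frame.
have K2 : s2.1 rK = s.1 rK by frame.
have X2 : s2.1 27 = valz L (s.1 rD) by frame.
split=> [z|x xA]; rewrite /= /upd A2 X2 ?K2.
  rewrite valz_sel -{2}[s.1 rA]addn0 eqn_add2l => zk.
  by case: eqP => // zn; apply: h1 => //; lia.
by rewrite ifF ?h2 //; apply/eqP => e; rewrite e ltnn in xA.
Qed.

(* Registers 31 and 32: the vertex v and the address of its row.  Registers 33 to
   36: the scan of the cover, as counter, address in the cover, address of the
   weight, vertex.  Registers 39 and 40: tv and xv of v. *)
Definition FIND_body : cmd :=
  IRead 36 34 ;; ISub 37 36 31 ;; ISub 38 31 36 ;; IAdd 37 37 38 ;;
  If 37 (IConst 37 0) (IConst 39 0 ;; IRead 40 35) ;;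
  IAdd 34 34 rOne ;; IAdd 35 35 rOne.

Definition FIND : cmd :=
  IConst 39 1 ;; IConst 40 0 ;; IAdd 33 rK rZero ;; IAdd 34 rC rZero ;;
  IAdd 35 rF rOne ;; Loop 33 FIND_body.

(** Every neighbour [c] of [v] adds its weight to the target, which so collects the degrees; only
    handled edges multiply the polynomial. Register 38 holds (v - c) + [tv], nonzero exactly when
    the edge is handled. *)
Definition EDGES_body : cmd :=
  IRead 36 34 ;; IRead rPa 35 ;; IAdd 37 32 36 ;; IRead 37 37 ;;
  If 37 (IAdd rT rT rPa ;; ISub 38 31 36 ;; IAdd 38 38 39 ;;
         If 38 (IAdd rD rD 39 ;; PSTEP) (IConst 37 0))
        (IConst 37 0) ;;
  IAdd 34 34 rOne ;; IAdd 35 35 rOne.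

Definition EDGES : cmd :=
  IConst rD 0 ;; IAdd 33 rK rZero ;; IAdd 34 rC rZero ;; IAdd 35 rF rOne ;;
  IAdd rPt 39 rZero ;; IAdd rPb 40 rZero ;; Loop 33 EDGES_body.

Definition SMALL_body : cmd :=
  IRead rPb 35 ;; IAdd 44 rK rZero ;; Loop 44 PSTEP ;;
  IAdd rPt rPt rOne ;; IAdd 35 35 rOne.

Definition SMALL : cmd :=
  IConst rPa 0 ;; IConst rPt 1 ;; IAdd 35 rF rK ;; IAdd 35 35 rOne ;;
  IAdd 43 rK rZero ;; Loop 43 SMALL_body.

Definition VERT : cmd := FIND ;; EDGES ;; SMALL ;; SELECT.

Definition VERTS_body : cmd := VERT ;; IAdd 31 31 rOne ;; IAdd 32 32 rN.

Definition VERTS : cmd :=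
  IAdd 30 rN rZero ;; IConst 31 0 ;; IAdd 32 rG rOne ;; IConst rT 0 ;;
  Loop 30 VERTS_body.

Definition STAR_body : cmd :=
  IRead 53 35 ;; MUL 50 53 ;; IAdd rPb 51 25 ;; PSTEP ;; IAdd 35 35 rOne.

(** Register 51 receives [foff]; the truncated l - k in register 52 vanishes exactly for the lengths
    that own a counter. *)
Definition STAR : cmd :=
  IConst 51 0 ;; IConst rPa 0 ;; IConst rPt 1 ;; ISub 52 50 rK ;;
  If 52 (IConst 52 0)
        (IAdd 51 rF rK ;; IAdd 51 51 50 ;; IRead 51 51 ;; IAdd rT rT 51 ;;
         IConst rPb 0 ;; PSTEP) ;;
  IAdd 35 rF rOne ;; IAdd 33 rK rZero ;; Loop 33 STAR_body ;;
  IConst rD 1 ;; SELECT.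

Definition STARS_body : cmd :=
  IRead 50 47 ;; IRead 49 48 ;; Loop 49 STAR ;;
  IAdd 47 47 rOne ;; IAdd 48 48 rOne.

Definition STARS : cmd :=
  IRead 46 32 ;; IAdd 47 32 rOne ;; IAdd 48 47 46 ;; Loop 46 STARS_body.

(* Reduces register 54 modulo 2^(T+Q) by subtracting descending powers of 2. *)
Definition FINAL_body : cmd :=
  ISub 55 55 rOne ;; IConst 57 1 ;; SHIFT 57 55 ;; ISub 58 57 54 ;;
  If 58 (IConst 58 0) (ISub 54 54 57).

Definition FINAL : cmd :=
  IRead 54 rA ;; IAdd 55 rF rK ;; IAdd 55 55 rK ;; IAdd 55 55 rOne ;;
  IRead 55 55 ;; ISub 56 55 rT ;; ISub 56 56 rQ ;;
  Loop 56 FINAL_body ;;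
  IConst 57 1 ;; SHIFT 57 rT ;; ISub 57 57 rOne ;; ISub rOut 54 57.

(** Fills a table with the powers of Q from 0 to 2k + 1. The weights [xw] and [fw] are entries of
    it, its last entry bounds the number of bits, and the array starts right behind it. *)
Definition SETUP_body : cmd :=
  IWrite 34 57 ;; IAdd 34 34 rOne ;; MUL 57 rQ ;; IAdd 57 25 rZero.

Definition SETUP : cmd :=
  IConst rOne 1 ;; IRead rN rG ;; IAdd 22 rK rOne ;; MUL 22 22 ;;
  IAdd 23 25 rZero ;; MUL 23 rN ;; IAdd rQ 25 25 ;;
  IConst 57 1 ;; IAdd 34 rF rZero ;; IAdd 33 rK rK ;; IAdd 33 33 rOne ;;
  IAdd 33 33 rOne ;; Loop 33 SETUP_body ;;
  IAdd rA 34 rZero ;; IWrite rA rOne.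

(** With an empty cover there are no edges, hence no stars, as lengths and multiplicities are
    positive; the answer is then yes. *)
Definition MAIN : cmd :=
  If rK (SETUP ;; VERTS ;; STARS ;; FINAL) (IConst rOut 1).

Definition statics := [:: rZero; rOne; rK; rC; rG; rF; rN; rQ; rA].

Lemma foldl_nseq (T R : Type) (f : R -> T -> R) x (t : T) j :
  foldl f x (nseq j t) = iter j (fun y => f y t) x.
Proof. by elim: j x => //= j IH x; rewrite IH -iterSr. Qed.

Lemma count_rcons (T : Type) (P : pred T) r x :
  count P (rcons r x) = count P r + P x.
Proof. by rewrite -cats1 count_cat /= addn0. Qed.

Lemma sum_rcons (T : Type) (P : pred T) (F : T -> nat) r x :
  \sum_(i <- rcons r x | P i) F i
  = \sum_(i <- r | P i) F i + (if P x then F x else 0).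
Proof. by rewrite -cats1 big_cat big_cons big_nil /= addn0. Qed.

(** * Invariants and running times of the phases *)

Section Main.

Variables (n : nat) (G : sgraph 'I_n) (d : nat) (s a : 'I_d -> nat).
Variables (cs : seq 'I_n) (Q : nat).
Variables (m : nat -> nat) (pC pG pF : nat).

Let k := size cs.
Let pA := pF + (k + k) + 2.
Let J := Q ^ (k + k).+1.

Hypothesis cs_uniq : uniq cs.
Hypothesis mC : forall i, i < k -> m (pC + i) = nth 0 (map val cs) i.
Hypothesis mG : forall u v : 'I_n, m (pG + 1 + u * n + v) = G u v.
Hypothesis mD : m (pG + 1 + n * n) = d.
Hypothesis mS : forall i : 'I_d, m (pG + 1 + n * n + 1 + i) = s i.
Hypothesis mM : forall i : 'I_d, m (pG + 1 + n * n + 1 + d + i) = a i.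
Hypothesis mW : forall j, j <= (k + k).+1 -> m (pF + j) = Q ^ j.
Hypothesis pC_le : pC + k <= pA.
Hypothesis pG_le : pG + 1 + n * n + 1 + d + d <= pA.
Hypothesis Q_gt0 : 0 < Q.

Definition reg0 (r : nat) : nat :=
  match r with
  | 11 => 1 | 3 => k | 4 => pC | 5 => pG | 6 => pF | 7 => n | 8 => Q | 9 => pA
  | _ => 0
  end.

Definition std (st : state) : Prop :=
  (forall r, r \in statics -> st.1 r = reg0 r) /\
  (forall x, x < pA -> st.2 x = m x).

Lemma std_reg st r : std st -> r \in statics -> st.1 r = reg0 r.
Proof. by move=> h rs; apply: h.1. Qed.

Lemma std_agree w st st' : agree w st st' -> all (fun r => r \notin w) statics ->
  (forall x, x < pA -> st'.2 x = st.2 x) -> std st -> std st'.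
Proof.
move=> ag /allP hw hm [h1 h2]; split=> [r rs|x xA].
  by rewrite ag; [exact: h1 | exact: hw].
by rewrite hm //; apply: h2.
Qed.

Lemma std_prim i st : std st -> ~~ is_write i ->
  all (fun r => r \notin seq_of_opt (writes_reg i)) statics -> std (prim i st).
Proof.
move=> h ni hw; apply: (std_agree _ hw _ h) => [r|]; first exact: prim_frame.
by case: i ni {hw}.
Qed.

Lemma std_below w st st' : agree w st st' -> all (fun r => r \notin w) statics ->
  below st st' -> std st -> std st'.
Proof.
move=> ag hw b h; apply: (std_agree ag hw _ h) => x xA; apply: b.
by rewrite (std_reg h).
Qed.

Definition step_cost := k.+1 * (10 * J + 20) + 2.

Lemma std_PSTEP st L : std st -> holds L st -> st.1 rPa <= J -> st.1 rPb <= J ->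
  ok PSTEP st step_cost (fun st' =>
    holds (stepL L (st.1 rPa, st.1 rPt, st.1 rPb)) st' /\ std st').
Proof.
move=> h hL ha hb.
have P := ok_PSTEP (std_reg h (r := rZero) isT) (std_reg h (r := 11) isT) hL.
apply: (ok_weaken P).
  rewrite (std_reg h (r := 3)) // /step_cost [reg0 _]/= leq_add2r leq_mul2l.
  by apply/orP; right; lia.
by move=> st' ag [h1 h2]; split=> //; apply: (std_below ag isT h2 h).
Qed.

Lemma powJ j : j <= (k + k).+1 -> Q ^ j <= J.
Proof. by move=> jk; rewrite leq_pexp2l. Qed.

Lemma xw_le c : c \in cs -> xw cs Q c <= J.
Proof. by rewrite -index_mem -/k => h; apply: powJ; lia. Qed.

Lemma xv_le v : xv cs Q v <= J.
Proof. by rewrite /xv; case: ifP => // /xw_le. Qed.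

Ltac stat h :=
  try rewrite (std_reg h (r := rZero) isT);
  try rewrite (std_reg h (r := 1) isT);
  try rewrite (std_reg h (r := 3) isT);
  try rewrite (std_reg h (r := 4) isT);
  try rewrite (std_reg h (r := 5) isT);
  try rewrite (std_reg h (r := 6) isT);
  try rewrite (std_reg h (r := 7) isT);
  try rewrite (std_reg h (r := 8) isT);
  try rewrite (std_reg h (r := 9) isT);
  try rewrite (std_reg h (r := 11) isT);
  rewrite ?/(reg0 _) /=.

Lemma ok_FIND st (v : 'I_n) : std st -> st.1 31 = v ->
  ok FIND st (k * 14 + 6) (fun st' =>
    [/\ st'.1 39 = tv cs v, st'.1 40 = xv cs Q v & st'.2 = st.2]).
Proof.
move=> h hv; have -> : k * 14 + 6 = (k * 14).+1.+4.+1 by lia.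
do 5!apply: ok_prim; set s1 := prim _ _.
have h1 : std s1 by do 5!(apply: std_prim => //).
pose I i (st' : state) := [/\ st'.1 39 = (v \notin take i cs),
  st'.1 40 = if v \in take i cs then xw cs Q v else 0,
  st'.1 34 = pC + i, st'.1 35 = pF + 1 + i & st'.2 = st.2].
have e33 : s1.1 33 = k by rewrite /= /upd /=; stat h; rewrite addn0.
have := @ok_loop 33 FIND_body s1 (fun=> 10) I isT isT.
rewrite e33 sum_nat_const card_ord => H.
apply: ok_weaken; first apply: H => [|i st' li ag cnt [i1 i2 i3 i4 i5]].
- by rewrite /I take0 /= /upd /=; stat h; rewrite !addn0.
- have h' : std st'.
    by apply: (std_agree ag isT _ h1) => x xA; rewrite i5.
  have := take_nth v li; set c := nth v cs i => tk.
  have mc : st'.2 (pC + i) = c.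
    by rewrite (h'.2 _ _) ?mC ?(nth_map v) //; lia.
  do 4!apply: ok_prim; set s2 := prim _ _.
  (* The two truncated differences add up to the distance, which vanishes only for c = v. *)
  have e37 : s2.1 37 = (c - v) + (v - c).
    by rewrite /= /upd /= i3 mc; frame; rewrite /= /upd /= hv.
  apply: (ok_seq (t1 := 4) (t2 := 2) (P1 := fun s3 => [/\ s3.1 39 = (v \notin take i.+1 cs),
     s3.1 40 = (if v \in take i.+1 cs then xw cs Q v else 0) & s3.2 = st.2])).
    apply: ok_if => hc.
      have vc : v != c by apply: contraNneq hc => vc; rewrite e37 vc subnn.
      split=> //; rewrite tk mem_rcons inE (negPf vc) /=.
      by split.
    have vc : v = c.
      by apply/val_inj/eqP; rewrite eqn_leq /=; move: hc; rewrite e37; lia.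
    split=> //; rewrite tk mem_rcons inE vc eqxx /=; split=> //.
    rewrite /upd /= i4 (h'.2 _ _); last by rewrite /pA; lia.
    rewrite -addnA mW; last lia.
    by rewrite /xw /c index_uniq // add1n.
  move=> s3 ag3 [j1 j2 j3]; apply: ok_prim; apply: ok_prim1.
  rewrite /I /= /upd /= j1 j2 j3; frame; rewrite /= /upd /=.
  by rewrite i3 i4; stat h'; split=> //; lia.
- by [].
- move=> st' _ [i1 i2 _ _ i5]; rewrite take_size in i1 i2.
  by rewrite i1 i2 i5.
Qed.

Lemma holds_agree w L st st' : agree w st st' -> 3 \notin w -> 9 \notin w ->
  st'.2 = st.2 -> holds L st -> holds L st'.
Proof. by move=> ag w3 w9 e h z; rewrite e !ag //; apply: h. Qed.

Lemma ok_EDGES st (v : 'I_n) L : std st -> holds L st -> st.1 31 = v ->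
  st.1 32 = pG + 1 + v * n -> st.1 39 = tv cs v -> st.1 40 = xv cs Q v ->
  ok EDGES st (k * (step_cost + 18) + 7) (fun st' =>
    [/\ holds (foldl stepL L (edge_ops G cs Q v)) st', std st',
        st'.1 rD = tv cs v * count (handled G cs v) cs
      & st'.1 rT = st.1 rT + \sum_(c <- cs | G v c) xw cs Q c]).
Proof.
move=> h hL hv h32 h39 h40.
have -> : k * (step_cost + 18) + 7 = (k * (step_cost + 18)).+1.+4.+2 by lia.
do 6!apply: ok_prim; set s1 := prim _ _.
have h1 : std s1 by do 6!(apply: std_prim => //).
pose ops r := [seq (xw cs Q c, tv cs v, xv cs Q v) | c <- r & handled G cs v c].
pose I i (st' : state) := [/\ holds (foldl stepL L (ops (take i cs))) st', std st',
  st'.1 rD = tv cs v * count (handled G cs v) (take i cs),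
  st'.1 rT = st.1 rT + \sum_(c <- take i cs | G v c) xw cs Q c
  & st'.1 34 = pC + i /\ st'.1 35 = pF + 1 + i].
have e33 : s1.1 33 = k by rewrite /= /upd /=; stat h; rewrite addn0.
have t13 : s1.1 13 = tv cs v by rewrite /= /upd /=; stat h; rewrite addn0.
have t14 : s1.1 14 = xv cs Q v by rewrite /= /upd /=; stat h; rewrite addn0.
have := @ok_loop 33 EDGES_body s1 (fun=> step_cost + 14) I isT isT.
rewrite e33 sum_nat_const card_ord => H.
apply: ok_weaken; first apply: H => [|i st' li ag cnt [i1 h' i3 i4 [i5 i6]]].
- rewrite /I take0 /= /upd /=; stat h; rewrite !addn0 !big_nil muln0 addn0.
  by split=> //; exact: hL.
- have := take_nth v li; set c := nth v cs i => tk.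
  have cc : c \in cs by exact: mem_nth.
  have mc : st'.2 (pC + i) = c.
    by rewrite (h'.2 _ _) ?mC ?(nth_map v) //; lia.
  have mx : st'.2 (pF + 1 + i) = xw cs Q c.
    rewrite (h'.2 _ _); last by rewrite /pA; lia.
    by rewrite -addnA mW ?/xw ?index_uniq ?add1n //; lia.
  have vn : v * n + c < n * n.
    apply: (@leq_trans (v.+1 * n)); first by rewrite mulSnr ltn_add2l.
    by rewrite leq_mul2r ltn_ord orbT.
  have mg : st'.2 (pG + 1 + v * n + c) = G v c.
    by rewrite (h'.2 _ _) ?mG //; lia.
  have -> : step_cost + 14 = ((step_cost + 1).+2.+2.+3 - 1 + 1 + 2).+4 by lia.
  do 4!apply: ok_prim; set s2 := prim _ _.
  have h2 : std s2 by do 4!(apply: std_prim => //).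
  have hh2 : holds (foldl stepL L (ops (take i cs))) s2 by exact: i1.
  have e36 : s2.1 36 = c by rewrite /= /upd /= i5 mc.
  have e12 : s2.1 12 = xw cs Q c by rewrite /= /upd /= i6 mx.
  have e37 : s2.1 37 = G v c.
    rewrite /= /upd /= i5 mc; frame.
    by rewrite (_ : s1.1 32 = pG + 1 + v * n) ?mg //= /upd /= h32.
  have T2 : s2.1 rT = st.1 rT + \sum_(c <- take i cs | G v c) xw cs Q c by [].
  have D2 : s2.1 rD = tv cs v * count (handled G cs v) (take i cs) by [].
  have v2 : s2.1 31 = v by rewrite /= /upd /=; frame; rewrite /= /upd /=.
  have t2 : s2.1 39 = tv cs v by rewrite /= /upd /=; frame; rewrite /= /upd /=.
  have p2 : s2.1 13 = tv cs v by rewrite /= /upd /=; frame.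
  have q2 : s2.1 14 = xv cs Q v by rewrite /= /upd /=; frame.
  have a2 : s2.1 34 = pC + i by [].
  have b2 : s2.1 35 = pF + 1 + i by [].
  move: (s2) h2 hh2 e36 e12 e37 T2 D2 v2 t2 p2 q2 a2 b2 => {}s2.
  move=> h2 hh2 e36 e12 e37 T2 D2 v2 t2 p2 q2 a2 b2.
  apply: (ok_seq (P1 := fun s3 => [/\ holds (foldl stepL L (ops (take i.+1 cs))) s3, std s3,
    s3.1 rD = tv cs v * count (handled G cs v) (take i.+1 cs)
    & s3.1 rT = st.1 rT + \sum_(c <- take i.+1 cs | G v c) xw cs Q c])).
    rewrite tk count_rcons sum_rcons /ops filter_rcons.
    apply: (ok_le (t := (step_cost + 1).+2.+3.+2)); last lia.
    apply: ok_if => hG.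
      have vc : G v c by move: hG; rewrite e37; case: (G v c).
      rewrite /handled vc /=.
      do 3!apply: ok_prim; set s3 := prim _ _.
      have h3 : std s3 by do 3!(apply: std_prim => //).
      have e38 : s3.1 38 = (v - c) + tv cs v by rewrite /= /upd /= v2 e36 t2.
      have T3 : s3.1 rT = s2.1 rT + xw cs Q c by rewrite /= /upd /= e12.
      apply: ok_if => hc.
        have -> : (v \notin cs) || (c < v).
          by move: hc; rewrite e38 /tv; case: (v \in cs) => //=; lia.
        rewrite map_rcons foldl_rcons.
        rewrite addn1; apply: ok_prim; set s4 := prim _ _.
        have h4 : std s4 by apply: std_prim.
        have := @std_PSTEP s4 (foldl stepL L (ops (take i cs))) h4 hh2.
        have -> : s4.1 12 = xw cs Q c by [].
        have -> : s4.1 14 = xv cs Q v by [].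
        have -> : s4.1 13 = tv cs v by [].
        move=> /(_ (xw_le cc) (xv_le v)) P; apply: (ok_weaken P) => // s5 ag5 [j1 j2].
        split=> //; frame; rewrite /= /upd /=.
          by rewrite D2 t2 mulnDr muln1.
        by rewrite T2 e12 addnA.
      have -> : (v \notin cs) || (c < v) = false.
        by move: hc; rewrite e38 /tv; case: (v \in cs) => //=; lia.
      apply: (ok_le (t := 1)); [apply: ok_prim1|lia].
      split; [exact: hh2 | by apply: std_prim | |].
        by rewrite /= /upd /= D2 addn0.
      by rewrite /= /upd /= T2 e12 addnA.
    have -> : G v c = false by move: hG; rewrite e37; case: (G v c).
    rewrite /handled (_ : G v c = false) /=; last by move: hG; rewrite e37; case: (G v c).
    apply: (ok_le (t := 1)); [apply: ok_prim1|lia].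
    split; [exact: hh2 | by apply: std_prim | |].
      by rewrite /= /upd /= D2 addn0.
    by rewrite /= /upd /= T2 addn0.
  move=> s3 ag3 [j1 j2 j3 j4]; apply: ok_prim; apply: ok_prim1.
  split; [exact: j1 | by do 4!(apply: std_prim => //) | exact: j3 | exact: j4 |].
  rewrite /= /upd /=; stat j2; frame; rewrite a2 b2; lia.
- by rewrite -addnA.
- by move=> st' _ []; rewrite take_size.
Qed.

Lemma ok_SMALL st L : std st -> holds L st ->
  ok SMALL st (k * (k * (step_cost + 4) + 9) + 6) (fun st' =>
    holds (foldl stepL L (star_ops cs Q)) st' /\ std st').
Proof.
move=> h hL.
have -> : k * (k * (step_cost + 4) + 9) + 6 = (k * (k * (step_cost + 4) + 9)).+1.+4.+1 by lia.
do 5!apply: ok_prim; set s1 := prim _ _.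
have h1 : std s1 by do 5!(apply: std_prim => //).
pose ops i := flatten [seq nseq k (0, l, fw cs Q l) | l <- iota 1 i].
pose I i (st' : state) := [/\ holds (foldl stepL L (ops i)) st', std st',
  st'.1 13 = i.+1 & st'.1 35 = pF + k + 1 + i].
have e43 : s1.1 43 = k by rewrite /= /upd /=; stat h; rewrite addn0.
have t12 : s1.1 12 = 0 by rewrite /= /upd /=.
have := @ok_loop 43 SMALL_body s1 (fun=> k * (step_cost + 4) + 5) I isT isT.
rewrite e43 sum_nat_const card_ord => H.
apply: ok_weaken; first apply: H => [|i st' li ag cnt [i1 h' i3 i4]].
- rewrite /I /= /upd /=; stat h; rewrite !addn0; split=> //; exact: hL.
- have mx : st'.2 (pF + k + 1 + i) = fw cs Q i.+1.
    rewrite (h'.2 _ _); last by rewrite /pA; lia.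
    by rewrite -!addnA mW ?/fw ?add1n //; lia.
  have -> : k * (step_cost + 4) + 5 = ((k * (step_cost + 4)).+1 + 2).+2 by lia.
  do 2!apply: ok_prim; set s2 := prim _ _.
  have h2 : std s2 by do 2!(apply: std_prim => //).
  have e44 : s2.1 44 = k by rewrite /= /upd /=; stat h'; rewrite addn0.
  have p2 : s2.1 12 = 0 by rewrite /= /upd /=; frame.
  have q2 : s2.1 13 = i.+1 by rewrite /= /upd /= i3.
  have r2 : s2.1 14 = fw cs Q i.+1 by rewrite /= /upd /= i4 mx.
  pose o := (0, i.+1, fw cs Q i.+1).
  pose I2 j (s3 : state) :=
    holds (iter j (fun L => stepL L o) (foldl stepL L (ops i))) s3 /\ std s3.
  have := @ok_loop 44 PSTEP s2 (fun=> step_cost) I2 isT isT.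
  rewrite e44 sum_nat_const card_ord => H2.
  apply: (ok_seq (P1 := I2 k)).
    apply: H2 => [|j s3 lj ag3 cnt3 [j1 j2]].
      by split=> //; exact: i1.
    have := std_PSTEP j2 j1; frame; rewrite p2 q2 r2.
    have fJ : fw cs Q i.+1 <= J by apply: powJ; rewrite -/k; lia.
    move=> /(_ isT fJ) P; apply: (ok_weaken P) => // s4 ag4 [w1 w2].
    split; first exact: w1.
    by do 2!(apply: std_prim => //).
  move=> s3 ag3 [j1 j2]; apply: ok_prim; apply: ok_prim1.
  split.
  - have E : iota 1 i.+1 = iota 1 i ++ [:: i.+1] by rewrite -{1}[i.+1]addn1 iotaD add1n.
    rewrite /ops E map_cat flatten_cat foldl_cat /= cats0 foldl_nseq.
    exact: j1.
  - by do 4!(apply: std_prim => //).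
  - by rewrite /= /upd /=; stat j2; frame; rewrite q2 addn1.
  - by rewrite /= /upd /=; stat j2; frame; rewrite /= /upd /= i4; lia.
- by rewrite -addnA.
- by move=> st' _ [].
Qed.

Definition vertex_cost := k * 14 + k * (step_cost + 18) + k * (k * (step_cost + 4) + 9) + 7 * k + 40.

Lemma ok_VERT st (v : 'I_n) L : std st -> holds L st -> st.1 31 = v ->
  st.1 32 = pG + 1 + v * n ->
  ok VERT st vertex_cost (fun st' =>
    [/\ holds (runb L (vblock G cs Q v)) st', std st'
      & st'.1 rT = st.1 rT + \sum_(c <- cs | G v c) xw cs Q c]).
Proof.
move=> h hL hv h32.
apply: (ok_le (t := (k * 14 + 6) + ((k * (step_cost + 18) + 7)
   + ((k * (k * (step_cost + 4) + 9) + 6) + (k.+1 * 7 + 5))))); last by rewrite /vertex_cost; lia.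
apply: ok_seq; first exact: ok_FIND h hv.
move=> s1 ag1 [e39 e40 m1].
have h1 : std s1 by apply: (std_agree ag1 isT _ h) => x _; rewrite m1.
have hL1 : holds L s1 by apply: (holds_agree ag1 isT isT m1 hL).
apply: ok_seq.
  by apply: (ok_EDGES h1 hL1 _ _ e39 e40); frame.
move=> s2 ag2 [hL2 h2 d2 t2].
apply: ok_seq; first exact: ok_SMALL h2 hL2.
move=> s3 ag3 [hL3 h3].
have d3 : s3.1 rD = tv cs v * count (handled G cs v) cs by frame.
(* The selected coefficient has degree at most k and degrees only grow, so truncating the polynomial
   above degree k loses nothing. *)
have dk : s3.1 rD <= s3.1 rK.
  rewrite d3; stat h3; rewrite /tv; case: (v \notin cs); rewrite ?mul1n //.
  exact: count_size.
have P := ok_SELECT (std_reg h3 (r := rZero) isT) (std_reg h3 (r := 11) isT) dk hL3.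
apply: (ok_weaken P); first by stat h3.
move=> s4 ag4 [w1 w2]; split.
- by rewrite /runb /vblock /= foldl_cat -d3.
- exact: (std_below ag4 isT w2 h3).
- by rewrite ag4 // ag3 // t2; frame.
Qed.

Lemma ok_VERTS st : std st -> holds [:: (0, 0)] st ->
  ok VERTS st (n * (vertex_cost + 6) + 5) (fun st' =>
    [/\ holds (runbs [seq vblock G cs Q v | v <- enum 'I_n]) st', std st',
        st'.1 rT = \sum_v \sum_(c <- cs | G v c) xw cs Q c
      & st'.1 32 = pG + 1 + n * n]).
Proof.
move=> h hL; have -> : n * (vertex_cost + 6) + 5 = (n * (vertex_cost + 6)).+1.+4 by lia.
do 4!apply: ok_prim; set s1 := prim _ _.
have h1 : std s1 by do 4!(apply: std_prim => //).
pose en := enum 'I_n.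
pose I i (st' : state) :=
  [/\ holds (runbs [seq vblock G cs Q v | v <- take i en]) st', std st',
    st'.1 rT = \sum_(v <- take i en) \sum_(c <- cs | G v c) xw cs Q c,
    st'.1 31 = i & st'.1 32 = pG + 1 + i * n].
have e30 : s1.1 30 = n by rewrite /= /upd /=; stat h; rewrite addn0.
have := @ok_loop 30 VERTS_body s1 (fun=> vertex_cost + 2) I isT isT.
rewrite e30 sum_nat_const card_ord => H.
apply: ok_weaken; first apply: H => [|i st' li ag cnt [i1 h' i3 i4 i5]].
- rewrite /I take0 big_nil /= /upd /=; stat h; rewrite addn0; split=> //; exact: hL.
- have szen : size en = n by rewrite size_enum_ord.
  have tk : take i.+1 en = rcons (take i en) (Ordinal li).
    rewrite (take_nth (Ordinal li)) ?szen //; congr rcons.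
    exact: (nth_ord_enum (Ordinal li) (Ordinal li)).
  apply: ok_seq; first exact: (ok_VERT (v := Ordinal li) h' i1 i4 i5).
  move=> s2 ag2 [w1 w2 w3]; apply: ok_prim; apply: ok_prim1; split.
  - by rewrite tk map_rcons /runbs foldl_rcons.
  - by do 4!(apply: std_prim => //).
  - by rewrite tk sum_rcons -i3.
  - by rewrite /= /upd /=; stat w2; frame; rewrite i4 addn1.
  - by rewrite /= /upd /=; stat w2; frame; rewrite i5 mulSn addnC addnCA addnA; lia.
- by rewrite -addnA.
- move=> st' _ []; rewrite take_oversize; last by rewrite size_enum_ord.
  by move=> w1 w2 w3 w4 w5; split=> //; rewrite w3 big_enum.
Qed.

Definition star_cost := k * (step_cost + 5 * Q + 10) + step_cost + 7 * k + 40.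

Lemma ok_STAR st l L : 0 < k -> l < Q -> std st -> holds L st -> st.1 50 = l ->
  ok STAR st star_cost (fun st' =>
    [/\ holds (runb L (sblock cs Q l)) st', std st'
      & st'.1 rT = st.1 rT + foff cs Q l]).
Proof.
move=> k0 lQ h hL hl.
apply: (ok_le (t := ((step_cost.+1.+4.+2 + ((k * (step_cost + 5 * Q + 10)).+1 +
   (k.+1 * 7 + 5).+1).+2)).+4)); last by rewrite /star_cost; lia.
(* The exponents of a star block are at most (l + 1) Q^(2k), and l < Q; so they stay within J, which
   bounds every shift. *)
have foffJ : foff cs Q l + l * Q ^ k <= J.
  rewrite /J expnS; apply: (@leq_trans (l.+1 * Q ^ (k + k))).
    have Qk i : i <= k + k -> Q ^ i <= Q ^ (k + k) by move=> ik; rewrite leq_pexp2l.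
    rewrite mulSn; apply: leq_add; last by rewrite leq_mul2l Qk ?orbT // leq_addl.
    by rewrite /foff; case: (leqP l (size cs)) => // lk; apply: Qk; rewrite leq_add2l.
  by rewrite leq_mul2r lQ orbT.
do 4!apply: ok_prim; set s1 := prim _ _.
have h1 : std s1 by do 4!(apply: std_prim => //).
have e52 : s1.1 52 = l - k by rewrite /= /upd /= hl; stat h.
have e51 : s1.1 51 = 0 by [].
have e12 : s1.1 12 = 0 by [].
have e13 : s1.1 13 = 1 by [].
have e50 : s1.1 50 = l by [].
have T1 : s1.1 rT = st.1 rT by [].
have hL1 : holds L s1 by exact: hL.
move: (s1) h1 e52 e51 e12 e13 e50 T1 hL1 => {}s1 h1 e52 e51 e12 e13 e50 T1 hL1.
pose L1 := foldl stepL L (if l <= k then [:: (0, 1, 0)] else [::]).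
apply: (ok_seq (P1 := fun s2 => [/\ holds L1 s2, std s2, s2.1 51 = foff cs Q l
   & s2.1 rT = st.1 rT + foff cs Q l])).
  apply: ok_if => hc.
    apply: (ok_le (t := 1)); [apply: ok_prim1|lia].
    have lk : (l <= k) = false by move: hc; rewrite e52; lia.
    rewrite /L1 /foff -/k lk addn0; split=> //.
    exact: std_prim.
  have lk : l <= k by move: hc; rewrite e52; lia.
  do 5!apply: ok_prim; set s2 := prim _ _.
  have h2 : std s2 by do 5!(apply: std_prim => //).
  have hL2 : holds L s2 by exact: hL1.
  have f2 : s2.1 51 = fw cs Q l.
    rewrite /= /upd /= e50; stat h1; rewrite (h1.2 _ _); last by rewrite /pA; lia.
    by rewrite -addnA mW // -/k; lia.
  have T2 : s2.1 rT = s1.1 rT + fw cs Q l by rewrite -f2.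
  have := std_PSTEP h2 hL2.
  have -> : s2.1 12 = 0 by exact: e12.
  have -> : s2.1 13 = 1 by exact: e13.
  have -> : s2.1 14 = 0 by [].
  move=> /(_ isT isT) P; apply: (ok_weaken P) => // s3 ag3 [j1 j2].
  rewrite /L1 /foff -/k lk /=; split=> //; frame; first exact: f2.
  by rewrite T2 T1.
move=> s2 ag2 [hL2 h2 f2 T2].
have {}e12 : s2.1 12 = 0 by frame.
have {}e13 : s2.1 13 = 1 by frame.
have {}e50 : s2.1 50 = l by frame.
do 2!apply: ok_prim; set s3 := prim _ _.
have h3 : std s3 by do 2!(apply: std_prim => //).
have e33 : s3.1 33 = k by rewrite /= /upd /=; stat h2; rewrite addn0.
pose ops r := [seq (0, 1, foff cs Q l + l * xw cs Q c) | c <- r].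
pose I i (st' : state) := [/\ holds (foldl stepL L1 (ops (take i cs))) st', std st',
  st'.1 35 = pF + 1 + i & true].
have := @ok_loop 33 STAR_body s3 (fun=> step_cost + 5 * Q + 6) I isT isT.
rewrite e33 sum_nat_const card_ord => H.
have E6 : step_cost + 5 * Q + 6 + 4 = step_cost + 5 * Q + 10 by lia.
rewrite E6 in H.
apply: (ok_seq (P1 := I k)).
  apply: H => [|i st' li ag cnt [i1 h' i3 _]].
    by rewrite /I take0 /= /upd /=; stat h2; rewrite !addn0; split.
  have c0 : 'I_n by move: li; rewrite /k; case: (cs).
  have := take_nth c0 li; set c := nth c0 cs i => tk.
  have cc : c \in cs by exact: mem_nth.
  have mx : st'.2 (pF + 1 + i) = xw cs Q c.
    rewrite (h'.2 _ _); last by rewrite /pA; lia.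
    by rewrite -addnA mW ?/xw ?index_uniq ?add1n //; lia.
  apply: (ok_le (t := ((5 * l + 3) + (step_cost + 1).+1).+1)); last lia.
  apply: ok_prim; set s4 := prim _ _.
  have h4 : std s4 by apply: std_prim.
  have e50' : s4.1 50 = l by rewrite /= /upd /=; frame; rewrite /= /upd /=.
  have e53 : s4.1 53 = xw cs Q c by rewrite /= /upd /= i3 mx.
  have Pm := @ok_MUL 50 53 s4 (std_reg h4 (r := rZero) isT) isT isT.
  rewrite e50' e53 in Pm.
  apply: (ok_seq Pm) => s5 ag5 [m5 mem5]; apply: ok_prim; set s6 := prim _ _.
  have h5 : std s5 by apply: (std_agree ag5 isT _ h4) => x _; rewrite mem5.
  have h6 : std s6 by apply: std_prim.
  have hL6 : holds (foldl stepL L1 (ops (take i cs))) s6.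
    have : holds (foldl stepL L1 (ops (take i cs))) s5.
      by apply: (holds_agree ag5 isT isT mem5); exact: i1.
    by [].
  have p6 : s6.1 14 = foff cs Q l + l * xw cs Q c.
    by rewrite /= /upd /= m5; frame; rewrite /= /upd /=; frame; rewrite /= /upd /= f2.
  have q6 : s6.1 12 = 0 by rewrite /= /upd /=; frame; rewrite /= /upd /=; frame; rewrite /= /upd /=.
  have r6 : s6.1 13 = 1 by rewrite /= /upd /=; frame; rewrite /= /upd /=; frame; rewrite /= /upd /=.
  have := std_PSTEP h6 hL6; rewrite p6 q6 r6.
  have bd : foff cs Q l + l * xw cs Q c <= J.
    apply: leq_trans foffJ; rewrite leq_add2l leq_mul2l /xw leq_pexp2l ?orbT //.
    by rewrite index_mem.
  move=> /(_ isT bd) P; apply: (ok_seq P) => s7 ag7 [w1 w2]; apply: ok_prim1; split=> //.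
  - by rewrite tk /ops map_rcons foldl_rcons; exact: w1.
  - by do 3!(apply: std_prim => //).
  - rewrite /= /upd /=; stat w2; frame; rewrite /= /upd /=; frame.
    by rewrite /= /upd /= i3; lia.
move=> s4 ag4 [i1 h4 _ _]; rewrite take_size in i1.
apply: ok_prim; set s5 := prim _ _.
have h5 : std s5 by apply: std_prim.
have dk : s5.1 rD <= s5.1 rK by stat h5.
have hL5 : holds (foldl stepL L1 (ops cs)) s5 by exact: i1.
have P := ok_SELECT (std_reg h5 (r := rZero) isT) (std_reg h5 (r := 11) isT) dk hL5.
apply: (ok_weaken P); first by stat h5.
move=> s6 ag6 [w1 w2]; split.
- by rewrite /runb /sblock /= foldl_cat.
- exact: (std_below ag6 isT w2 h5).
- by frame; rewrite /= /upd /=; frame; rewrite /= /upd /= T2.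
Qed.

Lemma ok_STARS st bs : 0 < k -> (forall i, s i < Q) -> std st -> holds (runbs bs) st ->
  st.1 32 = pG + 1 + n * n ->
  ok STARS st ((\sum_i a i) * (star_cost + 4) + 9 * d + 4) (fun st' =>
    [/\ holds (runbs (bs ++ flatten [seq nseq (a i) (sblock cs Q (s i)) | i <- enum 'I_d])) st',
        std st' & st'.1 rT = st.1 rT + \sum_i a i * foff cs Q (s i)]).
Proof.
move=> k0 sQ h hL h32.
apply: (ok_le (t := ((\sum_i a i) * (star_cost + 4) + 9 * d).+1.+3)); last lia.
do 3!apply: ok_prim; set s1 := prim _ _.
have h1 : std s1 by do 3!(apply: std_prim => //).
pose en := enum 'I_d; pose base := pG + 1 + n * n + 1.
have e46 : s1.1 46 = d by rewrite /= /upd /= h32 (h.2 _ _) //; lia.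
have e47 : s1.1 47 = base by rewrite /= /upd /= h32; stat h.
have e48 : s1.1 48 = base + d by rewrite -e46 -e47.
pose B i := nseq (a i) (sblock cs Q (s i)).
pose I i (st' : state) := [/\ holds (runbs (bs ++ flatten (map B (take i en)))) st', std st',
  st'.1 rT = st.1 rT + \sum_(i <- take i en) a i * foff cs Q (s i),
  st'.1 47 = base + i & st'.1 48 = base + d + i].
(* The cost of a round depends on a multiplicity; reading it from memory makes it a function of a
   plain number instead of an ordinal. *)
have := @ok_loop 46 STARS_body s1 (fun i => m (base + d + i) * (star_cost + 4) + 5) I isT isT.
rewrite e46 => H.
apply: ok_weaken; first apply: H => [|i st' li ag cnt [i1 h' i3 i4 i5]].
- rewrite /I take0 big_nil cats0 addn0 e47 e48 !addn0; split=> //; exact: hL.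
- have szen : size en = d by rewrite size_enum_ord.
  pose oi := Ordinal li.
  have tk : take i.+1 en = rcons (take i en) oi.
    rewrite (take_nth oi) ?szen //; congr rcons.
    exact: (nth_ord_enum oi oi).
  have mm : m (base + d + i) = a oi by rewrite (mM oi).
  have ms : m (base + i) = s oi by rewrite (mS oi).
  rewrite mm.
  apply: (ok_le (t := ((a oi * (star_cost + 4)).+1 + 2).+2)); last lia.
  do 2!apply: ok_prim; set s2 := prim _ _.
  have h2 : std s2 by do 2!(apply: std_prim => //).
  have e50 : s2.1 50 = s oi.
    by rewrite /= /upd /= i4 (h'.2 _ _) //; rewrite /base; lia.
  have e49 : s2.1 49 = a oi.
    by rewrite /= /upd /= i5 (h'.2 _ _) //; rewrite /base; lia.
  pose I2 j (s3 : state) := [/\ holds (iter j (fun L => runb L (sblock cs Q (s oi)))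
     (runbs (bs ++ flatten (map B (take i en))))) s3, std s3 &
     s3.1 rT = st'.1 rT + j * foff cs Q (s oi)].
  have := @ok_loop 49 STAR s2 (fun=> star_cost) I2 isT isT.
  rewrite e49 sum_nat_const card_ord => H2.
  apply: (ok_seq (P1 := I2 (a oi))).
    apply: H2 => [|j s3 lj ag3 cnt3 [j1 j2 j3]].
      by split; [exact: i1 | exact: h2 | rewrite addn0].
    have l3 : s3.1 50 = s oi by frame.
    apply: (ok_weaken (ok_STAR k0 (sQ oi) j2 j1 l3)) => // s4 ag4 [w1 w2 w3].
    split; [exact: w1 | by do 2!(apply: std_prim => //) |].
    by rewrite decr_frame // w3 j3 mulSn; lia.
  move=> s3 ag3 [j1 j2 j3]; apply: ok_prim; apply: ok_prim1; split.
  - by rewrite tk map_rcons flatten_rcons catA /runbs foldl_cat foldl_nseq; exact: j1.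
  - by do 4!(apply: std_prim => //).
  - by rewrite tk sum_rcons addnA -i3 -j3.
  - by rewrite /= /upd /=; stat j2; frame; rewrite /= /upd /= i4; lia.
  - by rewrite /= /upd /=; stat j2; frame; rewrite /= /upd /= i5; lia.
- rewrite ltnS big_distrl /= (eq_bigr (fun i => a i * (star_cost + 4) + 9)); last first.
    by move=> i _; rewrite (mM i); lia.
  by rewrite big_split /= sum_nat_const card_ord [d * 9]mulnC.
- move=> st' _ []; rewrite take_oversize; last by rewrite size_enum_ord.
  by move=> w1 w2 w3 _ _; split=> //; rewrite w3 big_enum.
Qed.

Lemma ok_FINAL st L T : std st -> holds L st -> st.1 rT = T ->
  valz L 0 < 2 ^ J -> T + Q <= J ->
  ok FINAL st (J * (5 * J + 20) + 5 * J + 20) (fun st' =>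
    st'.1 rOut <> 0 <-> 2 ^ T <= valz L 0 %% 2 ^ (T + Q)).
Proof.
move=> h hL hT hN TQ; set N := valz L 0 in hN *.
apply: (ok_le (t := (((J * (5 * J + 20)).+1 + ((5 * T + 2) + 2).+1).+4.+3))); last first.
  lia.
do 7!apply: ok_prim; set s1 := prim _ _.
have h1 : std s1 by do 7!(apply: std_prim => //).
have e54 : s1.1 54 = N.
  by rewrite /= /upd /= -[st.1 9]addn0 hL.
have e55 : s1.1 55 = J.
  rewrite /= /upd /=; stat h; rewrite (h.2 _ _); last by rewrite /pA; lia.
  by rewrite -!addnA mW; [congr (Q ^ _); lia | lia].
have e56 : s1.1 56 = J - T - Q by rewrite -e55 -hT; rewrite /= /upd /=; stat h.
have T1 : s1.1 rT = T by [].
move: (s1) h1 e54 e55 e56 T1 => {}s1 h1 e54 e55 e56 T1.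
(* Each round removes one leading bit, until T + Q bits remain. Up to J rounds with a shift of up to
   J each make the quadratic term of the running time. *)
pose I i (st' : state) := [/\ st'.1 54 = N %% 2 ^ (J - i), st'.1 55 = J - i & st'.2 = s1.2].
have := @ok_loop 56 FINAL_body s1 (fun=> 5 * J + 16) I isT isT.
rewrite e56 sum_nat_const card_ord => H.
have E0 : J - (J - T - Q) = T + Q by lia.
apply: (ok_seq (t1 := (J * (5 * J + 20)).+1) (P1 := I (J - T - Q))).
  apply: (ok_le (t := ((J - T - Q) * (5 * J + 16 + 4)).+1)); last first.
    by rewrite ltnS -addnA leq_mul2r; apply/orP; right; lia.
  apply: H => [|i st' li ag cnt [i1 i2 i3]].
    by rewrite /I e54 e55 !subn0 modn_small.
  have h' : std st' by apply: (std_agree ag isT _ h1) => x _; rewrite i3.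
  pose j := J - i.+1.
  have iJ : i < J by apply: leq_trans li _; rewrite -subnDA leq_subr.
  have Ji : J - i = j.+1 by rewrite /j subnSK.
  have jJ : j <= J by exact: leq_subr.
  apply: (ok_le (t := ((5 * j + 2) + (1).+2.+1).+2)); last first.
    by move: (J) jJ; clear; move=> J' jJ; lia.
  do 2!apply: ok_prim; set s2 := prim _ _.
  have h2 : std s2 by do 2!(apply: std_prim => //).
  have e2 : s2.1 55 = j by rewrite /= /upd /= i2 Ji; stat h'; rewrite subn1.
  have S := @ok_SHIFT 57 55 s2 (std_reg h2 (r := rZero) isT) isT isT.
  rewrite e2 in S.
  apply: (ok_seq S) => s3 ag3 [x3 m3].
  have {}x3 : s3.1 57 = 2 ^ j by rewrite x3 /= /upd /= mul1n.
  have n3 : s3.1 54 = N %% 2 ^ j.+1.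
    by frame; rewrite /= /upd /= i1 Ji.
  apply: ok_prim; set s4 := prim _ _.
  have e58 : s4.1 58 = 2 ^ j - N %% 2 ^ j.+1 by rewrite /= /upd /= x3 n3.
  (* A residue below 2^(j+1) needs at most one subtraction of 2^j. *)
  have key : N %% 2 ^ j = if N %% 2 ^ j.+1 < 2 ^ j then N %% 2 ^ j.+1
                          else N %% 2 ^ j.+1 - 2 ^ j.
    have lt := ltn_pmod N (expn_gt0 2 j.+1 : 0 < 2 ^ j.+1).
    have <- : (N %% 2 ^ j.+1) %% 2 ^ j = N %% 2 ^ j by rewrite modn_dvdm // dvdn_exp2l.
    move: lt; rewrite expnS; move: (N %% _) => M; case: (ltnP M (2 ^ j)) => hM lt.
      by rewrite modn_small.
    by rewrite -{1}(subnK hM) modnDr modn_small // ltn_subLR // addnn -mul2n.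
  have J4 : s4.1 55 = j by rewrite /= /upd /=; frame; rewrite e2.
  have M4 : s4.2 = s1.2 by rewrite /= m3 /= i3.
  apply: ok_if => hc; apply: ok_prim1; split=> //.
  - by rewrite /= /upd /= n3 key ifT //; move: hc; rewrite e58 -lt0n subn_gt0.
  - by rewrite /= /upd /= n3 x3 key ifF //; move/eqP: hc; rewrite e58 subn_eq0 leqNgt => /negPf.
move=> s2 ag2 [i1 i2 i3]; rewrite E0 in i1.
apply: ok_prim; set s3 := prim _ _.
have h2 : std s2 by apply: (std_agree ag2 isT _ h1) => x _; rewrite i3.
have h3 : std s3 by apply: std_prim.
have e3 : s3.1 10 = T by rewrite /= /upd /=; frame.
have S := @ok_SHIFT 57 10 s3 (std_reg h3 (r := rZero) isT) isT isT.
rewrite e3 in S.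
apply: (ok_seq S) => s4 ag4 [x4 m4]; apply: ok_prim; apply: ok_prim1.
have h4 : std s4 by apply: (std_agree ag4 isT _ h3) => x _; rewrite m4.
have n4 : s4.1 54 = N %% 2 ^ (T + Q) by frame; rewrite /= /upd /= i1.
have {}x4 : s4.1 57 = 2 ^ T by rewrite x4 /= /upd /= mul1n.
(* The output is the residue minus 2^T - 1, truncated, hence nonzero exactly when the residue
   reaches 2^T. *)
rewrite /= /upd /= n4 x4; stat h4.
have := expn_gt0 2 T; move: (2 ^ T) (N %% _); clear; lia.
Qed.

End Main.

(** * Correctness and running time *)

Definition setup_cost (k J : nat) :=
  5 * k.+1 + 5 * (k.+1 * k.+1) + (k + k).+2 * (5 * J + 10) + 22.

Lemma ok_SETUP st k pC pG pF n Q : st.1 rZero = 0 ->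
  st.1 rK = k -> st.1 rC = pC -> st.1 rG = pG -> st.1 rF = pF ->
  st.2 pG = n -> Q = 2 * (k.+1 * k.+1 * n) -> 0 < Q -> pG < pF ->
  (forall x, pF <= x -> st.2 x = 0) ->
  ok SETUP st (setup_cost k (Q ^ (k + k).+1)) (fun st' =>
    [/\ [/\ st'.1 rZero = 0, st'.1 rOne = 1, st'.1 rN = n, st'.1 rQ = Q
          & st'.1 rA = pF + (k + k) + 2],
        forall x, x < pF -> st'.2 x = st.2 x,
        forall j, j <= (k + k).+1 -> st'.2 (pF + j) = Q ^ j
      & holds [:: (0, 0)] st']).
Proof.
move=> z0 hK hC hG hF hn EQ Q0 GF hz; set J := Q ^ _.
apply: (ok_le (t := (5 * k.+1 + 3 + ((5 * (k.+1 * k.+1) + 3) +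
   (((k + k).+2 * (5 * J + 10)).+1 + 2).+4.+2).+1).+3)); last first.
  by rewrite /setup_cost; lia.
do 3!apply: ok_prim; set s1 := prim _ _.
have e22 : s1.1 22 = k.+1 by rewrite /= /upd /= hK addn1.
have := @ok_MUL 22 22 s1 z0 isT isT; rewrite e22 => S1.
apply: (ok_seq S1) => s2 ag2 [x2 m2]; apply: ok_prim; set s3 := prim _ _.
have e23 : s3.1 23 = k.+1 * k.+1.
  by rewrite /= /upd /= x2; frame; rewrite /= /upd /= z0 addn0.
have e7 : s3.1 7 = n by rewrite /= /upd /=; frame; rewrite /= /upd /= hG hn.
have z3 : s3.1 rZero = 0 by rewrite /= /upd /=; frame.
have := @ok_MUL 23 7 s3 z3 isT isT; rewrite e23 e7 => S3.
apply: (ok_seq S3) => s4 ag4 [x4 m4]; do 6!apply: ok_prim; set s5 := prim _ _.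
have K4 : s4.1 3 = k.
  by frame; rewrite /= /upd /=; frame; rewrite /= /upd /=.
have F4 : s4.1 6 = pF.
  by frame; rewrite /= /upd /=; frame; rewrite /= /upd /=.
have z4 : s4.1 rZero = 0 by frame.
have o4 : s4.1 11 = 1 by frame; rewrite /= /upd /=; frame; rewrite /= /upd /=.
have m5 : s5.2 = st.2 by rewrite /= m4 /= m2.
have Q5 : s5.1 8 = Q by rewrite /= /upd /= x4 EQ; lia.
have e33 : s5.1 33 = (k + k).+2 by rewrite /= /upd /= K4 o4 !addn1.
have e34 : s5.1 34 = pF by rewrite /= /upd /= F4 z4 addn0.
have e57 : s5.1 57 = 1 by rewrite /= /upd /=.
have z5 : s5.1 rZero = 0 by exact: z4.
have o5 : s5.1 11 = 1 by exact: o4.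
have n5 : s5.1 7 = n by rewrite /= /upd /=; frame.
have K5 : s5.1 3 = k by exact: K4.
move: (s5) m5 Q5 e33 e34 e57 z5 o5 n5 K5 => {}s5 m5 Q5 e33 e34 e57 z5 o5 n5 K5.
pose I i (s' : state) := [/\ s'.1 57 = Q ^ i, s'.1 34 = pF + i,
  forall j, j < i -> s'.2 (pF + j) = Q ^ j &
  forall x, x < pF \/ pF + i <= x -> s'.2 x = st.2 x].
have := @ok_loop 33 SETUP_body s5 (fun=> 5 * J + 6) I isT isT.
rewrite e33 sum_nat_const card_ord => H.
apply: (ok_seq (P1 := I (k + k).+2)).
  rewrite -[10]/(6 + 4) addnA; apply: H => [|i s' li ag cnt [i1 i2 i3 i4]].
    by rewrite /I e57 e34 m5 addn0; split.
  have QJ : Q ^ i <= J by rewrite leq_pexp2l.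
  apply: (ok_le (t := ((5 * Q ^ i + 3) + 1).+2)); last first.
    by move: (J) (Q ^ i) QJ; clear; lia.
  do 2!apply: ok_prim; set s6 := prim _ _.
  have e6 : s6.1 57 = Q ^ i by rewrite /= /upd /=.
  have z6 : s6.1 rZero = 0 by rewrite /= /upd /=; frame.
  have q6 : s6.1 8 = Q by rewrite /= /upd /=; frame.
  have := @ok_MUL 57 8 s6 z6 isT isT; rewrite e6 q6 => S6.
  apply: (ok_seq S6) => s7 ag7 [x7 m7]; apply: ok_prim1; split.
  - by rewrite /= /upd /= x7; frame; rewrite z6 addn0 expnSr.
  - by rewrite /= /upd /=; frame; rewrite /= /upd /= i2; frame; rewrite o5; lia.
  - move=> j; rewrite ltnS leq_eqVlt /= m7 /= /upd i1 i2 eqn_add2l.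
    by case: eqP => [-> //|_ /= /i3].
  - move=> x hx; rewrite /= m7 /= /upd i2 ifF; first by apply: i4; lia.
    by apply/eqP; lia.
move=> s6 ag6 [i1 i2 i3 i4]; apply: ok_prim; apply: ok_prim1.
have z6 : s6.1 rZero = 0 by frame.
have o6 : s6.1 11 = 1 by frame.
have A6 : s6.1 34 + s6.1 rZero = pF + (k + k) + 2 by rewrite i2 z6; lia.
split.
- split; rewrite /= /upd /=; [exact: z6 | exact: o6 | by frame | by frame | exact: A6].
- by move=> x xF; rewrite /= /upd /= A6 ifF ?i4; [|left|apply/eqP; lia].
- by move=> j jk; rewrite /= /upd /= A6 ifF ?i3 //; apply/eqP; lia.
- move=> z zk; rewrite /= /upd /= A6 o6 /valz big_cons big_nil /=.
  rewrite -[X in _ == X]addn0 eqn_add2l; case: z zk => //= z zk.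
  by rewrite i4 ?hz //; [lia | right; lia].
Qed.

(** The n vertices make O(k^2) calls of [PSTEP] each and the at most kn stars O(k) each, together
    O(Q) calls of cost O(kJ). With k + 1 <= Q and Q^2 <= J this is O(J^2), like the final
    reduction. *)
Lemma time_bound k n Q J A d : 0 < k -> 0 < n -> Q = 2 * (k.+1 * k.+1 * n) ->
  Q * Q <= J -> A <= k * n -> d <= A ->
  forall step_cost vertex_cost star_cost,
  step_cost = k.+1 * (10 * J + 20) + 2 ->
  vertex_cost = k * 14 + k * (step_cost + 18) + k * (k * (step_cost + 4) + 9) + 7 * k + 40 ->
  star_cost = k * (step_cost + 5 * Q + 10) + step_cost + 7 * k + 40 ->
  setup_cost k J + ((n * (vertex_cost + 6) + 5) + ((A * (star_cost + 4) + 9 * d + 4)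
    + (J * (5 * J + 20) + 5 * J + 20))) <= 100 * (J * J).
Proof.
move=> k0 n0 EQ QJ Akn dA step_cost vertex_cost star_cost EP EV ES.
have sq : 4 * k <= k.+1 * k.+1 by clear; nia.
have Q8 : 8 * k <= Q.
  rewrite EQ -[8]/(2 * 4) -mulnA leq_mul2l /= (leq_trans sq) //.
  exact: leq_pmulr.
have nQ : n * (k.+1 * k.+1) <= Q by rewrite EQ [n * _]mulnC leq_pmull.
have kQ : k.+1 <= Q.
  by apply: leq_trans nQ; rewrite mulnA leq_pmull // muln_gt0 n0.
have knQ : k * n * k.+1 <= Q.
  by apply: leq_trans nQ; rewrite [k * n]mulnC -mulnA leq_mul2l leq_mul2r leqnSn !orbT.
have Q8' : 8 <= Q by apply: leq_trans Q8; rewrite leq_pmulr.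
have QJ8 : 8 * Q <= J by apply: leq_trans QJ; rewrite leq_mul2r Q8' orbT.
have J64 : 64 <= J by apply: leq_trans QJ8; rewrite -[64]/(8 * 8) leq_mul2l Q8' orbT.
have QJ1 : Q <= J by apply: leq_trans QJ8; rewrite leq_pmull.
have P1 : step_cost + 60 <= k.+1 * (12 * J).
  apply: (@leq_trans (k.+1 * (10 * J + 82))); first by rewrite EP; clear; lia.
  by rewrite leq_mul2l; apply/orP; right; clear - J64; lia.
have QP : Q * (step_cost + 60) <= 12 * (J * J).
  apply: (@leq_trans (Q * (k.+1 * (12 * J)))); first by rewrite leq_mul2l P1 orbT.
  apply: (@leq_trans (Q * (Q * (12 * J)))).
    by rewrite leq_mul2l leq_mul2r kQ !orbT.
  by rewrite mulnA [12 * (J * J)]mulnCA leq_mul.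
have V1 : n * (vertex_cost + 6) <= Q * (step_cost + 60).
  apply: (@leq_trans (n * (k.+1 * k.+1) * (step_cost + 60))); last by rewrite leq_mul2r nQ orbT.
  rewrite -mulnA leq_mul2l; apply/orP; right; rewrite EV; clear; nia.
have QQ : Q * Q <= J * J by rewrite leq_mul.
have S1 : A * (star_cost + 4) <= Q * (step_cost + 60) + 5 * (J * J).
  apply: (@leq_trans (k * n * (k.+1 * (step_cost + 5 * Q + 60)))).
    by rewrite leq_mul //; rewrite ES; clear; nia.
  rewrite mulnA; apply: (@leq_trans (Q * (step_cost + 5 * Q + 60))).
    by rewrite leq_mul2r knQ orbT.
  clear - QQ; lia.
have AJ : A <= J.
  apply: leq_trans Akn _; apply: leq_trans QJ1; apply: leq_trans knQ.
  exact: leq_pmulr.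
have JJ : 64 * J <= J * J by rewrite leq_mul2r J64 orbT.
have U1 : setup_cost k J <= 30 * (J * J).
  have kkJ : k.+1 * k.+1 <= J.
    by apply: leq_trans QJ1; apply: leq_trans nQ; apply: leq_pmull.
  have kJ : (k + k).+2 * J <= 2 * (J * J).
    rewrite mulnA leq_mul2r; apply/orP; right; have := leq_trans kQ QJ1; clear; lia.
  have := leq_trans kQ QJ1; rewrite /setup_cost => kJ1.
  have -> : (k + k).+2 * (5 * J + 10) = 5 * ((k + k).+2 * J) + 20 * k.+1.
    by clear; lia.
  clear - kkJ kJ kJ1 JJ J64; lia.
clear - U1 S1 V1 QP AJ dA JJ J64; lia.
Qed.

(** Bounds the total length of the stars by kn, so that n and k alone determine how large Q must
    be. *)
Lemma card_edges_cover n (G : sgraph 'I_n) (cs : seq 'I_n) :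
  (forall u v, G u v -> (u \in cs) || (v \in cs)) ->
  #|edges G| <= size cs * n.
Proof.
move=> cov; pose D := setX [set c in cs] [set: 'I_n].
apply: (@leq_trans #|[set [set p.1; p.2] | p in D]|).
  apply/subset_leq_card/subsetP => e /edgesP[u [v [uv ->]]].
  case/orP: (cov _ _ uv) => h; [|rewrite setUC].
    by apply/imsetP; exists (u, v); rewrite // !inE h.
  by apply/imsetP; exists (v, u); rewrite // !inE h.
apply: leq_trans (leq_imset_card _ _) _; rewrite cardsX cardsT card_ord leq_mul2r.
by rewrite cardsE card_size orbT.
Qed.

Lemma size_blocks n (G : sgraph 'I_n) d (s a : 'I_d -> nat) (cs : seq 'I_n) Q :
  \sum_(b <- blocks G s a cs Q) size b.1
  <= n * (size cs * (size cs).+1) + (\sum_i a i) * (size cs).+1.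
Proof.
rewrite /blocks big_cat /= leq_add //.
  rewrite big_map big_enum /= -[X in X * _]card_ord -sum_nat_const leq_sum // => v _.
  rewrite /vblock size_cat /edge_ops size_map mulnS leq_add //.
    by rewrite size_filter count_size.
  rewrite /star_ops size_flatten /shape -map_comp sumnE big_map.
  by under eq_bigr do rewrite /= size_nseq; rewrite big_const_seq count_predT iter_addn addn0 size_iota.
rewrite big_flatten big_map big_enum /= big_distrl /= leq_sum // => i _.
rewrite big_nseq iter_addn addn0 mulnC leq_mul2l; apply/orP; right.
rewrite /sblock size_cat size_map; case: ifP => _ //=.
Qed.

Lemma valz_runbs bs : valz (runbs bs) 0 = \sum_(w <- [seq p.2 | p <- runbs bs]) 2 ^ w.
Proof.
rewrite /valz big_map big_mkcond /= !big_seq; apply: eq_bigr => -[z w].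
by case/mem_runbs=> ->.
Qed.

Lemma ok_MAIN n (G : sgraph 'I_n) d (s a : 'I_d -> nat) (cs : seq 'I_n)
    st pC pG pF :
  (forall i, 0 < s i) -> (forall i, 0 < a i) -> injective s ->
  \sum_i a i * s i = #|edges G| ->
  uniq cs -> (forall u v, G u v -> (u \in cs) || (v \in cs)) ->
  st.1 rZero = 0 -> st.1 rK = size cs -> st.1 rC = pC -> st.1 rG = pG ->
  st.1 rF = pF ->
  (forall i, i < size cs -> st.2 (pC + i) = nth 0 (map val cs) i) ->
  st.2 pG = n ->
  (forall u v : 'I_n, st.2 (pG + 1 + u * n + v) = G u v) ->
  st.2 (pG + 1 + n * n) = d ->
  (forall i : 'I_d, st.2 (pG + 1 + n * n + 1 + i) = s i) ->
  (forall i : 'I_d, st.2 (pG + 1 + n * n + 1 + d + i) = a i) ->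
  (forall x, pF <= x -> st.2 x = 0) ->
  pC + size cs <= pF -> pG + 1 + n * n + 1 + d + d <= pF ->
  ok MAIN st
    (if size cs == 0 then 3 else
     (100 * (2 * ((size cs).+1 * (size cs).+1 * n)) ^ (4 * size cs + 2)).+2)
    (fun st' => st'.1 rOut <> 0 <-> centred G s a).
Proof.
move=> s0 a0 s_inj sumE ucs cov z0 hK hC hG hF mC mN mG mD mS mM mz lC lG.
set k := size cs in hK lC *; set Q := 2 * _.
have leE : \sum_i a i * s i <= k * n by rewrite sumE; apply: card_edges_cover.
case: (posnP k) => k0.
  rewrite /=.
  apply: (@ok_if _ _ _ _ 1) => [/eqP[]|_]; first by rewrite hK.
  apply: ok_prim1; split=> // _.
  have csN : cs = [::] by apply/size0nil.
  have noG u v : G u v = false by apply/negP => /cov; rewrite csN.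
  have noD (i : 'I_d) : False.
    move: leE; rewrite k0 leqn0 sum_nat_eq0 => /forallP/(_ i).
    by rewrite implyTb muln_eq0 => /orP[/eqP e|/eqP e];
      [move: (a0 i) | move: (s0 i)]; rewrite e.
  exists (fun _ _ => false), (fun _ _ => 0); split=> [u v|i|v].
  - by rewrite noG.
  - by case: (noD i).
  - by rewrite big1 //; apply/esym/eqP; rewrite cards_eq0; apply/eqP/setP => u; rewrite !inE noG.
rewrite /=.
have n0 : 0 < n by rewrite lt0n; apply: contraTneq k0 => n0; rewrite /k; case: (cs) => // -[i]; rewrite n0.
have EQ : Q = 2 * (k.+1 * k.+1 * n) by [].
have Q0 : 0 < Q by rewrite EQ !muln_gt0 n0.
have kn0 : 0 < k * n by rewrite muln_gt0 k0.
have Qk : k * n + 2 * n < Q by rewrite EQ; clear - kn0; nia.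
have Qk2 : n * k + k * n < Q by rewrite EQ; clear - kn0; nia.
have Q1 : 2 * n + \sum_i a i * s i < Q by lia.
have Q2 : n * size cs + \sum_i a i * s i < Q by rewrite -/k; lia.
have sQ i : s i < Q.
  apply: leq_ltn_trans Q1; apply: leq_trans (leq_addl _ _).
  by rewrite (bigD1 i) //= (leq_trans _ (leq_addr _ _)) // leq_pmull.
have leA : \sum_i a i <= \sum_i a i * s i by apply: leq_sum => i _; rewrite leq_pmulr.
have led : d <= \sum_i a i by rewrite -[d in d <= _]card_ord -sum1_card leq_sum.
pose J := Q ^ (k + k).+1.
have QJ : Q * Q <= J by rewrite -[Q * Q]/(Q ^ 2) leq_pexp2l //; clear - k0; lia.
have JJ : J * J = Q ^ (4 * k + 2) by rewrite /J -expnD; congr (Q ^ _); lia.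
have := time_bound k0 n0 EQ QJ (leq_trans leA leE) led (erefl (step_cost cs Q))
  (erefl (vertex_cost cs Q)) (erefl (star_cost cs Q)).
rewrite -JJ => tb.
apply: (ok_le (t := (setup_cost k J +
  ((n * (vertex_cost cs Q + 6) + 5) +
   (((\sum_i a i) * (star_cost cs Q + 4) + 9 * d + 4)
    + (J * (5 * J + 20) + 5 * J + 20)))).+2)); last by rewrite !ltnS.
apply: ok_if => [_|]; last by rewrite hK => e; rewrite e in k0.
have GF : pG < pF by lia.
apply: ok_seq; first exact: (ok_SETUP z0 hK hC hG hF mN EQ Q0 GF mz).
move=> s1 ag1 [[c1 c2 c3 c4 c5] low pw hL].
pose m := s1.2.
have lowm x : x < pF -> m x = st.2 x by apply: low.
have mC' i : i < size cs -> m (pC + i) = nth 0 (map val cs) i.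
  move=> li; rewrite lowm ?mC //; apply: leq_trans lC.
  by rewrite ltn_add2l.
have mG' (u v : 'I_n) : m (pG + 1 + u * n + v) = G u v.
  rewrite lowm ?mG //; have : u * n + v < n * n; last lia.
  apply: (@leq_trans (u.+1 * n)); first by rewrite mulSnr ltn_add2l.
  by rewrite leq_mul2r ltn_ord orbT.
have mD' : m (pG + 1 + n * n) = d by rewrite lowm //; lia.
have mS' (i : 'I_d) : m (pG + 1 + n * n + 1 + i) = s i.
  by rewrite lowm ?mS //; have := ltn_ord i; lia.
have mM' (i : 'I_d) : m (pG + 1 + n * n + 1 + d + i) = a i.
  by rewrite lowm ?mM //; have := ltn_ord i; lia.
have lC' : pC + size cs <= pF + (size cs + size cs) + 2 by rewrite -/k; lia.
have lG' : pG + 1 + n * n + 1 + d + d <= pF + (size cs + size cs) + 2 by lia.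
have h1 : std cs Q m pC pG pF s1.
  split=> // r; rewrite /statics !inE.
  case/or4P=> [/eqP->|/eqP->|/eqP->|/or4P[/eqP->|/eqP->|/eqP->|/or3P[/eqP->|/eqP->|/eqP->]]] //;
    by frame.
apply: ok_seq; first exact: (ok_VERTS ucs mC' mG' mD' pw lC' lG' Q0 h1 hL).
move=> s2 ag2 [hL2 h2 T2 e32].
apply: ok_seq; first exact: (ok_STARS ucs mD' mS' mM' pw lC' lG' Q0 k0 sQ h2 hL2 e32).
move=> s3 ag3 [hL3 h3 T3].
have {}T3 : s3.1 10 = target G s a cs Q by rewrite T3 T2.
set L := runbs _ in hL3.
have EL : L = runbs (blocks G s a cs Q) by [].
pose ws := [seq p.2 | p <- L].
have wsP w : (w \in ws) <-> breach (blocks G s a cs Q) w.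
  split=> [/mapP[[z w'] zw ->]|h]; first by case/mem_runbs: zw.
  by apply/mapP; exists (0, w) => //; apply/mem_runbs.
(* The vertices have at most nk(k + 1) operations, and so have the stars, of which there are at most
   kn. The sum 2nk(k + 1) is below 2n(k + 1)^2, the value of Q. *)
have szL : size ws < 2 ^ Q.
  rewrite size_map EL; apply: leq_ltn_trans (size_runbs _) _.
  rewrite ltn_exp2l //; apply: leq_ltn_trans (size_blocks _ _ _ _ _) _.
  rewrite -/k; apply: (@leq_ltn_trans (n * (k * k.+1) + k * n * k.+1)).
    by rewrite leq_add2l leq_mul2r (leq_trans leA leE) orbT.
  by rewrite EQ; clear - kn0; nia.
have QleJ : Q <= J by apply: leq_trans QJ; rewrite leq_pmull.
(* Fewer than 2^Q terms of exponent at most J - Q sum to less than 2^J, the bound from which the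
   reduction in [FINAL] starts. *)
have valJ : valz L 0 < 2 ^ J.
  rewrite EL valz_runbs -EL -/ws.
  have le w : w \in ws -> w <= J - Q.
    by move/wsP; apply: (breach_blocks_le s0 ucs Q1 Q2).
  have := sum_pow_lt le szL; rewrite subnK //; apply: leq_trans.
  by rewrite -addn1 leq_add2l expn_gt0.
have TJ : target G s a cs Q + Q <= J.
  have := target_le G s0 ucs Q1 Q2; rewrite -/k -/J; lia.
have P := ok_FINAL ucs mD' pw lC' lG' Q0 h3 hL3 T3 valJ TJ.
apply: (ok_weaken P) => // s4 _ ->.
rewrite EL valz_runbs -EL -/ws kron_coef //.
- by rewrite wsP; apply: breach_targetP.
- by move=> w /wsP; apply: breach_blocks_dvd.
- exact: target_dvd.
Qed.

(** * Covers from greedy matchings *)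

(** The input ends after the n^2 entries of the matrix, the dimension and two vectors of that
    length; all cells behind it are free and contain 0. *)
Definition LAYOUT : cmd :=
  IRead rN rG ;; MUL rN rN ;; IConst rOne 1 ;; IAdd 59 rG 25 ;;
  IAdd 59 59 rOne ;; IRead 60 59 ;; IAdd rF 59 rOne ;; IAdd rF rF 60 ;;
  IAdd rF rF 60.

Lemma ok_LAYOUT st pG n d : st.1 rZero = 0 -> st.1 rG = pG -> st.2 pG = n ->
  st.2 (pG + 1 + n * n) = d ->
  ok LAYOUT st (5 * n + 11) (fun st' =>
    [/\ st'.1 rN = n, st'.1 rOne = 1, st'.1 rF = pG + 1 + n * n + 1 + d + d
      & st'.2 = st.2]).
Proof.
move=> z0 hG hn hd.
apply: (ok_le (t := ((5 * n + 3) + 7).+1)); last by lia.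
apply: ok_prim; set s1 := prim _ _.
have e7 : s1.1 7 = n by rewrite /= /upd /= hG.
have := @ok_MUL 7 7 s1 z0 isT isT; rewrite e7 => S1.
apply: (ok_seq S1) => s2 ag2 [x2 m2]; do 6!apply: ok_prim; apply: ok_prim1.
have G2 : s2.1 5 = pG by frame; rewrite /= /upd /=.
have N2 : s2.1 7 = n by frame.
have D2 : s2.2 (pG + n * n + 1) = d by rewrite m2 -hd /= -addnA [n * n + 1]addnC addnA.
by split; rewrite /= /upd /= ?G2 ?x2 ?D2 ?N2 // ?m2 //; lia.
Qed.

(** An array of n marks, starting at the address in register 62, records the matched vertices. If
    neither end of an edge is marked, both are marked and appended at the address in register 63, so
    that the list has the layout of a given cover. *)
Definition GREEDY_body : cmd :=
  IAdd 35 32 34 ;; IRead 36 35 ;;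
  If 36 (IAdd 37 62 31 ;; IAdd 38 62 34 ;; IRead 39 37 ;; IRead 40 38 ;;
         IAdd 39 39 40 ;;
         If 39 (IConst 39 0)
               (IWrite 37 rOne ;; IWrite 38 rOne ;;
                IWrite 63 31 ;; IAdd 63 63 rOne ;;
                IWrite 63 34 ;; IAdd 63 63 rOne ;;
                IAdd rK rK rOne ;; IAdd rK rK rOne))
        (IConst 36 0) ;;
  IAdd 34 34 rOne.

Definition GREEDY_row : cmd :=
  IAdd 33 rN rZero ;; IConst 34 0 ;; Loop 33 GREEDY_body ;;
  IAdd 31 31 rOne ;; IAdd 32 32 rN.

Definition GREEDY : cmd :=
  IAdd 62 rF rZero ;; IAdd rC 62 rN ;; IConst rK 0 ;; IAdd 63 rC rZero ;;
  IAdd 30 rN rZero ;; IConst 31 0 ;; IAdd 32 rG rOne ;;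
  Loop 30 GREEDY_row ;; IAdd rF 63 rZero.

Section Greedy.

Variables (n : nat) (G : sgraph 'I_n) (pG pM : nat) (st : state).
Hypothesis z0 : st.1 rZero = 0.
Hypothesis o0 : st.1 rOne = 1.
Hypothesis hN : st.1 rN = n.
Hypothesis hG : st.1 rG = pG.
Hypothesis hF : st.1 rF = pM.
Hypothesis mG : forall u v : 'I_n, st.2 (pG + 1 + u * n + v) = G u v.
Hypothesis pM_large : pG + 1 + n * n <= pM.
Hypothesis mz : forall x, pM <= x -> st.2 x = 0.

(* L lists the ends of a matching, stated as: every cover contains at least half
   of L. *)
Definition greedy_inv (t : nat) (st' : state) : Prop :=
  exists L : seq 'I_n,
   [/\ [/\ uniq L, forall D, vertex_cover G D -> size L <= 2 * count (mem D) L
         & forall u v : 'I_n, u * n + v < t -> G u v -> (u \in L) || (v \in L)],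
       st'.1 rK = size L /\ st'.1 63 = pM + n + size L
     & [/\ forall x, x < pM -> st'.2 x = st.2 x,
           forall u : 'I_n, st'.2 (pM + u) = (u \in L),
           forall i, i < size L -> st'.2 (pM + n + i) = nth 0 (map val L) i
         & forall x, pM + n + size L <= x -> st'.2 x = 0]].

Lemma greedy_inv_regs t s1 s2 : s2.1 rK = s1.1 rK -> s2.1 63 = s1.1 63 ->
  s2.2 = s1.2 -> greedy_inv t s1 -> greedy_inv t s2.
Proof.
move=> h1 h2 h3 [L [a [b1 b2] c]]; exists L; split=> //.
  by rewrite h1 h2.
by rewrite h3.
Qed.

Lemma ok_GREEDY_body s1 (u v : 'I_n) :
  s1.1 rOne = 1 -> s1.1 31 = u -> s1.1 34 = v -> s1.1 32 = pG + 1 + u * n ->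
  s1.1 62 = pM -> greedy_inv (u * n + v) s1 ->
  ok GREEDY_body s1 22 (fun s2 => s2.1 34 = v.+1 /\ greedy_inv (u * n + v).+1 s2).
Proof.
move=> o1 hu hv h32 h62 [L [[uL cL pL] [kL eL] [m1 m2 m3 m4]]].
(* The matrix is scanned row by row; division with remainder recovers a pair from its position, so
   that one round adds only (u, v). *)
have mv (x y : 'I_n) : x * n + y < (u * n + v).+1 ->
    x * n + y < u * n + v \/ (x = u /\ y = v).
  rewrite ltnS leq_eqVlt => /orP[/eqP e|]; [right|by left].
  have n0 : 0 < n by apply: leq_ltn_trans (ltn_ord u).
  have := congr1 (divn^~ n) e; have := congr1 (modn^~ n) e.
  rewrite !modnMDl !divnMDl // !modn_small // !divn_small // !addn0.
  by move=> /val_inj -> /val_inj ->.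
have uvn : u * n + v < n * n.
  apply: (@leq_trans (u.+1 * n)); first by rewrite mulSnr ltn_add2l.
  by rewrite leq_mul2r ltn_ord orbT.
have mg : s1.2 (s1.1 32 + s1.1 34) = G u v.
  by rewrite h32 hv m1 ?mG //; lia.
apply: (ok_le (t := (17.+2 + 1).+2)) => //.
do 2!apply: ok_prim; set s2 := prim _ _.
have e36 : s2.1 36 = G u v by rewrite /= /upd /= mg.
have same t : (G u v -> (u \in L) || (v \in L)) -> t = (u * n + v).+1 -> greedy_inv t s2.
  move=> h ->; exists L; split=> //; split=> // x y /mv[lt|[-> ->]]; last exact: h.
  exact: pL.
apply: (ok_seq (P1 := fun s3 => s3.1 rOne = 1 /\ greedy_inv (u * n + v).+1 s3)).
  apply: (ok_le (t := (15).+2)) => //; apply: ok_if => hc.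
    have Guv : G u v by move: hc; rewrite e36; case: (G u v).
    do 5!apply: ok_prim; set s3 := prim _ _.
    have e37 : s3.1 37 = pM + u by rewrite /= /upd /= h62 hu.
    have e38 : s3.1 38 = pM + v by rewrite /= /upd /= h62 hv.
    have e39 : s3.1 39 = (u \in L) + (v \in L).
      by rewrite /= /upd /= h62 hu hv !m2.
    have u3 : s3.1 31 = u by exact: hu.
    have v3 : s3.1 34 = v by exact: hv.
    have o3 : s3.1 11 = 1 by exact: o1.
    have k3 : s3.1 3 = size L by exact: kL.
    have p3 : s3.1 63 = pM + n + size L by exact: eL.
    have M3 : s3.2 = s1.2 by [].
    have same3 : ((u \in L) || (v \in L)) -> greedy_inv (u * n + v).+1 s3.
      by move=> h; apply: (greedy_inv_regs (s1 := s2)) => //; apply: same.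
    move: (s3) e37 e38 e39 u3 v3 o3 k3 p3 M3 same3 => {}s3 e37 e38 e39 u3 v3 o3 k3 p3 M3 same3.
    apply: (ok_le (t := 8.+2)) => //; apply: ok_if => hc2.
      apply: (ok_le (t := 1)) => //; apply: ok_prim1; split; first exact: o3.
      apply: (greedy_inv_regs (s1 := s3)) => //; apply: same3.
      by move: hc2; rewrite e39; case: (u \in L); case: (v \in L).
    have [uN vN] : u \notin L /\ v \notin L.
      by move: hc2; rewrite e39; case: (u \in L); case: (v \in L).
    have uv : u != v by apply: contraTneq Guv => ->; rewrite adj_irr.
    do 7!apply: ok_prim; apply: ok_prim1; split; first exact: o3.
    exists (L ++ [:: u; v]); split.
    - split.
      + by rewrite cat_uniq uL /= !inE orbF negb_or uN vN uv.
      (* A cover [D] contains [u] or [v], so the two new members of the list bring at least one new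
         member of [D]. *)
      + move=> D cD; rewrite size_cat count_cat /= mulnDr leq_add ?cL //.
        have /forallP/(_ u)/forallP/(_ v)/implyP/(_ Guv) := cD.
        by case: (u \in D); case: (v \in D).
      + move=> x y /mv[lt g|[-> ->] _]; last by rewrite !mem_cat !inE eqxx !orbT.
        by rewrite !mem_cat; case/orP: (pL _ _ lt g) => ->; rewrite ?orbT.
    - by rewrite /= /upd /= o3 k3 p3 size_cat /=; split; lia.
    have sz : size (L ++ [:: u; v]) = (size L).+2 by rewrite size_cat addn2.
    have memE x : (prim (IAdd 3 3 11) (prim (IAdd 3 3 11) (prim (IAdd 63 63 11)
        (prim (IWrite 63 34) (prim (IAdd 63 63 11) (prim (IWrite 63 31)
        (prim (IWrite 38 11) (prim (IWrite 37 11) s3)))))))).2 x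
      = if x == pM + n + (size L).+1 then val v else
        if x == pM + n + size L then val u else
        if x == pM + v then 1 else if x == pM + u then 1 else s1.2 x.
      by rewrite /= /upd /= o3 p3 u3 v3 e37 e38 M3 -addnA addn1.
    have uln := ltn_ord u; have vln := ltn_ord v.
    split.
    - move=> x xM; rewrite memE !ifF ?m1 //; apply/eqP; lia.
    - move=> x; have xln := ltn_ord x; rewrite memE ifF; last by apply/eqP; lia.
      rewrite ifF; last by apply/eqP; lia.
      rewrite !eqn_add2l m2 mem_cat !inE -!val_eqE /=.
      by case: (_ == v :> nat); case: (_ == u :> nat); rewrite ?orbT ?orbF.
    - move=> i; rewrite sz memE !eqn_add2l map_cat nth_cat size_map => li.
      case: (ltngtP i (size L)) => [lt|gt|->].
      + rewrite ifF; last by apply/eqP; lia.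
        rewrite ifF; last by apply/eqP; lia.
        by rewrite ifF ?m3 //; apply/eqP; lia.
      + have -> : i = (size L).+1 by lia.
        by rewrite eqxx subSnn.
      + by rewrite subnn ifF //; apply/eqP; lia.
    - by move=> x; rewrite sz => hx; rewrite memE !ifF ?m4 //; try (apply/eqP; lia); lia.
  apply: (ok_le (t := 1)) => //; apply: ok_prim1; split; first exact: o1.
  apply: (greedy_inv_regs (s1 := s2)) => //; apply: same => // g.
  by move: hc; rewrite e36 g.
move=> s3 ag3 [o3 g3]; apply: ok_prim1; split.
  by rewrite /= /upd /= o3; frame; rewrite /= /upd /= hv addn1.
exact: (greedy_inv_regs (s1 := s3)).
Qed.

Lemma ok_GREEDY : ok GREEDY st (n * (n * 26 + 9) + 9) (fun st' =>
  exists L : seq 'I_n,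
   [/\ [/\ uniq L, forall D, vertex_cover G D -> size L <= 2 * #|D|
         & forall u v : 'I_n, G u v -> (u \in L) || (v \in L)],
       [/\ st'.1 rK = size L, st'.1 rC = pM + n & st'.1 rF = pM + n + size L]
     & [/\ forall x, x < pM -> st'.2 x = st.2 x,
           forall i, i < size L -> st'.2 (pM + n + i) = nth 0 (map val L) i
         & forall x, pM + n + size L <= x -> st'.2 x = 0]]).
Proof.
apply: (ok_le (t := ((n * (n * 26 + 9)).+1 + 1).+4.+3)); last lia.
do 7!apply: ok_prim; set s1 := prim _ _.
have e62 : s1.1 62 = pM by rewrite /= /upd /= hF z0 addn0.
have e4 : s1.1 4 = pM + n by rewrite /= /upd /= hF z0 addn0 hN.
have e30 : s1.1 30 = n by rewrite /= /upd /= hN z0 addn0.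
have e32 : s1.1 32 = pG + 1 by rewrite /= /upd /= hG o0.
have e11 : s1.1 11 = 1 by exact: o0.
have e7 : s1.1 7 = n by exact: hN.
have e1 : s1.1 1 = 0 by exact: z0.
have e31 : s1.1 31 = 0 by [].
have g1 : greedy_inv 0 s1.
  exists [::]; split=> //; first by rewrite /= /upd /= hF z0 !addn0 hN.
  split=> // [u|x hx]; rewrite /= mz //; first exact: leq_addr.
  by apply: leq_trans hx; rewrite -addnA leq_addr.
move: (s1) e62 e4 e30 e32 e11 e7 e1 e31 g1 => {}s1 e62 e4 e30 e32 e11 e7 e1 e31 g1.
pose I i (s' : state) := [/\ s'.1 31 = i, s'.1 32 = pG + 1 + i * n & greedy_inv (i * n) s'].
have := @ok_loop 30 GREEDY_row s1 (fun=> n * 26 + 5) I isT isT.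
rewrite e30 sum_nat_const card_ord -addnA => H.
apply: (ok_seq (P1 := I n)).
  apply: H => [|i s' li ag cnt [i1 i2 i3]]; first by split; rewrite ?mul0n ?addn0.
  apply: (ok_le (t := ((n * 26).+1 + 2).+2)); last lia.
  do 2!apply: ok_prim; set s2 := prim _ _.
  have e33 : s2.1 33 = n by rewrite /= /upd /=; frame; rewrite e7 e1 addn0.
  pose I2 j (s3 : state) := s3.1 34 = j /\ greedy_inv (i * n + j) s3.
  have := @ok_loop 33 GREEDY_body s2 (fun=> 22) I2 isT isT.
  rewrite e33 sum_nat_const card_ord => H2.
  apply: (ok_seq (P1 := I2 n)).
    apply: H2 => [|j s3 lj ag3 cnt3 [j1 j2]].
      split; first by [].
      by rewrite addn0; apply: (greedy_inv_regs (s1 := s')).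
    have P := @ok_GREEDY_body s3 (Ordinal li) (Ordinal lj).
    apply: (ok_weaken (P _ _ j1 _ _ j2)) => //.
    - by frame; rewrite /= /upd /=; frame.
    - by frame; rewrite /= /upd /=.
    - by frame; rewrite /= /upd /=.
    - by frame; rewrite /= /upd /=; frame.
    - move=> s4 _ [w1 w2]; split; first exact: w1.
      by rewrite addnS; apply: (greedy_inv_regs (s1 := s4)).
  move=> s3 ag3 [j1 j2]; apply: ok_prim; apply: ok_prim1; split.
  - rewrite /= /upd /=; frame; rewrite /= /upd /=; frame.
    by rewrite i1 e11 addn1.
  - rewrite /= /upd /=; frame; rewrite /= /upd /=; frame.
    by rewrite i2 e7 mulSn; lia.
  - by rewrite mulSnr; apply: (greedy_inv_regs (s1 := s3)).
move=> s2 ag2 [_ _ [L [[uL cL pL] [kL eL] [m1 m2 m3 m4]]]]; apply: ok_prim1.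
exists L; split=> //.
- split=> // [D cD|u v uv].
    apply: leq_trans (cL _ cD) _; rewrite leq_mul2l /= -size_filter.
    rewrite -(card_uniqP (filter_uniq _ uL)); apply/subset_leq_card/subsetP => u.
    by rewrite mem_filter => /andP[].
  apply: pL => //; apply: (@leq_trans (u.+1 * n)); first by rewrite mulSnr ltn_add2l.
  by rewrite leq_mul2r ltn_ord orbT.
- by split=> //; rewrite /= /upd /=; frame; rewrite ?eL ?e1 ?addn0.
Qed.

End Greedy.

Definition WITH_COVER : cmd :=
  IRead rK rZero ;; IConst rC 1 ;; IAdd rG rK rC ;; LAYOUT ;; MAIN.

Definition WITHOUT_COVER : cmd := IConst rG 0 ;; LAYOUT ;; GREEDY ;; MAIN.

Lemma wf_WITH_COVER : wf WITH_COVER. Proof. by vm_compute. Qed.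
Lemma wf_WITHOUT_COVER : wf WITHOUT_COVER. Proof. by vm_compute. Qed.

(** * Input layout and final bounds *)

Lemma nth_allpairs (S T : Type) (f : S -> T -> nat) x0 y0 r t i j :
  i < size r -> j < size t ->
  nth 0 [seq f x y | x <- r, y <- t] (i * size t + j)
  = f (nth x0 r i) (nth y0 t j).
Proof.
elim: r i => // x r IH [|i] li lj /=; rewrite nth_cat size_map.
  by rewrite lj (nth_map y0).
by rewrite mulSn ltnNge -addnA leq_addr /= addKn IH.
Qed.

Section Encode.

Variables (x : instance) (pre : seq nat).

Let n := nv x.
Let w := pre ++ encode x.
Let pG := size pre.

Lemma nth_encode j : nth 0 w (pG + j) = nth 0 (encode x) j.
Proof. by rewrite nth_cat ltnNge leq_addr /= addKn. Qed.

Lemma size_adjacency :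
  size [seq nat_of_bool (graph x u v) | u <- enum 'I_(nv x), v <- enum 'I_(nv x)]
  = n * n.
Proof. by rewrite size_allpairs size_enum_ord. Qed.

Lemma encode_nv : nth 0 w pG = n.
Proof. by rewrite -[pG]addn0 nth_encode. Qed.

Lemma encode_adj (u v : 'I_n) : nth 0 w (pG + 1 + u * n + v) = graph x u v.
Proof.
have uvn : u * n + v < n * n.
  apply: (@leq_trans (u.+1 * n)); first by rewrite mulSnr ltn_add2l.
  by rewrite leq_mul2r ltn_ord orbT.
rewrite -!addnA nth_encode add1n /= nth_cat size_adjacency uvn.
have := @nth_allpairs _ _ (fun u v => nat_of_bool (graph x u v)) u v
  (enum 'I_n) (enum 'I_n) u v.
by rewrite size_enum_ord !nth_ord_enum; apply.
Qed.

Lemma nth_tail j : nth 0 w (pG + 1 + n * n + j)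
  = nth 0 (dim x :: lens x ++ mults x) j.
Proof.
by rewrite -!addnA nth_encode add1n [nth _ _ _]/= nth_cat size_adjacency ltnNge
  leq_addr /= addKn.
Qed.

Lemma encode_dim : nth 0 w (pG + 1 + n * n) = dim x.
Proof. by rewrite -[pG + 1 + n * n]addn0 nth_tail. Qed.

Lemma encode_lens (i : 'I_(dim x)) :
  nth 0 w (pG + 1 + n * n + 1 + i) = tnth (lens x) i.
Proof.
rewrite -[_ + 1 + i]addnA nth_tail add1n /= nth_cat size_tuple ltn_ord.
by rewrite (tnth_nth 0).
Qed.

Lemma encode_mults (i : 'I_(dim x)) :
  nth 0 w (pG + 1 + n * n + 1 + dim x + i) = tnth (mults x) i.
Proof.
rewrite -[_ + 1 + _ + i]addnA -[_ + 1 + _]addnA nth_tail add1n /= nth_cat.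
by rewrite size_tuple ltnNge leq_addr /= addKn (tnth_nth 0).
Qed.

Lemma encode_end j : pG + 1 + n * n + 1 + dim x + dim x <= j -> nth 0 w j = 0.
Proof.
move=> h; apply: nth_default; apply: leq_trans h.
rewrite size_cat /encode /= size_cat size_adjacency /= size_cat !size_tuple.
by rewrite -/pG; lia.
Qed.

End Encode.

Lemma size_encode x : nv x * nv x + 2 <= size (encode x).
Proof. by rewrite /encode /= size_cat size_adjacency /=; lia. Qed.

Lemma size_le_bitsize w : size w <= bitsize w.
Proof. by rewrite /bitsize -sum1_size; apply: leq_sum. Qed.

Lemma decides_ok c w (P : Prop) t : wf c ->
  ok c (start w) t (fun s' => s'.1 rOut <> 0 <-> P) ->
  decides_within (compile c) w P t.
Proof. by move=> wc [p ct]; have [h e] := run_compile wc ct; split; rewrite ?e. Qed.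

Lemma computable_ok c (f : nat -> nat) (t : nat -> nat) : wf c ->
  (forall k, ok c (start [:: k]) (t k) (fun s' => s'.1 rOut = f k)) ->
  computable f.
Proof.
move=> wc h; exists (compile c) => k; exists (t k).
by have [p ct] := h k; have [hh e] := run_compile wc ct; split; rewrite ?e.
Qed.

Lemma coverP n (G : sgraph 'I_n) (C : {set 'I_n}) : vertex_cover G C ->
  forall u v, G u v -> (u \in C) || (v \in C).
Proof. by move=> /forallP h u v uv; have /forallP/(_ v)/implyP := h u; apply. Qed.

Lemma min_cover n (G : sgraph 'I_n) : exists2 C, vertex_cover G C & #|C| = vc G.
Proof.
rewrite /vc; case: arg_minnP => [|C cC _]; last by exists C.
by apply/forallP => u; apply/forallP => v; rewrite !inE implybT.
Qed.

Lemma star_decomposable_centred (x : instance) :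
  star_decomposable x <-> centred (graph x) (tnth (lens x)) (tnth (mults x)).
Proof.
have inj : injective (tnth (lens x)) by apply/tuple_uniqP; apply: lens_uniq.
split; first by apply: decomposition_centred => //; apply: sum_lens.
by apply: centred_decomposition => //; apply: lens_gt0.
Qed.

Definition main_cost n k :=
  if k == 0 then 3 else (100 * (2 * (k.+1 * k.+1 * n)) ^ (4 * k + 2)).+2.

Lemma ok_WITH_COVER (x : instance) (C : {set 'I_(nv x)}) :
  vertex_cover (graph x) C ->
  ok WITH_COVER (start (encode_with_cover C)) (5 * nv x + 14 + main_cost (nv x) #|C|)
    (fun s' => s'.1 rOut <> 0 <-> star_decomposable x).
Proof.
move=> cC; set w := encode_with_cover C; set n := nv x; set k := #|C|.
pose pre := k :: [seq val u | u <- enum C].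
have Ew : w = pre ++ encode x by [].
have sp : size pre = k.+1 by rewrite /= size_map -cardE.
apply: (ok_le (t := ((5 * n + 11) + main_cost n k).+3)); last lia.
do 3!apply: ok_prim; set s1 := prim _ _.
have e5 : s1.1 5 = size pre by rewrite sp /= /upd /= addn1.
have e3 : s1.1 3 = k by [].
have e4 : s1.1 4 = 1 by [].
have m1 : s1.2 = fun j => nth 0 w j by [].
have z1 : s1.1 rZero = 0 by [].
have hn : s1.2 (size pre) = n by rewrite m1 Ew encode_nv.
have hd : s1.2 (size pre + 1 + n * n) = dim x by rewrite m1 Ew encode_dim.
move: (s1) e5 e3 e4 m1 z1 hn hd => {}s1 e5 e3 e4 m1 z1 hn hd.
apply: ok_seq; first exact: (ok_LAYOUT z1 e5 hn hd).
move=> s2 ag2 [n2 o2 f2 m2].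
have ek : size (enum C) = k by rewrite -cardE.
have P := @ok_MAIN n (graph x) (dim x) (tnth (lens x)) (tnth (mults x)) (enum C)
  s2 1 (size pre) (size pre + 1 + n * n + 1 + dim x + dim x)
  (@lens_gt0 x) (@mults_gt0 x).
rewrite m2 m1 Ew ek in P.
apply: ok_weaken; first apply: P.
- by apply/tuple_uniqP; apply: lens_uniq.
- exact: sum_lens.
- exact: enum_uniq.
- by move=> u v uv; rewrite !mem_enum; apply: coverP uv.
- by frame.
- by frame.
- by frame.
- by frame.
- exact: f2.
- by move=> i li; rewrite nth_cat sp add1n ltnS li.
- exact: encode_nv.
- exact: encode_adj.
- exact: encode_dim.
- exact: encode_lens.
- exact: encode_mults.
- exact: encode_end.
- by rewrite sp; lia.
- by [].
- by [].
- by move=> s' _ ->; rewrite star_decomposable_centred.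
Qed.

(** The greedy cover may be smaller than twice the minimum, even empty; the summand 3 pays for the
    empty one. *)
Lemma main_cost_mono n k k' : (0 < k -> 0 < n) -> k <= k' ->
  main_cost n k <= 3 + 100 * (2 * (k'.+1 * k'.+1) * n) ^ (4 * k' + 2).
Proof.
rewrite /main_cost => kn kk; case: eqP => [_|/eqP k0]; first exact: leq_addr.
have n0 : 0 < n by apply: kn; rewrite lt0n.
rewrite -addn2 addnC leq_add // leq_mul2l /=.
apply: (@leq_trans ((2 * (k.+1 * k.+1 * n)) ^ (4 * k' + 2))).
  by rewrite leq_pexp2l ?muln_gt0 ?n0 // leq_add2r leq_mul2l kk orbT.
rewrite leq_exp2r ?addn2 // mulnA leq_mul2r leq_mul2l /=; apply/orP; right.
by rewrite leq_mul.
Qed.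

Lemma ok_WITHOUT_COVER (x : instance) :
  let n := nv x in let k := 2 * vc (graph x) in
  ok WITHOUT_COVER (start (encode x))
    (5 * n + 12 + (n * (n * 26 + 9) + 9)
     + (3 + 100 * (2 * (k.+1 * k.+1) * n) ^ (4 * k + 2)))
    (fun s' => s'.1 rOut <> 0 <-> star_decomposable x).
Proof.
move=> n k; set w := encode x.
have Ew : w = [::] ++ encode x by [].
apply: (ok_le (t := ((5 * n + 11) + ((n * (n * 26 + 9) + 9)
  + (3 + 100 * (2 * (k.+1 * k.+1) * n) ^ (4 * k + 2)))).+1)); last by lia.
apply: ok_prim; set s1 := prim _ _.
have e5 : s1.1 5 = 0 by [].
have m1 : s1.2 = fun j => nth 0 w j by [].
have z1 : s1.1 rZero = 0 by [].
have hn : s1.2 0 = n by rewrite m1 Ew (encode_nv x [::]).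
have hd : s1.2 (0 + 1 + n * n) = dim x by rewrite m1 Ew (encode_dim x [::]).
move: (s1) e5 m1 z1 hn hd => {}s1 e5 m1 z1 hn hd.
apply: ok_seq; first exact: (ok_LAYOUT z1 e5 hn hd).
move=> s2 ag2 [n2 o2 f2 m2]; set pM := 0 + 1 + _ + 1 + _ + _ in f2.
have z2 : s2.1 rZero = 0 by frame.
have g2 : s2.1 5 = 0 by frame.
have a2 (u v : 'I_n) : s2.2 (0 + 1 + u * n + v) = graph x u v.
  by rewrite m2 m1 Ew (@encode_adj x [::]).
have l2 : 0 + 1 + n * n <= pM by rewrite /pM; lia.
have e2 j : pM <= j -> s2.2 j = 0 by rewrite m2 m1 Ew; apply: (@encode_end x [::]).
apply: ok_seq; first exact: (ok_GREEDY z2 o2 n2 g2 f2 a2 l2 e2).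
move=> s3 ag3 [L [[uL cL pL] [k3 c3 f3] [b3 l3 e3]]].
have [C cC vcC] := min_cover (graph x).
have Lk : size L <= k by rewrite /k -vcC; apply: cL.
have P := @ok_MAIN n (graph x) (dim x) (tnth (lens x)) (tnth (mults x)) L
  s3 (pM + n) 0 (pM + n + size L) (@lens_gt0 x) (@mults_gt0 x).
apply: ok_weaken; first apply: P.
- by apply/tuple_uniqP; apply: lens_uniq.
- exact: sum_lens.
- exact: uL.
- exact: pL.
- by frame.
- exact: k3.
- exact: c3.
- by frame.
- exact: f3.
- exact: l3.
- by rewrite b3 ?m2 //; rewrite /pM; lia.
- move=> u v; rewrite b3 ?a2 //.
  have : u * n + v < n * n; last by rewrite /pM; lia.
  apply: (@leq_trans (u.+1 * n)); first by rewrite mulSnr ltn_add2l.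
  by rewrite leq_mul2r ltn_ord orbT.
- by rewrite b3 ?m2 //; rewrite /pM; lia.
- move=> i; rewrite b3; last by have := ltn_ord i; rewrite /pM; lia.
  by rewrite m2 m1 Ew (@encode_lens x [::]).
- move=> i; rewrite b3; last by have := ltn_ord i; rewrite /pM; lia.
  by rewrite m2 m1 Ew (@encode_mults x [::]).
- exact: e3.
- by [].
- by rewrite -/pM -addnA leq_addr.
- apply: main_cost_mono Lk; case: (L) => // v _ _; exact: leq_ltn_trans (ltn_ord v).
- by move=> s' _ ->; rewrite star_decomposable_centred.
Qed.

(** For k >= 3 the number 5^k is at least 2(k + 1)^2 and at least 2(4k + 2): the base is at most 5^k
    n <= (n + 5^k)^2, and the doubled exponent still fits. For k = 1 and k = 2 the factor 2(k + 1)^2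
    <= 18 is split off, with exponent at most 10, which gives 18^10; the power of n fits because 4k
    + 2 <= 5^k + k, with equality for k = 1. *)
Lemma power_bound k n : 0 < k -> 0 < n ->
  (2 * (k.+1 * k.+1 * n)) ^ (4 * k + 2)
  <= 18 ^ 10 * ((n + 5 ^ k) ^ (5 ^ k) * n ^ k).
Proof.
move=> k0 n0.
have small c : 0 < c <= 18 -> (c * n) ^ (4 * k + 2) <= c ^ (4 * k + 2) * ((n + 5 ^ k) ^ (5 ^ k) * n ^ k) ->
    4 * k + 2 <= 10 -> (c * n) ^ (4 * k + 2) <= 18 ^ 10 * ((n + 5 ^ k) ^ (5 ^ k) * n ^ k).
  case/andP=> c0 c18 h hk; apply: leq_trans h _; rewrite leq_mul2r; apply/orP; right.
  apply: (@leq_trans (18 ^ (4 * k + 2))); last by rewrite leq_pexp2l.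
  by rewrite leq_exp2r // addn2.
have le_pow e : e <= 5 ^ k + k -> n ^ e <= (n + 5 ^ k) ^ (5 ^ k) * n ^ k.
  move=> h; apply: (@leq_trans (n ^ (5 ^ k + k))); first by rewrite leq_pexp2l.
  rewrite expnD leq_mul2r; apply/orP; right.
  by rewrite leq_exp2r ?expn_gt0 // leq_addr.
case: k k0 small le_pow => [//|[|[|k]]] _ small le_pow.
- rewrite mulnA; apply: small => //.
  by rewrite expnMn leq_mul2l; apply/orP; right; apply: le_pow.
- rewrite mulnA; apply: small => //.
  by rewrite expnMn leq_mul2l; apply/orP; right; apply: le_pow.
clear small le_pow; set K := k.+3.
have A : 2 * (K.+1 * K.+1) <= 5 ^ K.
  rewrite /K; elim: k {K} => [//|k IH]; rewrite expnS.
  apply: (@leq_trans (5 * (2 * (k.+4 * k.+4)))); last by rewrite leq_mul2l IH.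
  by clear; lia.
have B : 2 * (4 * K + 2) <= 5 ^ K.
  rewrite /K; elim: k {K A} => [//|k IH]; rewrite expnS.
  apply: (@leq_trans (5 * (2 * (4 * k.+3 + 2)))); last by rewrite leq_mul2l IH.
  by clear; lia.
apply: (@leq_trans ((n + 5 ^ K) ^ (5 ^ K))); last first.
  by rewrite -[X in X <= _]mul1n leq_mul ?expn_gt0 // leq_pmulr // expn_gt0 n0.
apply: (@leq_trans ((n + 5 ^ K) ^ (2 * (4 * K + 2)))); last first.
  by rewrite leq_pexp2l // addn_gt0 n0.
rewrite expnM leq_exp2r ?addn2 // mulnA -[_ ^ 2]/(_ * _) mulnC.
by rewrite leq_mul ?leq_addr // (leq_trans A) // leq_addl.
Qed.

(** The constant 100 * 18^10 comes from [power_bound]; 21 absorbs 5n + 16, since the bound is at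
    least n and at least 1. For k = 0 the bound is n + 1. *)
Lemma cover_time k n : (0 < k -> 0 < n) ->
  5 * n + 14 + main_cost n k
  <= (100 * 18 ^ 10 + 21) * ((n + 5 ^ k) ^ (5 ^ k) * n ^ k).
Proof.
rewrite /main_cost mulnDl; case: eqP => [-> _|/eqP k0 n0].
  rewrite !expn0 expn1 muln1; apply: leq_trans (leq_addl _ _).
  by move: (n); clear; lia.
rewrite -lt0n in k0; have {}n0 := n0 k0.
have := power_bound k0 n0; set P := _ ^ (4 * k + 2); set X := _ * n ^ k => h.
have nX : n <= X.
  rewrite /X -[n in n <= _]muln1 leq_mul ?expn_gt0 ?n0 //.
  apply: (@leq_trans (n + 5 ^ k)); first exact: leq_addr.
  by rewrite -{1}[n + _]expn1 leq_pexp2l ?expn_gt0 // addn_gt0 n0.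
rewrite -mulnA; have : 100 * P <= 100 * (18 ^ 10 * X) by rewrite leq_mul2l.
by move: (18 ^ 10 * X) => Y; clear - n0 nX; lia.
Qed.

(** A greedy cover has size at most h = 2k. The factor 2(h + 1)^2 <= 2^(2h + 1) = 2^(4k + 1) is
    raised to the power 4h + 2 = 8k + 2, and 2^9 absorbs the numerical constants; a power of two is
    within reach of [SHIFT]. *)
Definition exp_coef (k : nat) : nat := 2 ^ ((4 * k + 1) * (8 * k + 2) + 9).
Definition exp_deg (k : nat) : nat := 8 * k + 2.

Definition EXP_DEG : cmd :=
  IRead 3 rZero ;; IConst 11 1 ;; IAdd 22 3 3 ;; IAdd 22 22 22 ;;
  IAdd 22 22 11 ;; IAdd rOut 22 22.

Definition EXP_COEF : cmd :=
  EXP_DEG ;; MUL 22 rOut ;; IConst 12 9 ;; IAdd 25 25 12 ;;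
  IConst rOut 1 ;; SHIFT rOut 25.

Lemma ok_EXP_DEG k : ok EXP_DEG (start [:: k]) 6 (fun s' =>
  [/\ s'.1 rZero = 0, s'.1 22 = 4 * k + 1 & s'.1 rOut = exp_deg k]).
Proof.
do 5!apply: ok_prim; apply: ok_prim1; split=> //; rewrite /= /upd /= /exp_deg; lia.
Qed.

Lemma computable_exp_deg : computable exp_deg.
Proof.
apply: (@computable_ok EXP_DEG _ (fun=> 6)) => [|k]; first by vm_compute.
by apply: (ok_weaken (ok_EXP_DEG k)) => // s' _ [].
Qed.

Lemma computable_exp_coef : computable exp_coef.
Proof.
apply: (@computable_ok EXP_COEF _ (fun k => 6 + ((5 * (4 * k + 1) + 3)
  + (5 * ((4 * k + 1) * exp_deg k + 9) + 2).+3))) => [|k]; first by vm_compute.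
apply: (ok_seq (ok_EXP_DEG k)) => s1 _ [z1 e22 e0].
have := @ok_MUL 22 rOut s1 z1 isT isT; rewrite e22 e0 => S1.
apply: (ok_seq S1) => s2 ag2 [x2 _]; do 3!apply: ok_prim; set s3 := prim _ _.
have e25 : s3.1 25 = (4 * k + 1) * exp_deg k + 9 by rewrite /= /upd /= x2.
have z3 : s3.1 rZero = 0 by rewrite /= /upd /=; frame.
have := @ok_SHIFT rOut 25 s3 z3 isT isT; rewrite e25 => S3.
apply: (ok_weaken S3) => // s4 _ [-> _].
by rewrite /= /upd /= mul1n.
Qed.

Lemma no_cover_time n v B : n * n + 2 <= B ->
  5 * n + 12 + (n * (n * 26 + 9) + 9)
  + (3 + 100 * (2 * ((2 * v).+1 * (2 * v).+1) * n) ^ (4 * (2 * v) + 2))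
  <= exp_coef v * B ^ exp_deg v.
Proof.
move=> nB; set k := 2 * v.
have -> : exp_deg v = 4 * k + 2 by rewrite /exp_deg /k; lia.
have -> : exp_coef v = 2 ^ 9 * 2 ^ ((2 * k + 1) * (4 * k + 2)).
  by rewrite /exp_coef -expnD; congr (2 ^ _); rewrite /k; lia.
set g := 4 * k + 2; set E := 2 ^ (_ * g).
have nn : n <= n * n by case: (n) => // n'; rewrite leq_pmulr.
have B0 : 0 < B by apply: leq_trans nB; rewrite addn2.
have BBg : B <= B ^ g by rewrite -{1}[B]expn1 leq_pexp2l // /g addn2.
have E0 : 0 < E by rewrite expn_gt0.
have P : (2 * (k.+1 * k.+1) * n) ^ g <= E * B ^ g.
  rewrite expnMn leq_mul //; last first.
    by rewrite leq_exp2r /g ?addn2 // (leq_trans nn) // (leq_trans _ nB) // leq_addr.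
  rewrite /E expnM leq_exp2r /g ?addn2 // expnD mulnC expn1 leq_mul2r /=.
  by rewrite mul2n -addnn expnD leq_mul // ltn_expl.
have Q : B ^ g <= E * B ^ g by rewrite leq_pmull.
(* The encoding has at least n^2 + 2 words, so the quadratic cost of the layout and the matching is
   linear in [B]. *)
have H : 5 * n + 12 + (n * (n * 26 + 9) + 9) + 3 <= 40 * B.
  by move: nB nn; clear; lia.
have gen a b c e : a <= e -> c <= e -> B <= c -> b <= 40 * B ->
  b + 100 * a <= 512 * e by clear; lia.
rewrite -[X in _ <= X]mulnA [X in X <= _]addnA.
exact: (gen _ _ _ _ P Q BBg H).
Qed.
Theorem theorem11 :
  in_XP encode (fun x : instance => vc (graph x)) star_decomposable
  /\
  exists (p : program) (K : nat),
    forall (x : instance) (C : {set 'I_(nv x)}),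
      vertex_cover (graph x) C ->
      #|C| = vc (graph x) ->
      decides_within p (encode_with_cover C) (star_decomposable x)
        (K * ((nv x + 5 ^ vc (graph x)) ^ (5 ^ vc (graph x))
              * nv x ^ vc (graph x))).
Proof.
split.
  exists (compile WITHOUT_COVER), exp_coef, exp_deg.
  split; [exact: computable_exp_coef | exact: computable_exp_deg | move=> x].
  apply: decides_ok; first exact: wf_WITHOUT_COVER.
  apply: (ok_le (ok_WITHOUT_COVER x)); apply: no_cover_time.
  exact: leq_trans (size_encode x) (size_le_bitsize _).
exists (compile WITH_COVER), (100 * 18 ^ 10 + 21) => x C cC vC.
apply: decides_ok; first exact: wf_WITH_COVER.
apply: (ok_le (ok_WITH_COVER cC)); rewrite vC; apply: cover_time.
rewrite -vC => /card_gt0P[u _]; exact: leq_ltn_trans (ltn_ord u).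
Qed.
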